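(* Let $s\in(0,\tfrac12)$. There exists a constant $C>0$, depending only on $s$, such that for every $R\ge2$ and every $E\subset\mathbb{R}^2$ that is a minimizer for the $s$-perimeter in $B_R$, there exists a halfplane $h\subset\mathbb{R}^2$ such that $$\big|(E\,\Delta\, h)\cap B_1\big|\le\frac{C}{R^s},$$ where $E\,\Delta\, h:=(E\setminus h)\cup(h\setminus E)$.
   Context: $B_r$ is the open ball of radius $r$ centered at the origin of $\mathbb{R}^2$, and $|\cdot|$ is Lebesgue measure. A halfplane is a set of the form $\{x\in\mathbb{R}^2: x\cdot\omega<a\}$ with $|\omega|=1$ and $a\in\mathbb{R}$ (not necessarily with the origin on its boundary). Here $n=2$. For disjoint measurable sets $S_1,S_2\subseteq\mathbb{R}^n$ let $I(S_1,S_2):=\iint_{S_1\times S_2}\frac{dx\,dy}{|x-y|^{n+2s}}$, and write $E^c=\mathbb{R}^n\setminus E$. The $s$-perimeter of $E$ in an open set $\Omega$ is $$\mathrm{Per}_s(E,\Omega):=I(E\cap\Omega,E^c\cap\Omega)+I(E\cap\Omega,E^c\setminus\Omega)+I(E\setminus\Omega,E^c\cap\Omega).$$ $E$ is a minimizer for the $s$-perimeter in $\Omega$ if $\mathrm{Per}_s(E,\Omega)<+\infty$ and $\mathrm{Per}_s(E,\Omega)\le\mathrm{Per}_s(F,\Omega)$ for every measurable $F\subseteq\mathbb{R}^n$ with $F\setminus\Omega=E\setminus\Omega$. *)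

(* Defs.v *)
From HB Require Import structures.
From mathcomp Require Import all_boot all_order all_algebra.
From mathcomp Require Import all_classical all_reals all_analysis.

Set Implicit Arguments.
Unset Strict Implicit.
Unset Printing Implicit Defensive.

Import Order.TTheory GRing.Theory Num.Theory.
Import numFieldNormedType.Exports.

Local Open Scope classical_set_scope.
Local Open Scope ring_scope.

(* The product Lebesgue measure on the Borel sets of R * R. *)
Definition borel_area (R : realType) :
    {measure set (measurableTypeR R * measurableTypeR R) -> \bar R} :=
  (@lebesgue_measure R \x @lebesgue_measure R)%E.

(* The carrier is R * R; the sigma-algebra is that of the Lebesgue measurable
   sets, i.e. the Caratheodory measurable sets for the outer measure of
   [borel_area R], which is strictly larger than the Borel one. *)
Definition plane (R : realType) : Type :=
  caratheodory_type (borel_area R)^*%mu.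

HB.instance Definition _ (R : realType) := Measurable.on (plane R).

Section plane_geometry.
Context {R : realType}.
Implicit Types (x y w : plane R) (r a s : R) (S E F h Omega : set (plane R)).

Definition area : set (plane R) -> \bar R :=
  @completed_measure_extension _ _ R (borel_area R).

HB.instance Definition _ := Measure.on area.

Lemma area_sigma_finite : sigma_finite [set: plane R] area.
Proof.
apply: completed_measure_extension_sigma_finite.
have /sigma_finiteP[F [TF ndF Foo]] := sigma_finiteT (@lebesgue_measure R).
exists (fun n => F n `*` F n).
  rewrite -setXTT TF predeqE => -[x y]; split.
    move=> [/= [n _ Fnx] [k _ Fky]]; exists (maxn n k) => //; split.
    - by move: x Fnx; exact/subsetPset/ndF/leq_maxl.
    - by move: y Fky; exact/subsetPset/ndF/leq_maxr.
  by move=> [n _ [/= ? ?]]; split; exists n.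
move=> k; have [mF Fk] := Foo k; split; first exact: measurableX.
by rewrite /= product_measure1E// lte_mul_pinfty// ge0_fin_numE.
Qed.

HB.instance Definition _ :=
  Measure_isSigmaFinite.Build _ _ _ area area_sigma_finite.

(* The canonical norm of R * R is the sup norm, hence these definitions. *)
Definition dotp x y : R := x.1 * y.1 + x.2 * y.2.

Definition enorm x : R := Num.sqrt (dotp x x).

Definition eball r : set (plane R) := [set x | enorm x < r].

Definition halfplane h : Prop :=
  exists w a, enorm w = 1 /\ h = [set x | dotp x w < a].

(* |x - y| ^ -(n + 2s) with n = 2. Since [0 `^ p] is 0 for p != 0, the kernel is
   0 on the diagonal; this is harmless because it is only integrated over
   products of disjoint sets. *)
Definition kernel s (z : plane R * plane R) : R :=
  enorm (z.1.1 - z.2.1, z.1.2 - z.2.2) `^ (- (2 + 2 * s)).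

Definition interaction s S1 S2 : \bar R :=
  (\int[area \x area]_(z in S1 `*` S2) (kernel s z)%:E)%E.

Definition s_perimeter s E Omega : \bar R :=
  (interaction s (E `&` Omega) (~` E `&` Omega)
   + interaction s (E `&` Omega) (~` E `\` Omega)
   + interaction s (E `\` Omega) (~` E `&` Omega))%E.

Definition s_minimizer s Omega E : Prop :=
  [/\ measurable E,
      (s_perimeter s E Omega < +oo)%E &
      forall F, measurable F -> F `\` Omega = E `\` Omega ->
        (s_perimeter s E Omega <= s_perimeter s F Omega)%E].

End plane_geometry.

(* Main.v *)
(* Let E be a minimizer in B_R, v a unit vector, and let E_t be the image of E
   under the diffeomorphism x + t phi(x) v, where phi is a cutoff at scale R.
   The first-order terms of Per(E_t) + Per(E_(-t)) cancel, so that
   Per(E_t) <= (1 + C t^2 / R^2) Per(E), while Per(E) <= C R^(2 - 2s). Comparing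
   with E `&` E_t and E `|` E_t, the submodularity defect of the perimeter bounds
   the product of the areas of E \ E_t and E_t \ E in B_10 by C t^2 R^(-2s).
   Hence for every |w| <= 10 one of E \ (E + w), (E + w) \ E has area at most
   d |w| in B_10, where d = C R^(-s). Turning w to -w exchanges these two sets, so
   at scale d some direction v makes both of them small: E is almost invariant
   along v. In the orthogonal direction E is almost monotone at scale d.
   Cut B_1 into strips of width d parallel to v. A Poincare inequality shows
   that E almost fills or almost misses most strips, and monotonicity orders
   them, whence a halfplane. *)

From HB Require Import structures.
Require Import Defs.
From mathcomp Require Import all_boot all_order all_algebra.
From mathcomp Require Import all_classical all_reals all_analysis measurable_realfun.
From mathcomp Require Import ring lra.

Set Implicit Arguments.
Unset Strict Implicit.
Unset Printing Implicit Defensive.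

Import Order.TTheory GRing.Theory Num.Theory.
Import numFieldNormedType.Exports.

Local Open Scope classical_set_scope.
Local Open Scope ring_scope.

(** Completion shapes the analytic half. A Borel map acts on Lebesgue sets once preimages of null
    sets are null, and the difference of two points need not be measurable on a product of two
    completed planes. Every deformation is therefore brought back to the line: after a rotation,
    itself a product of shears, the cutoff is a product of two trapezoids and the displacement is
    horizontal, so each horizontal line is mapped by an increasing piecewise affine bijection with
    an explicit Jacobian. The rate is a square root: the energy R^(2 - 2s) times the relative error
    (t / R)^2 bounds a product of two areas, so one factor is at most a multiple of t R^(-s). The
    energy bound rests on the finite perimeter of a disc, where s < 1/2 enters. The flux bound
    controls only one of the two differences of E and E + w. The other is still O(|w|), because the
    areas differ by a boundary term; this cruder bound, with no small factor, makes the differences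
    Lipschitz in w and pays for displacements of length at most d. The radii 10, 9, 6, 3, 1 leave
    room for the translations. *)

Notation bplane R := (measurableTypeR R * measurableTypeR R)%type.

(** * Changes of variables *)

Section density_measure.
Context {d : measure_display} {T : measurableType d} {R : realType}.
Variables (mu : {measure set T -> \bar R}) (J : T -> R).
Hypotheses (mJ : measurable_fun setT J) (J0 : forall x, 0 <= J x).

Definition dens (A : set T) : \bar R := (\int[mu]_(x in A) (J x)%:E)%E.

Let dens0 : dens set0 = 0%E.
Proof. by rewrite /dens integral_set0. Qed.

Let dens_ge0 A : (0 <= dens A)%E.
Proof. by apply: integral_ge0 => x _; rewrite lee_fin. Qed.

Let dens_additive : semi_sigma_additive dens.
Proof.
apply: semi_sigma_additive_nng_induced; first exact/measurable_EFinP.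
by move=> x; rewrite lee_fin.
Qed.

HB.instance Definition _ := isMeasure.Build _ _ _ dens dens0 dens_ge0 dens_additive.

Import HBNNSimple.

(** Simple functions and monotone convergence on both sides; on a multiple of an indicator the claim
    is the definition of [dens]. *)
Lemma integral_dens (f : T -> \bar R) : measurable_fun setT f ->
  (forall x, 0 <= f x)%E ->
  (\int[dens]_x f x = \int[mu]_x (f x * (J x)%:E))%E.
Proof.
move=> mf f0; pose h := nnsfun_approx measurableT mf.
have -> : (\int[dens]_x f x)%E = lim ((\int[dens]_x (EFin \o h n) x)%E @[n --> \oo]).
  have fE x : f x = lim ((EFin \o h n) x @[n --> \oo]).
    by apply/esym/cvg_lim => //; apply: cvg_nnsfun_approx.
  under eq_integral => x _ do rewrite fE.
  apply: monotone_convergence => //.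
  - by move=> n; apply/measurable_EFinP; exact/measurable_funP.
  - by move=> n x _ /=; rewrite lee_fin.
  - by move=> x _ a b ab; rewrite lee_fin; exact/lefP/nd_nnsfun_approx.
have -> : (\int[mu]_x (f x * (J x)%:E))%E =
    lim ((\int[mu]_x ((EFin \o h n) x * (J x)%:E))%E @[n --> \oo]).
  have fE x : (f x * (J x)%:E)%E = lim (((EFin \o h n) x * (J x)%:E)%E @[n --> \oo]).
    apply/esym/cvg_lim => //; apply: cvgeZr => //.
    by apply: cvg_nnsfun_approx.
  under eq_integral => x _ do rewrite fE.
  apply: monotone_convergence => //.
  - move=> n; apply: emeasurable_funM; last exact/measurable_EFinP.
    by apply/measurable_EFinP; exact/measurable_funP.
  - by move=> n x _ /=; rewrite mule_ge0// lee_fin.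
  - move=> x _ a b ab; rewrite lee_wpmul2r ?lee_fin//; exact/lefP/nd_nnsfun_approx.
suff E : (fun n => \int[dens]_x (EFin \o h n) x)%E =
    (fun n => \int[mu]_x ((EFin \o h n) x * (J x)%:E))%E by rewrite E.
apply/funext => n /=.
transitivity (\int[dens]_x (\sum_(y \in range (h n))
   (y * \1_(h n @^-1` [set y]) x)%:E))%E.
  by apply: eq_integral => t _; rewrite /= fimfunE -fsumEFin.
have mi (r : R) : measurable (h n @^-1` [set r]).
  by rewrite -[X in measurable X]setTI; exact: measurable_funP.
have indich r : measurable_fun setT (fun x => (r * \1_(h n @^-1` [set r]) x)%:E).
  by apply/measurable_EFinP; apply: measurable_funM => //; exact: measurable_indic.
rewrite ge0_integral_fsum//; last by move=> m y _; exact: nnfun_muleindic_ge0.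
transitivity (\int[mu]_x (\sum_(y \in range (h n))
   ((y * \1_(h n @^-1` [set y]) x)%:E * (J x)%:E)))%E; last first.
  apply: eq_integral => t _; rewrite /= fimfunE -fsumEFin//.
  rewrite ge0_mule_fsuml// => r; exact: nnfun_muleindic_ge0.
rewrite ge0_integral_fsum//; last 2 first.
  - by move=> r; apply: emeasurable_funM => //; exact/measurable_EFinP.
  - by move=> m y _; rewrite mule_ge0 ?lee_fin//; exact: nnfun_muleindic_ge0.
apply: eq_fsbigr => r /[!inE] -[t _ ht].
have r0 : 0 <= r by rewrite -ht.
under eq_integral do rewrite EFinM.
under [RHS]eq_integral do rewrite EFinM -muleA.
have mI : measurable_fun setT (fun x => (\1_(h n @^-1` [set r]) x)%:E : \bar R).
  exact/measurable_EFinP/measurable_indic.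
rewrite (ge0_integralZl _ measurableT mI)//.
rewrite ge0_integralZl//; last by move=> x _; rewrite mule_ge0 ?lee_fin.
  2: by apply: emeasurable_funM => //; exact/measurable_EFinP.
congr (_ * _)%E; rewrite integral_indic// setIT.
transitivity (\int[mu]_(x in h n @^-1` [set r]) (J x)%:E)%E; first by [].
rewrite integral_mkcond.
apply: eq_integral => x _; rewrite patchE indicE.
by case: ifPn => _; rewrite ?mul1e ?mul0e.
Qed.

End density_measure.

(* [T] pushes [J mu] forward to [nu]; for a bijection of the plane, [J] is its
   Jacobian determinant. *)
Definition transports {d1 d2 : measure_display} {T1 : measurableType d1}
    {T2 : measurableType d2} {R : realType} (mu : {measure set T1 -> \bar R})
    (nu : {measure set T2 -> \bar R}) (T : T1 -> T2) (J : T1 -> R) : Prop :=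
  [/\ measurable_fun setT T, measurable_fun setT J, (forall x, 0 <= J x) &
    forall f : T2 -> \bar R, measurable_fun setT f -> (forall x, 0 <= f x)%E ->
      (\int[nu]_y f y = \int[mu]_x (f (T x) * (J x)%:E))%E].

(** The hypothesis on sets identifies [nu] with the image under [T] of the measure of density
    [J]. *)
Lemma transports_set {d1 d2 : measure_display} {T1 : measurableType d1}
    {T2 : measurableType d2} {R : realType} (mu : {measure set T1 -> \bar R})
    (nu : {measure set T2 -> \bar R}) (T : T1 -> T2) (J : T1 -> R) :
  measurable_fun setT T -> measurable_fun setT J -> (forall x, 0 <= J x) ->
  (forall B, measurable B -> nu B = \int[mu]_(x in T @^-1` B) (J x)%:E)%E ->
  transports mu nu T J.
Proof.
move=> mT mJ J0 h; split => // f mf f0.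
transitivity (\int[pushforward (dens mu J) T]_y f y)%E.
  by apply: eq_measure_integral => // A mA _; rewrite h.
rewrite ge0_integral_pushforward// preimage_setT integral_dens//.
  exact: measurableT_comp.
by move=> x; exact: f0.
Qed.

Lemma transports_comp {d1 d2 d3 : measure_display} {T1 : measurableType d1}
    {T2 : measurableType d2} {T3 : measurableType d3} {R : realType}
    (m1 : {measure set T1 -> \bar R}) (m2 : {measure set T2 -> \bar R})
    (m3 : {measure set T3 -> \bar R})
    (S : T1 -> T2) (T : T2 -> T3) (I : T1 -> R) (J : T2 -> R) :
  transports m1 m2 S I -> transports m2 m3 T J ->
  transports m1 m3 (T \o S) (fun x => J (S x) * I x).
Proof.
move=> [mS mI I0 hS] [mT mJ J0 hT]; split.
- exact: measurableT_comp.
- by apply: measurable_funM => //; exact: (measurableT_comp mJ).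
- by move=> x; rewrite mulr_ge0.
- move=> f mf f0; rewrite hT// hS.
  + by apply: eq_integral => x _; rewrite EFinM muleA.
  + by apply: emeasurable_funM; [exact: measurableT_comp|exact/measurable_EFinP].
  + by move=> x; rewrite mule_ge0// lee_fin.
Qed.

(** * Borel approximation of Lebesgue sets and maps of the completed plane *)

Section plane_measure.
Context {R : realType}.

Lemma borel_plane_measurable (A : set (bplane R)) :
  measurable A -> measurable (A : set (plane R)).
Proof. by move=> mA; exact: caratheodory_measurable_mu_ext. Qed.

Lemma area_borel (A : set (bplane R)) :
  measurable A -> area (A : set (plane R)) = borel_area R A.
Proof. by move=> mA; exact: measurable_mu_extE. Qed.

Lemma measurable_plane_id :
  measurable_fun [set: plane R] (fun x : plane R => x : bplane R).
Proof. by move=> _ Y mY; rewrite setTI; exact: borel_plane_measurable. Qed.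

Lemma area_complete (N M : set (plane R)) :
  measurable M -> area M = 0%E -> N `<=` M -> measurable N.
Proof.
move=> mM M0 NM.
have := @measure_is_complete_caratheodory R _ (borel_area R)^*%mu.
by move=> /(_ N); apply; exists M; split.
Qed.

Lemma le_area (A B : set (plane R)) : A `<=` B -> (area A <= area B)%E.
Proof. exact: (@le_mu_ext _ _ _ (borel_area R)). Qed.

Lemma area_bigcup_le (A : (set (plane R))^nat) :
  (area (\bigcup_n A n) <= \sum_(n <oo) area (A n))%E.
Proof. exact: (outer_measure_sigma_subadditive (borel_area R)^*%mu). Qed.

(** The area is an outer measure defined by countable Borel covers: intersect covers whose total
    mass exceeds that of [A] by less than 1/(n + 1). *)
Lemma borel_hull (A : set (plane R)) : exists B : set (bplane R),
  [/\ measurable B, A `<=` B & area (B : set (plane R)) = area A].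
Proof.
have [Aoo|Afin] := eqVneq (area A) +oo%E.
  exists setT; split => //; apply/eqP; rewrite eq_le; apply/andP; split.
    by rewrite Aoo leey.
  exact: le_area.
have A0 : (0 <= area A)%E by exact: mu_ext_ge0.
have {}Afin : area A \is a fin_num by rewrite ge0_fin_numE// ltey.
have inv0 n : (0 < n.+1%:R^-1 :> R) by rewrite invr_gt0.
have coverE n : exists F : (set (bplane R))^nat, @measurable_cover _ (bplane R) A F /\
   (\sum_(0 <= k <oo) borel_area R (F k) < area A + (n.+1%:R^-1)%:E)%E.
  have := Afin; move=> /lb_ereal_inf_adherent => /(_ _ (inv0 n))[_/= [F EF] <-] ?.
  by exists F.
have [F FP] := choice coverE.
have mU n : measurable (\bigcup_k F n k).
  by apply: bigcupT_measurable => k; have [[/(_ k)]] := FP n.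
exists (\bigcap_n \bigcup_k F n k); split.
- exact: bigcapT_measurable.
- by apply: sub_bigcap => n _; have [[_]] := FP n.
- apply/eqP; rewrite eq_le; apply/andP; split; last first.
    by apply: le_area; apply: sub_bigcap => n _; have [[_]] := FP n.
  apply/lee_addgt0Pr => /= _/posnumP[e]; near \oo => n.
  apply: (@le_trans _ _ (area (\bigcup_k F n k : set (plane R)))).
    by apply: le_area; exact: bigcap_inf.
  apply: (le_trans (area_bigcup_le (F n))).
  apply: (@le_trans _ _ (\sum_(0 <= k <oo) borel_area R (F n k))%E).
    apply: lee_nneseries => // k _.
    by rewrite area_borel//; have [[/(_ k)]] := FP n.
  have [_ /ltW h] := FP n; apply: (le_trans h).
  rewrite leeD// lee_fin ltW//.
  by near: n; apply: near_infty_natSinv_lt.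
Unshelve. all: by end_near. Qed.

(** Equal areas give a null difference only when they are finite, so hulls are taken of the pieces
    of a sigma-finite exhaustion and then united. *)
Lemma borel_hull_null (A : set (plane R)) : measurable A ->
  exists B : set (bplane R),
  [/\ measurable B, A `<=` B & area ((B : set (plane R)) `\` A) = 0%E].
Proof.
move=> mA; have [F TF Foo] := @area_sigma_finite R.
pose An n := A `&` F n.
have mAn n : measurable (An n) by apply: measurableI => //; have [] := Foo n.
have [B BP] := choice (fun n => borel_hull (An n)).
have mB n : measurable (B n) by have [] := BP n.
have Bnull n : area ((B n : set (plane R)) `\` An n) = 0%E.
  have [_ AB BA] := BP n.
  have Afin : (area (An n) < +oo)%E.
    by apply: le_lt_trans (Foo n).2; apply: le_area => x [].
  transitivity (area (B n : set (plane R)) - area ((B n : set (plane R)) `&` An n))%E.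
    apply: measureD; [exact: borel_plane_measurable|by []|].
    by apply: le_lt_trans Afin; rewrite -BA.
  by rewrite setIidr// BA subee// ge0_fin_numE// mu_ext_ge0.
exists (\bigcup_n B n); split.
- exact: bigcupT_measurable.
- move=> x Ax; have : (\bigcup_n F n) x by rewrite -TF.
  by move=> [n _ Fx]; exists n => //; have [_ + _] := BP n; apply; split.
- apply/eqP; rewrite eq_le; apply/andP; split; last exact: mu_ext_ge0.
  apply: (@le_trans _ _ (area (\bigcup_n (B n `\` An n)))).
    apply: le_area => x [[n _ Bx] nAx]; exists n => //; split => // -[].
    by [].
  apply: (le_trans (area_bigcup_le _)).
  by rewrite eseries0.
Qed.

(** The inner set is the complement of a hull of the complement. *)
Lemma borel_sandwich (A : set (plane R)) : measurable A ->
  exists B1 B2 : set (bplane R), [/\ measurable B1, measurable B2,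
   B1 `<=` A, A `<=` B2 & borel_area R (B2 `\` B1) = 0%E].
Proof.
move=> mA; have [B2 [mB2 AB2 B20]] := borel_hull_null mA.
have [B1 [mB1 AB1 B10]] := borel_hull_null (measurableC mA).
have m1 : measurable (~` B1) by exact: measurableC.
exists (~` B1), B2; split => //.
  by move=> x B1x; apply: contrapT => nAx; apply: B1x; exact: AB1.
rewrite -area_borel; last exact: measurableD.
apply/eqP; rewrite eq_le; apply/andP; split; last exact: mu_ext_ge0.
apply: (@le_trans _ _ (area ((B2 `\` A) `|` (B1 `\` ~` A)))).
  apply: le_area => x [B2x /= /contrapT B1x].
  by have [Ax|nAx] := pselect (A x); [right; split => // /(_ Ax)|left].
apply: (@le_trans _ _ (area ((B2 : set (plane R)) `\` A) +
    area ((B1 : set (plane R)) `\` ~` A))%E).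
  exact: (outer_measureU2 (borel_area R)^*%mu).
by rewrite B20 B10 adde0.
Qed.

Lemma transports_plane_borel : transports (@area R) (borel_area R)
  (fun x : plane R => x : bplane R) (fun=> 1).
Proof.
apply: transports_set; [exact: measurable_plane_id|exact: measurable_cst| |].
  by move=> x; exact: ler01.
move=> B mB; rewrite integral_cst; last exact: borel_plane_measurable.
by rewrite mul1e -area_borel.
Qed.

Lemma area_integral_borel (f : bplane R -> \bar R) :
  measurable_fun setT f -> (forall x, 0 <= f x)%E ->
  (\int[@area R]_x f x = \int[borel_area R]_x f x)%E.
Proof.
move=> mf f0; have [_ _ _ h] := transports_plane_borel; rewrite h//.
by apply: eq_integral => x _; rewrite mule1.
Qed.

Lemma borel_null_integral (J : bplane R -> R) (N : set (bplane R)) :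
  measurable_fun setT J -> (forall x, 0 < J x) -> measurable N ->
  (\int[borel_area R]_(x in N) (J x)%:E = 0)%E -> borel_area R N = 0%E.
Proof.
move=> mJ J0 mN iN.
have mJN : measurable_fun N (EFin \o J).
  by apply: measurable_funTS; exact/measurable_EFinP.
have : (\int[borel_area R]_(x in N) `|(EFin \o J) x| = 0)%E.
  by rewrite -[RHS]iN; apply: eq_integral => x _; rewrite /= gtr0_norm.
move=> /(ae_eq_integral_abs _ mN mJN) [M [mM M0 NM]].
apply/eqP; rewrite eq_le measure_ge0 andbT -M0 le_measure ?inE//.
move=> x Nx; apply: NM => /= /(_ Nx) [Jx].
by have := J0 x; rewrite Jx ltxx.
Qed.

(** A Lebesgue set is a Borel set plus a subset of a Borel null set; the second part pulls back into
    a null set and is measurable by completeness. *)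
Lemma measurable_plane_map (T : bplane R -> bplane R) :
  measurable_fun setT T ->
  (forall N, measurable N -> borel_area R N = 0%E -> borel_area R (T @^-1` N) = 0%E) ->
  measurable_fun setT (T : plane R -> plane R).
Proof.
move=> mT T0.
have pre B : measurable B -> measurable (T @^-1` B).
  by move=> mB; rewrite -[X in measurable X]setTI; exact: mT.
move=> _ A mA; rewrite setTI.
have [B1 [B2 [mB1 mB2 BA AB B0]]] := borel_sandwich mA.
have mD : measurable (B2 `\` B1) by exact: measurableD.
have -> : T @^-1` A = T @^-1` B1 `|` (T @^-1` A `\` T @^-1` B1).
  by rewrite setDUK//; exact: preimage_subset.
apply: (@measurableU _ (plane R)); first by apply: borel_plane_measurable; apply: pre.
apply: (@area_complete _ (T @^-1` (B2 `\` B1))).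
- by apply: borel_plane_measurable; apply: pre.
- by rewrite area_borel//; [exact: T0|exact: pre].
- by move=> x [/= /AB ? ?]; split.
Qed.

(** Positivity of [J] makes preimages of null sets null, since the integral of [J] over the preimage
    vanishes. The formula passes from Borel to Lebesgue sets by squeezing between Borel sets of
    equal area. *)
Lemma transports_plane (T : bplane R -> bplane R) (J : bplane R -> R) :
  measurable_fun setT T -> measurable_fun setT J -> (forall x, 0 < J x) ->
  (forall B, measurable B ->
    borel_area R B = \int[borel_area R]_(x in T @^-1` B) (J x)%:E)%E ->
  transports (@area R) (@area R) (T : plane R -> plane R) (J : plane R -> R).
Proof.
move=> mT mJ J0 h.
have pre B : measurable B -> measurable (T @^-1` B).
  by move=> mB; rewrite -[X in measurable X]setTI; exact: mT.
have mT' : measurable_fun setT (T : plane R -> plane R).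
  apply: measurable_plane_map => // N mN N0.
  apply: (borel_null_integral mJ J0); first exact: pre.
  by rewrite -h.
have mJ' : measurable_fun setT (J : plane R -> R).
  exact: (measurableT_comp mJ measurable_plane_id).
apply: transports_set => //; first by move=> x; exact: ltW.
have hB (B : set (bplane R)) : measurable B ->
    (area (B : set (plane R)) = \int[@area R]_(x in T @^-1` B) (J x)%:E)%E.
  move=> mB; rewrite area_borel// h// integral_mkcond [RHS]integral_mkcond.
  rewrite area_integral_borel//.
    apply/(measurable_restrictT _ (pre _ mB)).
    by apply: measurable_funTS; exact/measurable_EFinP.
  by move=> x; rewrite patchE; case: ifPn => // _; rewrite lee_fin ltW.
move=> A mA.
have [B1 [B2 [mB1 mB2 BA AB B0]]] := borel_sandwich mA.
have preP (B : set (plane R)) : measurable B -> measurable (T @^-1` B : set (plane R)).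
  by move=> mB; rewrite -[X in measurable X]setTI; exact: mT'.
have mJA (A' : set (plane R)) : measurable_fun A' (fun x : plane R => (J x)%:E).
  by apply: measurable_funTS; exact/measurable_EFinP.
have area12 : area (B2 : set (plane R)) = area (B1 : set (plane R)).
  have B12 : B1 `<=` B2 by exact: subset_trans BA AB.
  rewrite !area_borel// -(setDUK B12) measureU//; last 2 first.
  - exact: measurableD.
  - by rewrite setDE setICA setICr setI0.
  by transitivity (borel_area R B1 + 0)%E; [congr (_ + _)%E; exact: B0|exact: adde0].
apply/eqP; rewrite eq_le; apply/andP; split.
  apply: (le_trans (le_area AB)); rewrite area12 hB//.
  apply: ge0_subset_integral => //.
  - by apply: borel_plane_measurable; apply: pre.
  - exact: preP.
  - by move=> x _; rewrite lee_fin ltW.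
  - exact: preimage_subset.
apply: (@le_trans _ _ (area (B1 : set (plane R)))); last exact: le_area.
rewrite -area12 hB//; apply: ge0_subset_integral => //.
- exact: preP.
- by apply: borel_plane_measurable; apply: pre.
- by move=> x _; rewrite lee_fin ltW.
- exact: preimage_subset.
Qed.

End plane_measure.

(** * Perturbations of the line *)

Section line_change.
Context {R : realType}.
Notation leb := (@lebesgue_measure R).

Lemma lebesgue_itv_oc (c d : R) : c <= d -> leb `]c, d] = (d - c)%:E.
Proof.
move=> cd; rewrite lebesgue_measure_itv /= lte_fin; case: ltP => cd' //.
have -> : c = d by apply/le_anti; rewrite cd.
by rewrite subrr.
Qed.

(** Since [g] is increasing and onto, preimages of intervals ]a, b] are intervals of the same kind,
    and the image of the measure [J dx] agrees with Lebesgue measure on them; this determines it. *)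
Lemma line_density (g J : R -> R) :
  measurable_fun setT g -> measurable_fun setT J -> (forall x, 0 <= J x) ->
  {homo g : x y / x < y} -> (forall v, exists x, g x = v) ->
  (forall c d : R, c <= d -> (\int[leb]_(x in `]c, d]) (J x)%:E = (g d - g c)%:E)%E) ->
  forall B : set (measurableTypeR R), measurable B ->
    leb B = (\int[leb]_(x in g @^-1` B) (J x)%:E)%E.
Proof.
move=> mg mJ J0 gi gs gJ B mB.
have gle : {mono g : x y / x <= y} by exact: le_mono.
have glt : {mono g : x y / x < y} by exact: leW_mono.
apply: (@lebesgue_measure_unique R
  (pushforward (dens leb J) (g : measurableTypeR R -> measurableTypeR R))) => //.
move=> _ [[a b] _ <-] /=; rewrite /pushforward /dens.
have [x ax] := gs a; have [y by_] := gs b.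
rewrite lebesgue_measure_itv /= lte_fin.
have -> : g @^-1` `]a, b]%classic = `]x, y]%classic.
  by apply/seteqP; split => z; rewrite /= !in_itv/= -ax -by_ glt gle.
case: ltP => ab.
  by rewrite gJ ?ax ?by_// -gle ax by_ ltW.
rewrite set_itv_ge ?integral_set0//.
by rewrite bnd_simp -leNgt -gle ax by_.
Qed.

Lemma affine_density (k b : R) : 0 < k ->
  forall B : set (measurableTypeR R), measurable B ->
    leb B = (\int[leb]_(x in (fun x => k * x + b)%R @^-1` B) k%:E)%E.
Proof.
move=> k0; apply: line_density.
- by apply: measurable_funD => //; exact: measurable_funM.
- exact: measurable_cst.
- by move=> _; exact: ltW.
- by move=> x y xy; rewrite ltrD2r ltr_pM2l.
- by move=> v; exists ((v - b) / k); rewrite mulrC divfK ?subrK// gt_eqF.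
- move=> c d cd; rewrite integral_cst// [X in (_ * X)%E](lebesgue_itv_oc cd).
  by rewrite -EFinM; congr (_%:E); ring.
Qed.

Definition clamp (p q x : R) := Num.max p (Num.min x q).

Lemma clampP p q x : p <= q ->
  [\/ x <= p /\ clamp p q x = p, p <= x <= q /\ clamp p q x = x |
      q <= x /\ clamp p q x = q].
Proof.
move=> pq; rewrite /clamp; have [xp|px] := leP x p.
  constructor 1; split => //; apply/max_idPl; rewrite ge_min xp//.
have [xq|qx] := leP x q; last first.
  by constructor 3; split; [exact: ltW|exact/max_idPr].
by constructor 2; split; [rewrite ltW|apply/max_idPr; exact: ltW].
Qed.

Lemma clamp_lipschitz p q x y : p <= q -> `|clamp p q x - clamp p q y| <= `|x - y|.
Proof.
move=> pq.
by case: (clampP x pq) => -[hx ->]; case: (clampP y pq) => -[hy ->];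
  rewrite ?subrr ?normr0 ?normr_ge0 //;
  rewrite ler_norml; have := ler_norm (x - y); have := ler_norm (y - x);
  rewrite (distrC y x); try (move/andP: hx => [? ?]); try (move/andP: hy => [? ?]);
  move=> ? ?; apply/andP; split; lra.
Qed.

Lemma measurable_clamp p q : measurable_fun setT (clamp p q).
Proof. by apply: measurable_maxr => //; exact: measurable_minr. Qed.

(** In other words, [clamp p q] is a primitive of the indicator of ]p, q]; all piecewise affine maps
    below are integrated through it. *)
Lemma lebesgue_itvI (c d p q : R) : c <= d -> p <= q ->
  leb (`]p, q] `&` `]c, d]) = (clamp p q d - clamp p q c)%:E.
Proof.
move=> cd pq.
have -> : `]p, q] `&` `]c, d] = `]Num.max p c, Num.min q d]%classic.
  apply/seteqP; split => x /=; rewrite !in_itv/= gt_max le_min.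
    by move=> [/andP[-> ->] /andP[-> ->]].
  by move=> /andP[/andP[-> ->] /andP[-> ->]].
rewrite lebesgue_measure_itv /= lte_fin -EFinB.
case: (clampP d pq) => -[hd ->]; case: (clampP c pq) => -[hc ->];
  try (move/andP: hd => [? ?]); try (move/andP: hc => [? ?]);
  case: (leP p c) => ?; case: (leP q d) => ?; case: ifP => [|/negbT]; rewrite -?leNgt => ?; congr (_%:E); lra.
Qed.

Lemma bump_density (l k c d : R) : 0 < l -> c <= d ->
  (\int[leb]_(x in `]c, d]) (1 + k * (\1_(`](- (2 * l)), (- l)]) x - \1_(`]l, 2 * l]) x))%:E =
   (d - c + k * ((clamp (- (2 * l)) (- l) d - clamp l (2 * l) d) -
                (clamp (- (2 * l)) (- l) c - clamp l (2 * l) c)))%:E)%E.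
Proof.
move=> l0 cd.
have iI (p q : R) : leb.-integrable `]c, d] (EFin \o \1_(`]p, q])).
  by apply: (@integrableS _ _ _ _ setT) => //; exact: integrable_indic_itv.
have mcd : measurable (`]c, d]%classic : set (measurableTypeR R)) by [].
have i1 : leb.-integrable `]c, d] (EFin \o (fun=> 1 : R)).
  apply: measurable_bounded_integrable => //=; last exact: bounded_cst.
  rewrite lebesgue_measure_itv/=; case: ifP => // _; first by rewrite -EFinB ltry.
pose f : R -> \bar R := fun x => ((\1_(`](- (2 * l)), (- l)]) x)%:E - (\1_(`]l, 2 * l]) x)%:E)%E.
have if_ : leb.-integrable `]c, d] f by exact: (integrableB mcd (iI _ _) (iI _ _)).
have -> : (\int[leb]_(x in `]c, d]) (1 + k * (\1_(`](- (2 * l)), (- l)]) x - \1_(`]l, 2 * l]) x))%:E =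
   \int[leb]_(x in `]c, d]) ((EFin \o (fun=> 1%R : R)) x + (k%:E * f x)))%E.
  by apply: eq_integral => x _; rewrite /f /= -!EFinB -EFinM -EFinD.
rewrite integralD//; last exact: integrableZl.
rewrite integralZl//.
pose P : set R := `](- (2 * l)), (- l)]%classic; pose N : set R := `]l, (2 * l)]%classic.
pose D : set R := `]c, d]%classic.
have -> : (\int[leb]_(x in D) f x = leb (P `&` D) - leb (N `&` D))%E.
  transitivity (\int[leb]_(x in D) (\1_P x)%:E - \int[leb]_(x in D) (\1_N x)%:E)%E.
    exact: (integralB mcd (iI (- (2 * l)) (- l)) (iI l (2 * l))).
  by congr (_ - _)%E; apply: integral_indic; exact: measurable_itv.
have h1 : - (2 * l) <= - l by lra.
have h2 : l <= 2 * l by lra.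
rewrite /P /N /D (lebesgue_itvI cd h1) (lebesgue_itvI cd h2).
rewrite integral_cst// [X in (_ * X)%E](lebesgue_itv_oc cd).
rewrite mul1e -EFinB -EFinM -EFinD; congr (_%:E); ring.
Qed.

(* The trapezoid equal to 1 on [-l, l], to 0 outside [-2l, 2l], and affine in
   between. *)
Definition trap (l x : R) : R :=
  (clamp (- (2 * l)) (- l) x - clamp l (2 * l) x + 3 * l) / l.

Lemma trap_ge0 (l x : R) : 0 < l -> 0 <= trap l x.
Proof.
move=> l0; apply: divr_ge0; last exact: ltW.
have h1 : - (2 * l) <= - l by lra.
have h2 : l <= 2 * l by lra.
by case: (clampP x h1) => -[hd ->]; case: (clampP x h2) => -[hc ->];
  try (move/andP: hd => [? ?]); try (move/andP: hc => [? ?]); lra.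
Qed.

Lemma trap_le1 (l x : R) : 0 < l -> trap l x <= 1.
Proof.
move=> l0; rewrite ler_pdivrMr//.
have h1 : - (2 * l) <= - l by lra.
have h2 : l <= 2 * l by lra.
by case: (clampP x h1) => -[hd ->]; case: (clampP x h2) => -[hc ->];
  try (move/andP: hd => [? ?]); try (move/andP: hc => [? ?]); lra.
Qed.

Lemma trap_eq1 (l x : R) : 0 < l -> `|x| <= l -> trap l x = 1.
Proof.
move=> l0; rewrite ler_norml => /andP[x1 x2].
have h1 : - (2 * l) <= - l by lra.
have h2 : l <= 2 * l by lra.
rewrite /trap; suff -> : clamp (- (2 * l)) (- l) x - clamp l (2 * l) x + 3 * l = l.
  by rewrite divff// gt_eqF.
by case: (clampP x h1) => -[hd ->]; case: (clampP x h2) => -[hc ->];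
  try (move/andP: hd => [? ?]); try (move/andP: hc => [? ?]); lra.
Qed.

Lemma trap_eq0 (l x : R) : 0 < l -> 2 * l <= `|x| -> trap l x = 0.
Proof.
move=> l0; rewrite ler_normr => hx.
have h1 : - (2 * l) <= - l by lra.
have h2 : l <= 2 * l by lra.
rewrite /trap; suff -> : clamp (- (2 * l)) (- l) x - clamp l (2 * l) x + 3 * l = 0 by rewrite mul0r.
by case/orP: hx => hx; case: (clampP x h1) => -[hd ->]; case: (clampP x h2) => -[hc ->];
  try (move/andP: hd => [? ?]); try (move/andP: hc => [? ?]); lra.
Qed.

Lemma trap_lipschitz (l x y : R) : 0 < l -> `|trap l x - trap l y| <= 2 / l * `|x - y|.
Proof.
move=> l0.
have h1 : - (2 * l) <= - l by lra.
have h2 : l <= 2 * l by lra.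
rewrite /trap -mulrBl normrM (gtr0_norm (_ : 0 < l^-1)) ?invr_gt0//.
rewrite mulrAC ler_pM2r ?invr_gt0//.
have := clamp_lipschitz x y h1; have := clamp_lipschitz x y h2.
set a := clamp _ _ x; set b := clamp _ _ y; set a' := clamp _ _ x; set b' := clamp _ _ y => u v.
have -> : a' - a + 3 * l - (b' - b + 3 * l) = (a' - b') - (a - b) by ring.
apply: (le_trans (ler_normB _ _)); lra.
Qed.

Lemma measurable_trap l : measurable_fun setT (trap l).
Proof.
apply: measurable_funM => //; apply: measurable_funD => //.
by apply: measurable_funB; exact: measurable_clamp.
Qed.

Lemma continuous_lipschitz (f : R -> R) (k : R) :
  (forall x y, `|f x - f y| <= k * `|x - y|) -> continuous f.
Proof.
move=> h x; apply/cvgrPdist_le => e e0 /=.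
have k0 : 0 < `|k| + 1 by rewrite ltr_wpDl.
near=> y; apply: (le_trans (h _ _)).
apply: (@le_trans _ _ ((`|k| + 1) * `|x - y|)).
  by rewrite ler_wpM2r// (le_trans (ler_norm _))// lerDl.
rewrite -ler_pdivlMl//; near: y.
by apply: cvgr_dist_le; [exact: cvg_id|rewrite mulr_gt0 ?invr_gt0].
Unshelve. all: by end_near. Qed.

Definition bump_map (l k x : R) : R := x + k * trap l x.

(** The derivative of [bump_map l k], with its values at the corners fixed by half-open
    intervals. *)
Definition bump_jac (l k x : R) : R :=
  1 + k / l * (\1_(`](- (2 * l)), (- l)]) x - \1_(`]l, 2 * l]) x).

(** The trapezoid is 2/l-Lipschitz, so the bound on [k] makes the perturbation of the identity
    1/2-Lipschitz. *)
Lemma bump_map_incr (l k : R) : 0 < l -> `|k| <= l / 4 ->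
  {homo bump_map l k : x y / x < y}.
Proof.
move=> l0 kl x y xy; rewrite /bump_map.
have h := trap_lipschitz x y l0.
have : `|k * (trap l x - trap l y)| <= 1 / 2 * (y - x).
  rewrite normrM; apply: (@le_trans _ _ ((l / 4) * (2 / l * `|x - y|))).
    by apply: ler_pM.
  rewrite distrC gtr0_norm ?subr_gt0//.
  have -> : l / 4 * (2 / l * (y - x)) = 1 / 2 * (y - x) by field; rewrite gt_eqF.
  by [].
rewrite ler_norml => /andP[]; lra.
Qed.

Lemma bump_map_surj (l k v : R) : 0 < l -> exists x, bump_map l k x = v.
Proof.
move=> l0.
have kv : v - `|k| <= v + `|k| by have := normr_ge0 k; lra.
have ct : continuous (bump_map l k).
  apply: (@continuous_lipschitz _ (1 + `|k| * (2 / l))) => x y.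
  rewrite /bump_map.
  have -> : x + k * trap l x - (y + k * trap l y) = (x - y) + k * (trap l x - trap l y) by ring.
  rewrite (le_trans (ler_normD _ _))// mulrDl mul1r lerD2l normrM -mulrA.
  by rewrite ler_wpM2l// trap_lipschitz.
(* Points move by at most |k|, so [v] lies between the values at v - |k| and v + |k|. *)
have [||x _ hx] := @IVT R (bump_map l k) (v - `|k|) (v + `|k|) v kv.
- by apply: continuous_subspaceT => x; exact: ct.
- have hk z : `|k * trap l z| <= `|k|.
    rewrite normrM ler_piMr// ger0_norm ?trap_ge0//; exact: trap_le1.
  have := hk (v - `|k|); have := hk (v + `|k|); rewrite !ler_norml /bump_map.
  move=> /andP[? ?] /andP[? ?]; rewrite ge_min le_max; apply/andP; split; apply/orP; [left|right]; lra.
- by exists x.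
Qed.

Lemma bump_jac_bound (l k x : R) : 0 < l -> `|bump_jac l k x - 1| <= `|k| / l.
Proof.
move=> l0; rewrite /bump_jac addrAC subrr add0r normrM normrM.
rewrite (gtr0_norm (_ : 0 < l^-1)) ?invr_gt0//; apply: ler_piMr.
  by rewrite mulr_ge0// invr_ge0 ltW.
by rewrite !indicE; case: (_ \in _) => /=; case: (_ \in _) => /=;
  rewrite ?subrr ?subr0 ?sub0r ?normrN ?normr1 ?normr0 ?ler01.
Qed.

Lemma bump_map_density (l k : R) : 0 < l -> `|k| <= l / 4 ->
  forall B : set (measurableTypeR R), measurable B ->
    leb B = (\int[leb]_(x in bump_map l k @^-1` B) (bump_jac l k x)%:E)%E.
Proof.
move=> l0 kl; apply: line_density.
- by apply: measurable_funD => //; apply: measurable_funM => //; exact: measurable_trap.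
- apply: measurable_funD => //; apply: measurable_funM => //.
  by apply: measurable_funB; exact: measurable_indic.
- move=> x; have := bump_jac_bound k x l0; rewrite ler_norml => /andP[+ _].
  have : `|k| / l <= 1 / 4 by rewrite ler_pdivrMr// mulrC mulrA mulr1.
  lra.
- exact: bump_map_incr.
- by move=> v; exact: bump_map_surj.
- move=> c d cd; rewrite bump_density//; congr (_%:E).
  by rewrite /bump_map /trap; field; rewrite gt_eqF.
Qed.

End line_change.

(** * Area-preserving maps and localized translations of the plane *)

Section plane_maps.
Context {R : realType}.
Notation leb := (@lebesgue_measure R).

Lemma borel_area_ysection (B : set (bplane R)) : measurable B ->
  (borel_area R B = \int[leb]_y leb (ysection B y))%E.
Proof.
move=> mB; transitivity (\int[borel_area R]_z (\1_B z)%:E)%E.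
  by rewrite integral_indic// setIT.
rewrite /borel_area fubini_tonelli2//; last exact/measurable_EFinP/measurable_indic.
apply: eq_integral => y _; rewrite /fubini_G.
transitivity (\int[leb]_x (\1_(ysection B y) x)%:E)%E.
  by apply: eq_integral => x _; rewrite !indicE mem_ysection.
by rewrite integral_indic ?setIT//; exact: measurable_ysection.
Qed.

(** By Tonelli, a map that preserves every horizontal line needs only a change of variables on each
    line. *)
Lemma transports_fiber (G J : bplane R -> R) :
  measurable_fun setT G -> measurable_fun setT J -> (forall z, 0 < J z) ->
  (forall y (B : set (measurableTypeR R)), measurable B ->
    (leb B = \int[leb]_(x in (fun x => G (x, y)) @^-1` B) (J (x, y))%:E)%E) ->
  transports (@area R) (@area R) (fun z : plane R => (G z, z.2) : plane R)
    (J : plane R -> R).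
Proof.
move=> mG mJ J0 h.
have mT : measurable_fun setT (fun z : bplane R => (G z, z.2) : bplane R).
  by apply: measurable_fun_pair => //; exact: measurable_snd.
apply: (@transports_plane R (fun z => (G z, z.2)) J) => // B mB.
rewrite borel_area_ysection// [RHS]integral_mkcond /borel_area fubini_tonelli2; last 2 first.
  - have mTB : measurable ((fun z : bplane R => (G z, z.2) : bplane R) @^-1` B).
      by rewrite -[X in measurable X]setTI; exact: mT.
    apply/(measurable_restrictT _ mTB).
    by apply: measurable_funTS; exact/measurable_EFinP.
  - by move=> z; rewrite patchE; case: ifPn => // _; rewrite lee_fin ltW.
apply: eq_integral => y _; rewrite (h y); last exact: measurable_ysection.
rewrite integral_mkcond; apply: eq_integral => x _; rewrite !patchE.
by congr (if _ then _ else _); apply/idP/idP; rewrite !inE /= /ysection /= inE.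
Qed.

Definition mpres (T : plane R -> plane R) := transports (@area R) (@area R) T (fun=> 1).

Lemma mpres_comp S T : mpres S -> mpres T -> mpres (T \o S).
Proof.
move=> hS hT; have := transports_comp hS hT.
by rewrite /mpres; congr transports; apply/funext => x; rewrite mulr1.
Qed.

Lemma transports_area d (T1 : measurableType d) d2 (T2 : measurableType d2)
    (mu : {measure set T1 -> \bar R}) (nu : {measure set T2 -> \bar R}) T J A :
  transports mu nu T J -> measurable A ->
  (nu A = \int[mu]_(x in T @^-1` A) (J x)%:E)%E.
Proof.
move=> [mT mJ J0 h] mA.
transitivity (\int[nu]_x (\1_A x)%:E)%E; first by rewrite integral_indic// setIT.
rewrite h; last 2 first.
  - exact/measurable_EFinP/measurable_indic.
  - by move=> z; rewrite lee_fin.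
rewrite [RHS]integral_mkcond; apply: eq_integral => x _; rewrite patchE indicE.
rewrite (_ : (x \in T @^-1` A) = (T x \in A)); last first.
  by apply/idP/idP; rewrite !inE.
by case: ifPn => _; rewrite ?mul1e ?mul0e.
Qed.

Lemma mpres_area T A : mpres T -> measurable A -> area (T @^-1` A) = area A.
Proof.
move=> hT mA; rewrite (transports_area hT mA) integral_cst ?mul1e//.
by have [mT _ _ _] := hT; rewrite -[X in measurable X]setTI; exact: mT.
Qed.

Definition hshear (m : R) (z : plane R) : plane R := (z.1 + m * z.2, z.2).

Lemma mpres_hshear m : mpres (hshear m).
Proof.
apply: (@transports_fiber (fun z => z.1 + m * z.2) (fun=> 1)) => //.
  apply: measurable_funD; first exact: measurable_fst.
  by apply: measurable_funM => //; exact: measurable_snd.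
move=> y B mB; rewrite (affine_density (m * y) ltr01 mB).
by congr (integral _ _ _); apply/seteqP; split => x /=; rewrite mul1r.
Qed.

Definition pswap (z : plane R) : plane R := (z.2, z.1).

Lemma mpres_pswap : mpres pswap.
Proof.
have mS : measurable_fun setT (fun z : bplane R => (z.2, z.1) : bplane R).
  by apply: measurable_fun_pair; [exact: measurable_snd|exact: measurable_fst].
apply: (@transports_plane R (fun z => (z.2, z.1)) (fun=> 1)) => // B mB.
have mSB : measurable ((fun z : bplane R => (z.2, z.1) : bplane R) @^-1` B).
  by rewrite -[X in measurable X]setTI; exact: mS.
rewrite integral_cst// mul1e borel_area_ysection// /borel_area /= /product_measure1.
Qed.

Lemma mpres_eq S T : mpres S -> S =1 T -> mpres T.
Proof. by move=> hS ST; have <- : S = T by exact/funext. Qed.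

Lemma mpres_vshear m : mpres (fun z : plane R => (z.1, z.2 + m * z.1) : plane R).
Proof.
apply: (mpres_eq (mpres_comp mpres_pswap (mpres_comp (mpres_hshear m) mpres_pswap))).
by move=> z.
Qed.

Lemma transports_fst_affine (k b : R) : 0 < k ->
  transports (@area R) (@area R) (fun z : plane R => (k * z.1 + b, z.2) : plane R) (fun=> k).
Proof.
move=> k0; apply: (@transports_fiber (fun z => k * z.1 + b) (fun=> k)) => //.
  by apply: measurable_funD => //; apply: measurable_funM => //; exact: measurable_fst.
by move=> y B mB; exact: affine_density.
Qed.

Lemma transports_dilation (k : R) : 0 < k ->
  transports (@area R) (@area R) (fun z : plane R => (k * z.1, k * z.2) : plane R)
    (fun=> k ^+ 2).
Proof.
move=> k0; have h := transports_fst_affine 0 k0.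
have := transports_comp (transports_comp (transports_comp h mpres_pswap) h) mpres_pswap.
congr transports; apply/funext => z /=; first by rewrite /pswap /= !addr0.
by rewrite mul1r mul1r expr2.
Qed.

Definition pmove (w x : plane R) : plane R := (x.1 + w.1, x.2 + w.2).

Lemma mpres_pmove w : mpres (pmove w).
Proof.
have h b := transports_fst_affine b (@ltr01 R).
have := mpres_comp (mpres_comp (mpres_comp (h w.1) mpres_pswap) (h w.2)) mpres_pswap.
by move=> /mpres_eq; apply => z; rewrite /= /pswap /pmove /= !mul1r.
Qed.

Definition prot (v x : plane R) : plane R :=
  (v.1 * x.1 - v.2 * x.2, v.2 * x.1 + v.1 * x.2).

(* A rotation with cosine c and sine s is a product of three shears, with
   coefficients - s / (1 + c), s and - s / (1 + c). *)
Lemma mpres_prot v : dotp v v = 1 -> mpres (prot v).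
Proof.
(* The shear coefficients have denominator 1 + c, so the half turn is treated apart, as the square
   of the quarter turn [prot (0, 1)]. *)
rewrite /dotp => v1; have [c1|c1] := eqVneq v.1 (-1).
  have vE : v.2 = 0.
    apply/eqP; rewrite -sqrf_eq0 expr2; apply/eqP.
    by move: v1; rewrite c1; lra.
  have h : mpres (prot (0, 1)).
    have := mpres_comp (mpres_comp (mpres_hshear (-1)) (mpres_vshear 1)) (mpres_hshear (-1)).
    move=> /mpres_eq; apply => x; rewrite /prot /hshear /=; congr (_, _); ring.
  apply: (mpres_eq (mpres_comp h h)) => x.
  by rewrite /prot /= c1 vE; congr (_, _); ring.
have c0 : 1 + v.1 != 0 by rewrite addrC addr_eq0.
pose m := - (v.2 / (1 + v.1)).
have := mpres_comp (mpres_comp (mpres_hshear m) (mpres_vshear v.2)) (mpres_hshear m).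
have e1 : 1 + m * v.2 = v.1.
  rewrite /m; apply: (mulIf c0); rewrite mulrDl mul1r.
  have -> : - (v.2 / (1 + v.1)) * v.2 * (1 + v.1) = - (v.2 * v.2) by field.
  have -> : v.2 * v.2 = 1 - v.1 * v.1 by lra.
  ring.
have e2 : m + m * (1 + v.2 * m) = - v.2.
  have -> : 1 + v.2 * m = v.1 by rewrite mulrC.
  by rewrite /m; field.
move=> /mpres_eq; apply => x; rewrite /prot /hshear /=; congr (_, _).
  transitivity ((1 + m * v.2) * x.1 + (m + m * (1 + v.2 * m)) * x.2); first ring.
  by rewrite e1 e2; ring.
transitivity (v.2 * x.1 + (1 + m * v.2) * x.2); first ring.
by rewrite e1.
Qed.

Definition protV (v : plane R) : plane R := (v.1, - v.2).

Lemma dotp_protV v : dotp (protV v) (protV v) = dotp v v.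
Proof. by rewrite /dotp /protV /=; ring. Qed.

Lemma protK v : dotp v v = 1 -> cancel (prot v) (prot (protV v)).
Proof.
rewrite /dotp => v1 [x1 x2]; rewrite /prot /protV /=; congr (_, _).
  by transitivity ((v.1 * v.1 + v.2 * v.2) * x1); [ring|rewrite v1 mul1r].
by transitivity ((v.1 * v.1 + v.2 * v.2) * x2); [ring|rewrite v1 mul1r].
Qed.

Lemma protVK v : dotp v v = 1 -> cancel (prot (protV v)) (prot v).
Proof.
rewrite /dotp => v1 [x1 x2]; rewrite /prot /protV /=; congr (_, _).
  by transitivity ((v.1 * v.1 + v.2 * v.2) * x1); [ring|rewrite v1 mul1r].
by transitivity ((v.1 * v.1 + v.2 * v.2) * x2); [ring|rewrite v1 mul1r].
Qed.

Lemma dotp_prot v x y : dotp v v = 1 -> dotp (prot v x) (prot v y) = dotp x y.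
Proof.
rewrite /dotp /prot => v1 /=.
transitivity ((v.1 * v.1 + v.2 * v.2) * (x.1 * y.1 + x.2 * y.2)); first ring.
by rewrite v1 mul1r.
Qed.

Lemma dotp_ge0 (x : plane R) : 0 <= dotp x x.
Proof. by rewrite /dotp addr_ge0// -expr2 sqr_ge0. Qed.

Lemma enorm_ge0 (x : plane R) : 0 <= enorm x.
Proof. exact: sqrtr_ge0. Qed.

Lemma sqr_enorm (x : plane R) : enorm x ^+ 2 = dotp x x.
Proof. by rewrite sqr_sqrtr// dotp_ge0. Qed.

Lemma enorm_prot v x : dotp v v = 1 -> enorm (prot v x) = enorm x.
Proof. by move=> v1; rewrite /enorm dotp_prot. Qed.

Lemma enorm_fst (x : plane R) : `|x.1| <= enorm x.
Proof.
rewrite -(@ler_pXn2r _ 2)// ?nnegrE ?enorm_ge0// sqr_enorm /dotp.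
by rewrite real_normK ?num_real// expr2 lerDl -expr2 sqr_ge0.
Qed.

Lemma enorm_snd (x : plane R) : `|x.2| <= enorm x.
Proof.
rewrite -(@ler_pXn2r _ 2)// ?nnegrE ?enorm_ge0// sqr_enorm /dotp.
by rewrite real_normK ?num_real// expr2 lerDr -expr2 sqr_ge0.
Qed.

Lemma enorm_le_add (x : plane R) : enorm x <= `|x.1| + `|x.2|.
Proof.
rewrite -(@ler_pXn2r _ 2)// ?nnegrE ?enorm_ge0 ?addr_ge0// sqr_enorm /dotp.
rewrite sqrrD !real_normK ?num_real// !expr2.
have : 0 <= `|x.1| * `|x.2| by rewrite mulr_ge0.
by rewrite mulr2n; lra.
Qed.

Lemma measurable_enorm : measurable_fun setT (enorm : bplane R -> R).
Proof.
rewrite (_ : (enorm : bplane R -> R) = Num.sqrt \o (fun z => z.1 * z.1 + z.2 * z.2))//.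
apply: measurableT_comp.
  by apply: continuous_measurable_fun; exact: sqrt_continuous.
by apply: measurable_funD; apply: measurable_funM; (exact: measurable_fst || exact: measurable_snd).
Qed.

Lemma measurable_enorm_plane : measurable_fun setT (@enorm R).
Proof. exact: (measurableT_comp measurable_enorm measurable_plane_id). Qed.

Lemma measurable_eball r : measurable (@eball R r).
Proof.
have -> : @eball R r = (@enorm R) @^-1` `]-oo, r[.
  by apply/seteqP; split => x; rewrite /= in_itv.
by rewrite -[X in measurable X]setTI; exact: measurable_enorm_plane.
Qed.

(** * The localized horizontal translation and its inverse *)

Section bump_plane.
Variables (l t : R).
Hypotheses (l0 : 0 < l) (tl : `|t| <= l / 4).

Definition bump_plane (z : plane R) : plane R :=
  (bump_map l (t * trap l z.2) z.1, z.2).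

Definition bump_plane_jac (z : plane R) : R := bump_jac l (t * trap l z.2) z.1.

Let ttrap y : `|t * trap l y| <= l / 4.
Proof.
rewrite normrM (le_trans _ tl)// ler_piMr// ger0_norm ?trap_ge0//.
exact: trap_le1.
Qed.

Lemma bump_plane_jac_gt0 z : 0 < bump_plane_jac z.
Proof.
have := bump_jac_bound (t * trap l z.2) z.1 l0; rewrite ler_norml => /andP[+ _].
have : `|t * trap l z.2| / l <= 1 / 4.
  by rewrite ler_pdivrMr// (le_trans (ttrap _))//; lra.
by rewrite /bump_plane_jac; lra.
Qed.

Lemma measurable_trap_snd : measurable_fun setT (fun z : bplane R => t * trap l z.2).
Proof.
apply: measurable_funM => //.
by apply: (measurableT_comp (measurable_trap l)); exact: measurable_snd.
Qed.

Lemma measurable_bump_fst : measurable_fun setT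
  (fun z : bplane R => bump_map l (t * trap l z.2) z.1).
Proof.
apply: measurable_funD; first exact: measurable_fst.
apply: measurable_funM; first exact: measurable_trap_snd.
by apply: (measurableT_comp (measurable_trap l)); exact: measurable_fst.
Qed.

Lemma measurable_bump_jac : measurable_fun setT
  (fun z : bplane R => bump_jac l (t * trap l z.2) z.1).
Proof.
apply: measurable_funD => //; apply: measurable_funM.
  by apply: measurable_funM => //; exact: measurable_trap_snd.
apply: measurable_funB.
  apply: (measurableT_comp (f := \1_(`](- (2 * l)), (- l)]) : measurableTypeR R -> R)).
    exact: measurable_indic.
  exact: measurable_fst.
apply: (measurableT_comp (f := \1_(`]l, (2 * l)]) : measurableTypeR R -> R)).
  exact: measurable_indic.
exact: measurable_fst.
Qed.

Lemma transports_bump_plane :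
  transports (@area R) (@area R) bump_plane bump_plane_jac.
Proof.
apply: (@transports_fiber (fun z => bump_map l (t * trap l z.2) z.1)
  (fun z => bump_jac l (t * trap l z.2) z.1)).
- exact: measurable_bump_fst.
- exact: measurable_bump_jac.
- exact: bump_plane_jac_gt0.
- by move=> y B mB; exact: (bump_map_density l0 (ttrap y) mB).
Qed.

(** Each line map is increasing, so its inverse is at least r exactly where the image of r is at
    most the first coordinate, a Borel condition. The inverse pulls a null set N back to the image
    of N, whose area is the integral of the Jacobian over N, hence zero. *)
Lemma bump_plane_inverse : exists T : plane R -> plane R,
  [/\ measurable_fun setT T, cancel T bump_plane & cancel bump_plane T].
Proof.
have [g gP] := choice (fun y : bplane R => bump_map_surj (t * trap l y.2) y.1 l0).
have gle y : {mono bump_map l (t * trap l y) : a b / a <= b}.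
  by apply: le_mono; exact: bump_map_incr.
pose T (z : bplane R) : bplane R := (g z, z.2).
have TK : cancel T bump_plane by move=> y; rewrite [RHS]surjective_pairing; congr (_, _); exact: gP.
have KT : cancel bump_plane T.
  move=> z; rewrite [RHS]surjective_pairing; congr (_, _).
  have := gP (bump_plane z); rewrite /bump_plane /= => h.
  exact: (inc_inj (gle z.2) h).
have mg : measurable_fun setT g.
  apply: (measurability (@RGenCInfty.G R)) => [|/= _ [_] [r] -> <-].
    exact: RGenCInfty.measurableE.
  rewrite setTI.
  have -> : g @^-1` `[r, +oo[ =
      (fun z : bplane R => bump_map l (t * trap l z.2) r <= z.1) @^-1` [set true].
    apply/seteqP; split => z /=; rewrite in_itv/= andbT -{1}(gP z) gle.
      by move=> ->.
    by move=> /= ->.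
  have mle : measurable_fun setT
      (fun z : bplane R => bump_map l (t * trap l z.2) r <= z.1).
    apply: measurable_fun_ler; last exact: measurable_fst.
    apply: measurable_funD => //; apply: measurable_funM => //.
    exact: measurable_trap_snd.
  by rewrite -[X in measurable X]setTI; exact: mle.
have mT : measurable_fun setT T.
  by apply: measurable_fun_pair => //; exact: measurable_snd.
exists T; split; [|exact: TK|exact: KT].
apply: measurable_plane_map => [|N mN N0]; first exact: mT.
have mTN : measurable (T @^-1` N).
  by rewrite -[X in measurable X]setTI; exact: mT.
rewrite -area_borel// (transports_area transports_bump_plane); last exact: borel_plane_measurable.
have -> : bump_plane @^-1` (T @^-1` N) = N.
  by apply/seteqP; split => z /=; rewrite KT.
have [_ mJ _ _] := transports_bump_plane.
apply: null_set_integral.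
- exact: borel_plane_measurable.
- by apply: measurable_funTS; exact/measurable_EFinP.
- by rewrite -N0; exact: area_borel.
Qed.

End bump_plane.

End plane_maps.

Section directional.
Context {R : realType}.

Definition pdiff (x y : plane R) : plane R := (x.1 - y.1, x.2 - y.2).

Definition pshift (v : plane R) (c : R) (x : plane R) : plane R :=
  (x.1 + c * v.1, x.2 + c * v.2).

Lemma prot_pdiff v x y : pdiff (prot v x) (prot v y) = prot v (pdiff x y).
Proof. by rewrite /pdiff /prot /=; congr (_, _); ring. Qed.

Lemma pdiff_pshift v b c x y :
  pdiff (pshift v b x) (pshift v c y) = pshift v (b - c) (pdiff x y).
Proof. by rewrite /pdiff /pshift /=; congr (_, _); ring. Qed.

Lemma trap_norm_le1 (l x : R) : 0 < l -> `|trap l x| <= 1.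
Proof. by move=> l0; rewrite ger0_norm ?trap_ge0// trap_le1. Qed.

(* The displacement is parallel to [v], so the Jacobian determinant is affine in
   [t], with slope the derivative of [phi] along [v]. *)
Lemma directional_bump (v : plane R) (l : R) : dotp v v = 1 -> 0 < l ->
  exists phi a : plane R -> R,
  [/\ forall x y, `|phi x - phi y| <= 4 / l * enorm (pdiff x y),
      forall x, enorm x <= l -> phi x = 1,
      forall x, 4 * l <= enorm x -> phi x = 0,
      forall x, `|a x| <= l^-1 &
      forall t, `|t| <= l / 4 ->
        transports (@area R) (@area R) (fun x => pshift v (t * phi x) x)
          (fun x => 1 + t * a x) /\
        exists T : plane R -> plane R, [/\ measurable_fun setT T,
          cancel T (fun x => pshift v (t * phi x) x) &
          cancel (fun x => pshift v (t * phi x) x) T]].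
Proof.
move=> v1 l0; have v1' : dotp (protV v) (protV v) = 1 by rewrite dotp_protV.
pose y x := prot (protV v) x.
have ny x : enorm (y x) = enorm x by exact: enorm_prot.
(* In the coordinates [y] the vector [v] is the first basis vector. The cutoff vanishes outside the
   square of half-side 2l, hence where the norm is at least 4l, the norm being at most the sum of
   the absolute coordinates. *)
exists (fun x => trap l (y x).1 * trap l (y x).2).
exists (fun x => trap l (y x).2 / l *
  (\1_(`](- (2 * l)), (- l)]) (y x).1 - \1_(`]l, (2 * l)]) (y x).1)).
have shiftE t x : pshift v (t * (trap l (y x).1 * trap l (y x).2)) x =
    prot v (bump_plane l t (y x)).
  rewrite -{3}(protVK v1 x) -/(y x) /prot /bump_plane /pshift /bump_map /=.
  by congr (_, _); ring.
split.
- move=> x x'; rewrite -(ny (pdiff x x')) /y -prot_pdiff -/(y x) -/(y x').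
  move: (y x) (y x') => {}x {}x'.
  have := enorm_fst (pdiff x x'); have := enorm_snd (pdiff x x').
  set N := enorm _; rewrite /pdiff /= => h2 h1.
  have -> : trap l x.1 * trap l x.2 - trap l x'.1 * trap l x'.2 =
    (trap l x.1 - trap l x'.1) * trap l x.2 + trap l x'.1 * (trap l x.2 - trap l x'.2).
    ring.
  have -> : 4 / l * N = 2 / l * N * 1 + 1 * (2 / l * N) by ring.
  have l2 : 0 <= 2 / l by rewrite divr_ge0 ?ltW.
  apply: (le_trans (ler_normD _ _)).
  rewrite [X in X + _ <= _]normrM [X in _ + X <= _]normrM; apply: lerD; apply: ler_pM => //.
  + apply: (le_trans (trap_lipschitz _ _ l0)); exact: ler_wpM2l.
  + exact: trap_norm_le1.
  + exact: trap_norm_le1.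
  + apply: (le_trans (trap_lipschitz _ _ l0)); exact: ler_wpM2l.
- move=> x xl; rewrite !trap_eq1 ?mulr1//.
    by rewrite (le_trans (enorm_snd _))// ny.
  by rewrite (le_trans (enorm_fst _))// ny.
- move=> x; rewrite -ny => h; have := le_trans h (enorm_le_add (y x)) => {}h.
  have [h1|h1] := leP (2 * l) `|(y x).1|; first by rewrite trap_eq0// mul0r.
  by rewrite [X in _ * X]trap_eq0 ?mulr0//; lra.
- move=> x; rewrite normrM normrM (gtr0_norm (_ : 0 < l^-1)) ?invr_gt0//.
  have h1 : `|\1_(`](- (2 * l)), (- l)]) (y x).1 - \1_(`]l, (2 * l)]) (y x).1| <= 1 :> R.
    rewrite !indicE; case: (_ \in _) => /=; case: (_ \in _) => /=;
    by rewrite ?subrr ?subr0 ?sub0r ?normrN ?normr1 ?normr0 ?ler01.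
  rewrite -[leRHS]mulr1; apply: ler_pM => //; first by rewrite mulr_ge0// invr_ge0 ltW.
  by rewrite ler_piMl ?invr_ge0 ?(ltW l0)// trap_norm_le1.
- move=> t tl; have tb := transports_bump_plane l0 tl.
  have [T [mT TK KT]] := bump_plane_inverse l0 tl.
  have [mr _ _ _] := mpres_prot v1; have [mr' _ _ _] := mpres_prot v1'.
  have Ef : (fun x => pshift v (t * (trap l (y x).1 * trap l (y x).2)) x) =
      prot v \o bump_plane l t \o y by apply/funext => x; rewrite shiftE.
  split.
    have := transports_comp (transports_comp (mpres_prot v1') tb) (mpres_prot v1).
    rewrite Ef; congr transports; apply/funext => x.
    by rewrite mul1r mulr1 /bump_plane_jac /bump_jac /=; ring.
  exists (prot v \o T \o y); split.
  + exact: (measurableT_comp (measurableT_comp mr mT) mr').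
  + by move=> x; rewrite shiftE /y /= protK// TK protVK.
  + by move=> x; rewrite shiftE /y /= protK// KT protVK.
Qed.

End directional.

(** * Second variation of the kernel *)

Section pointwise.
Context {R : realType}.
Variable s : R.
Hypotheses (s0 : 0 < s) (s1 : s < 1 / 2).

(** Young's inequality for w^s and 1, with conjugate exponents 1/s and 1/(1 - s). *)
Lemma bernoulli_powR (w : R) : 0 < w -> w `^ s <= 1 + s * (w - 1).
Proof.
move=> w0.
have s'0 : 0 < 1 - s by move: s0 s1; lra.
have si : 0 < s^-1 by rewrite invr_gt0.
have s'i : 0 < (1 - s)^-1 by rewrite invr_gt0.
have h := @conjugate_powR R (w `^ s) 1 s^-1 (1 - s)^-1 (powR_ge0 _ _) ler01 si s'i.
move: h; rewrite !invrK mulr1 powR1 -powRrM divff ?gt_eqF// powRr1 ?(ltW w0)//.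
by move=> /(_ _)/le_trans; apply; [ring|lra].
Qed.

(** With w = 1/(1 + u) the left side is w w^s, and Bernoulli's inequality leaves the remainder u^2
    (w + s w + s w^2). Since w <= 2 and s < 1/2, its factor is at most 2 + 1 + 2 = 5. *)
Lemma powR_taylor (u : R) : `|u| <= 1 / 2 ->
  (1 + u) `^ (- (1 + s)) <= 1 - (1 + s) * u + 5 * u ^+ 2.
Proof.
rewrite ler_norml => /andP[u1 u2].
have u0 : 0 < 1 + u by lra.
pose w := (1 + u)^-1.
have w0 : 0 < w by rewrite invr_gt0.
have wu : w * (1 + u) = 1 by rewrite mulVf// gt_eqF.
have w2 : w <= 2 by rewrite -[2]invrK lef_pV2 ?posrE ?invr_gt0//; lra.
have wE : w = 1 - u * w by lra.
have -> : (1 + u) `^ (- (1 + s)) = w * w `^ s.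
  rewrite /w -powR_inv1 ?(ltW u0)// -powRrM -powRD ?(gt_eqF u0) ?implybT//.
  by congr (_ `^ _); ring.
have h := bernoulli_powR w0.
apply: (@le_trans _ _ (w * (1 + s * (w - 1)))); first by rewrite ler_pM2l.
have -> : w * (1 + s * (w - 1)) = 1 - (1 + s) * u + u ^+ 2 * (w + s * w + s * w ^+ 2).
  have e1 : u ^+ 2 * w = u - 1 + w.
    have -> : u ^+ 2 * w = u * (u * w) by ring.
    have uw : u * w = 1 - w by lra.
    by rewrite uw mulrBr mulr1 uw; ring.
  have e3 : u ^+ 2 * w ^+ 2 = (1 - w) ^+ 2.
    by rewrite -exprMn; congr (_ ^+ 2); lra.
  have -> : u ^+ 2 * (w + s * w + s * w ^+ 2) =
     (1 + s) * (u ^+ 2 * w) + s * (u ^+ 2 * w ^+ 2) by ring.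
  by rewrite e1 e3; ring.
rewrite lerD2l mulrC ler_wpM2r ?sqr_ge0//.
have ww : w ^+ 2 <= 4 by nra.
have sw : s * w <= 1 / 2 * 2 by apply: ler_pM => //; exact: ltW.
have sww : s * w ^+ 2 <= 1 / 2 * 4 by apply: ler_pM => //; [exact: ltW|exact: sqr_ge0|exact: ltW].
lra.
Qed.

Lemma kernelE (x y : plane R) :
  Defs.kernel s (x, y) = dotp (pdiff x y) (pdiff x y) `^ (- (1 + s)).
Proof.
rewrite /Defs.kernel /= -/(pdiff x y) /enorm -powR12_sqrt ?dotp_ge0// -powRrM.
by congr (_ `^ _); field.
Qed.

Lemma cauchy_schwarz (x y : plane R) : dotp x y ^+ 2 <= dotp x x * dotp y y.
Proof.
rewrite -subr_ge0.
have -> : dotp x x * dotp y y - dotp x y ^+ 2 = (x.1 * y.2 - x.2 * y.1) ^+ 2.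
  by rewrite /dotp; ring.
exact: sqr_ge0.
Qed.

Lemma norm_dotp_le (x y : plane R) : `|dotp x y| <= enorm x * enorm y.
Proof.
rewrite -(@ler_pXn2r _ 2)// ?nnegrE ?mulr_ge0 ?enorm_ge0//.
by rewrite real_normK ?num_real// exprMn !sqr_enorm cauchy_schwarz.
Qed.

Definition kpow (z : plane R) : R := dotp z z `^ (- (1 + s)).

(* The terms of first order in [tau], [al], [be] cancel between the summands. *)
Lemma kernel_second_variation (d w : plane R) (tau kap al be : R) :
  0 < dotp d d -> dotp w w = 1 -> kap <= 1 / 8 ->
  `|tau| <= kap * enorm d -> `|al| <= kap -> `|be| <= kap ->
  kpow (pshift w tau d) * ((1 + al) * (1 + be)) +
  kpow (pshift w (- tau) d) * ((1 - al) * (1 - be)) <= (2 + 110 * kap ^+ 2) * kpow d.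
Proof.
move=> q0 w1 kap8 htau hal hbe; pose k := kpow; rewrite -/k.
have kap0 : 0 <= kap by exact: le_trans hal.
set q := dotp d d in q0; pose N := enorm d.
have NN : N ^+ 2 = q by exact: sqr_enorm.
have hp : `|dotp d w| <= N.
  by have := norm_dotp_le d w; rewrite {2}/enorm w1 sqrtr1 mulr1.
(* The squared norm of d + tau w is q (1 + m + n). Here m is odd in tau and cancels to first order,
   while n >= 0 enters the upper bound with a negative coefficient and is dropped. *)
pose m := 2 * tau * dotp d w / q; pose n := tau ^+ 2 / q.
have hm : `|m| <= 2 * kap.
  rewrite /m normrM (gtr0_norm (_ : 0 < q^-1)) ?invr_gt0// ler_pdivrMr//.
  rewrite !normrM normr_nat -mulrA -NN.
  have -> : 2 * kap * N ^+ 2 = 2 * (kap * N * N) by ring.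
  by rewrite ler_pM2l//; apply: ler_pM.
have n0 : 0 <= n by rewrite divr_ge0 ?sqr_ge0 ?ltW.
have hn : n <= kap ^+ 2.
  rewrite /n ler_pdivrMr// -NN -exprMn -real_normK ?num_real//.
  by rewrite ler_pXn2r ?nnegrE// mulr_ge0// enorm_ge0.
have kk : kap ^+ 2 <= 1 / 64 by nra.
have sn : 0 <= (1 + s) * n by rewrite mulr_ge0// addr_ge0// ltW.
have kk' : kap ^+ 2 <= kap * (1 / 8) by rewrite expr2 ler_wpM2l.
(* The 45 is 5 * 9: the Taylor constant times the bound for u = m + n or u = - m + n, where |u| <= 3
   kap. *)
have key (u : R) : u ^+ 2 <= 9 * kap ^+ 2 -> `|u| <= 1 / 2 ->
    (q * (1 + u)) `^ (- (1 + s)) <= (1 - (1 + s) * u + 45 * kap ^+ 2) * k d.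
  move=> u1 u2; have uu := u2; move: uu; rewrite ler_norml => /andP[u3 _].
  rewrite powRM; [|exact: ltW|lra]; rewrite mulrC ler_wpM2r ?powR_ge0//.
  by apply: (le_trans (powR_taylor u2)); lra.
have E1 (c : R) : dotp (pshift w c d) (pshift w c d) =
    q * (1 + (2 * c * dotp d w / q + c ^+ 2 / q)).
  have -> : q * (1 + (2 * c * dotp d w / q + c ^+ 2 / q)) =
     q + 2 * c * dotp d w + c ^+ 2 * dotp w w by rewrite w1; field; rewrite gt_eqF.
  by rewrite /q /dotp /pshift /=; ring.
have ub (z : R) : `|z| <= 2 * kap ->
    (z + n) ^+ 2 <= 9 * kap ^+ 2 /\ `|z + n| <= 1 / 2.
  move=> hz; have h3 : `|z + n| <= 3 * kap.
    apply: (le_trans (ler_normD _ _)); rewrite (ger0_norm n0); lra.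
  split; last lra.
  rewrite -real_normK ?num_real//.
  have -> : 9 * kap ^+ 2 = (3 * kap) ^+ 2 by ring.
  by rewrite ler_pXn2r ?nnegrE// mulr_ge0.
have hm' : `|- m| <= 2 * kap by rewrite normrN.
have [a1 a2] := ub _ hm; have [b1 b2] := ub _ hm'.
have h1 : k (pshift w tau d) <= (1 - (1 + s) * m + 45 * kap ^+ 2) * k d.
  rewrite {1}/k /kpow E1 -/m -/n; apply: (le_trans (key _ a1 a2)).
  by apply: ler_wpM2r; [exact: powR_ge0|lra].
have h2 : k (pshift w (- tau) d) <= (1 + (1 + s) * m + 45 * kap ^+ 2) * k d.
  rewrite {1}/k /kpow E1 sqrrN -/n mulrN !mulNr -/m; apply: (le_trans (key _ b1 b2)).
  by apply: ler_wpM2r; [exact: powR_ge0|lra].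
move: hal hbe; rewrite !ler_norml => /andP[al1 al2] /andP[be1 be2].
move: hm; rewrite ler_norml => /andP[m1 m2].
have j1 : 0 <= (1 + al) * (1 + be) by apply: mulr_ge0; lra.
have j2 : 0 <= (1 - al) * (1 - be) by apply: mulr_ge0; lra.
apply: (le_trans (lerD (ler_wpM2r j1 h1) (ler_wpM2r j2 h2))).
rewrite mulrAC [X in _ + X]mulrAC -mulrDl.
rewrite ler_wpM2r ?powR_ge0//.
(* Only products of two odd quantities survive the summation. The total is 2 + 104 kap^2 + 90 kap^4,
   and kap^2 <= 1/64 brings it below 2 + 110 kap^2. *)
have ab : al * be <= kap ^+ 2 by nra.
have mab : - (m * (al + be)) <= 4 * kap ^+ 2 by nra.
have smab : - ((1 + s) * (m * (al + be))) <= 6 * kap ^+ 2 by move: s0 s1; nra.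
have -> : (1 - (1 + s) * m + 45 * kap ^+ 2) * ((1 + al) * (1 + be)) +
   (1 + (1 + s) * m + 45 * kap ^+ 2) * ((1 - al) * (1 - be)) =
   (1 + 45 * kap ^+ 2) * (2 + 2 * (al * be)) + 2 * (- ((1 + s) * (m * (al + be)))) by ring.
have : (1 + 45 * kap ^+ 2) * (2 + 2 * (al * be)) <= (1 + 45 * kap ^+ 2) * (2 + 2 * kap ^+ 2).
  by apply: ler_wpM2l; have := sqr_ge0 kap; lra.
have X2 : kap ^+ 2 * kap ^+ 2 <= kap ^+ 2 * (1 / 64) by rewrite ler_wpM2l ?sqr_ge0.
have := sqr_ge0 kap; move: smab X2; clear => *; lra.
Qed.

End pointwise.

(** Tonelli, changing variables in one factor at a time. *)
Lemma transports_prod {d1 d2 : measure_display} {T1 : measurableType d1}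
    {T2 : measurableType d2} {R : realType}
    (mu : {sigma_finite_measure set T1 -> \bar R})
    (nu : {sigma_finite_measure set T2 -> \bar R}) (T : T1 -> T2) (J : T1 -> R) :
  transports mu nu T J ->
  transports (mu \x mu)%E (nu \x nu)%E (fun z => (T z.1, T z.2))
    (fun z => J z.1 * J z.2).
Proof.
move=> [mT mJ J0 h].
have mTT : measurable_fun setT (fun z : T1 * T1 => (T z.1, T z.2)).
  apply: measurable_fun_pair.
    exact: (measurableT_comp mT measurable_fst).
  exact: (measurableT_comp mT measurable_snd).
have mJ1 : measurable_fun setT (fun z : T1 * T1 => J z.1).
  exact: (measurableT_comp mJ measurable_fst).
have mJ2 : measurable_fun setT (fun z : T1 * T1 => J z.2).
  exact: (measurableT_comp mJ measurable_snd).
split => //; [exact: measurable_funM|by move=> z; rewrite mulr_ge0|].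
move=> f mf f0; rewrite fubini_tonelli1// h; last 2 first.
  - exact: measurable_fun_fubini_tonelli_F.
  - by move=> x; apply: integral_ge0 => y _.
have mfT : measurable_fun setT (fun z : T1 * T1 => f (T z.1, T z.2)).
  exact: (measurableT_comp mf mTT).
rewrite fubini_tonelli1; last 2 first.
  - by apply: emeasurable_funM => //; apply/measurable_EFinP; exact: measurable_funM.
  - by move=> z; rewrite mule_ge0// lee_fin mulr_ge0.
apply: eq_integral => x _; rewrite /fubini_F /=.
rewrite h; last 2 first.
  - exact: (measurableT_comp mf (pair1_measurable _)).
  - by move=> y.
rewrite -ge0_integralZr//; last 3 first.
  - apply: emeasurable_funM; last exact/measurable_EFinP.
    exact: (measurableT_comp (measurableT_comp mf (pair1_measurable _)) mT).
  - by move=> y _; rewrite mule_ge0// lee_fin.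
  - by rewrite lee_fin.
by apply: eq_integral => y _; rewrite -muleA -EFinM [J y * _]mulrC.
Qed.

Lemma measurable_cst_indic {d : measure_display} {T : measurableType d} {R : realType}
    (k : R) (D : set T) : measurable D ->
  measurable_fun setT (fun x => (k%:E * (\1_D x)%:E)%E).
Proof.
move=> mD; apply: emeasurable_funM => //; apply/measurable_EFinP.
exact: measurable_indic.
Qed.

Lemma measurable_fun_indicM {d : measure_display} {T : measurableType d} {R : realType}
    (f : T -> R) (D : set T) : measurable_fun setT f -> measurable D ->
  measurable_fun setT (fun x => ((f x)%:E * (\1_D x)%:E)%E).
Proof.
move=> mf mD; apply: emeasurable_funM; first exact/measurable_EFinP.
by apply/measurable_EFinP; exact: measurable_indic.
Qed.

Lemma integral_cst_indic {d : measure_display} {T : measurableType d} {R : realType}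
    (mu : {measure set T -> \bar R}) (k : R) (D : set T) : 0 <= k -> measurable D ->
  (\int[mu]_x (k%:E * (\1_D x)%:E) = k%:E * mu D)%E.
Proof.
move=> k0 mD; rewrite ge0_integralZl//; first by rewrite integral_indic// setIT.
by apply/measurable_EFinP; exact: measurable_indic.
Qed.

Lemma integral_indicM {d : measure_display} {T : measurableType d} {R : realType}
    (mu : {measure set T -> \bar R}) (f : T -> \bar R) (D : set T) :
  (\int[mu]_(x in D) f x = \int[mu]_x (f x * (\1_D x)%:E))%E.
Proof.
rewrite integral_mkcond; apply: eq_integral => x _; rewrite patchE indicE.
by case: ifPn => _; rewrite ?mule1 ?mule0.
Qed.

(** This stands in for polar coordinates. The sets [B n] may overlap, so that full balls can replace
    dyadic annuli. *)
Lemma sum_sets_lty {d : measure_display} {T : measurableType d} {R : realType}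
    (mu : {measure set T -> \bar R}) (f : T -> \bar R) (B : nat -> set T)
    (g : nat -> R) (c q : R) :
  measurable_fun setT f -> (forall z, 0 <= f z)%E -> (forall n, measurable (B n)) ->
  (forall n, 0 <= g n) -> 0 <= c -> 0 < q < 1 ->
  (forall n, (g n)%:E * mu (B n) <= (c * q ^+ n)%:E)%E ->
  (forall z, f z = 0%E \/ exists n, B n z /\ (f z <= (g n)%:E)%E) ->
  (\int[mu]_z f z < +oo)%E.
Proof.
move=> mf f0 mB g0 c0 /andP[q0 q1] hgq hf.
pose F n (z : T) := ((g n)%:E * (\1_(B n) z)%:E)%E.
have F0 n z : (0 <= F n z)%E by rewrite mule_ge0 ?lee_fin.
have mF n : measurable_fun setT (F n) by exact: measurable_cst_indic.
apply: (@le_lt_trans _ _ (\int[mu]_z (\sum_(n <oo) F n z))%E).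
  apply: ge0_le_integral => //.
  - by apply: ge0_emeasurable_sum.
  - move=> z _; have [->|[n [zn fn]]] := hf z; first exact: nneseries_ge0.
    apply: (le_trans fn); rewrite (@nneseriesD1 _ (fun k => F k z) n xpredT)//.
    rewrite {1}/F indicE mem_set// mule1 leeDl//.
    exact: nneseries_ge0.
rewrite integral_nneseries//.
apply: (@le_lt_trans _ _ (c * (1 - q)^-1)%:E); last exact: ltry.
apply: lime_le; first by apply: is_cvg_nneseries => n _ _; exact: integral_ge0.
apply: nearW => n.
apply: (@le_trans _ _ (\sum_(0 <= k < n) (c * q ^+ k)%:E)%E).
  by apply: lee_sum => k _; rewrite /F integral_cst_indic.
rewrite sumEFin lee_fin.
apply: (le_trans _ (@geometric_le_lim R n c q c0 q0 _)); last by rewrite gtr0_norm.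
by rewrite /series /=.
Qed.

Lemma transports_prod_integrand {d1 d2 : measure_display} {T1 : measurableType d1}
    {T2 : measurableType d2} {R : realType} (mu : {measure set T1 -> \bar R})
    (nu : {measure set T2 -> \bar R}) (T : T1 -> T2) (J : T1 -> R) (f : T2 * T2 -> R) :
  transports mu nu T J -> measurable_fun setT f ->
  measurable_fun setT (fun z : T1 * T1 => f (T z.1, T z.2) * (J z.1 * J z.2)).
Proof.
move=> [mT mJ _ _] mf.
have m1 := @measurable_fst _ _ T1 T1; have m2 := @measurable_snd _ _ T1 T1.
apply: measurable_funM; last first.
  by apply: measurable_funM; [exact: measurableT_comp mJ m1|exact: measurableT_comp mJ m2].
apply: (measurableT_comp mf); apply: measurable_fun_pair.
  exact: measurableT_comp mT m1.
exact: measurableT_comp mT m2.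
Qed.

(** * Integrability of the kernel *)

Section energy.
Context {R : realType}.

Lemma area_eball_le (r : R) : 0 <= r -> (area (eball r) <= (4 * r ^+ 2)%:E)%E.
Proof.
move=> r0.
pose I : set (measurableTypeR R) := `[- r, r]%classic.
have mI : measurable I by exact: measurable_itv.
have mB : measurable (I `*` I : set (bplane R)) by exact: measurableX.
apply: (@le_trans _ _ (area (I `*` I : set (plane R)))).
  apply: le_area => x; rewrite /eball /= => hx.
  split; rewrite /I /= in_itv/= -ler_norml.
    exact: le_trans (enorm_fst x) (ltW hx).
  exact: le_trans (enorm_snd x) (ltW hx).
have -> : area (I `*` I : set (plane R)) = (lebesgue_measure I * lebesgue_measure I)%E.
  by rewrite area_borel//; exact: product_measure1E.
rewrite /I.
have -> : lebesgue_measure (`[(- r), r]%classic : set (measurableTypeR R)) = (2 * r)%:E.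
  rewrite lebesgue_measure_itv/= lte_fin; case: ltP => rr.
    by rewrite opprK; congr (_%:E); ring.
  by congr (_%:E); lra.
by rewrite -EFinM lee_fin; nra.
Qed.

Lemma ball_weight_le (g rho c : R) : 0 <= g -> 0 <= rho ->
  g * (4 * rho ^+ 2) <= c -> (g%:E * area (eball rho) <= c%:E)%E.
Proof.
move=> g0 rho0 h; apply: (@le_trans _ _ (g%:E * (4 * rho ^+ 2)%:E)%E).
  by apply: lee_wpmul2l; rewrite ?lee_fin//; exact: area_eball_le.
by rewrite -EFinM lee_fin.
Qed.

Lemma dyadic (x : R) : 1 <= x -> exists n : nat, 2 ^+ n <= x < 2 ^+ n.+1.
Proof.
move=> x1.
have ex : exists n : nat, x < 2 ^+ n.
  exists (Num.bound x); apply: (lt_le_trans (archi_boundP (le_trans ler01 x1))).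
  by rewrite -natrX ler_nat ltnW// ltn_expl.
case: (ex_minnP ex) => -[|m] hm hmin; first by move: hm; rewrite expr0 ltNge x1.
exists m; rewrite hm andbT leNgt; apply/negP => /hmin.
by rewrite ltnn.
Qed.

Variable s : R.
Hypotheses (s0 : 0 < s) (s1 : s < 1 / 2).

Definition kabs (z : plane R) : R := enorm z `^ (- (2 + 2 * s)).

Lemma kabs_ge0 z : 0 <= kabs z.
Proof. exact: powR_ge0. Qed.

Lemma measurable_kabs : measurable_fun setT kabs.
Proof. exact: (measurableT_comp (measurable_powR _) measurable_enorm_plane). Qed.

Lemma powR_nat_exp (a p : R) (n : nat) : 0 <= a -> (a ^+ n) `^ p = (a `^ p) ^+ n.
Proof.
move=> a0; rewrite -powR_mulrn// -powRrM mulrC powRrM powR_mulrn//.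
exact: powR_ge0.
Qed.

(** Where 2^n <= |z| < 2^(n + 1) the kernel is at most 2^(-(2 + 2s) n) = (q/4)^n, and the enclosing
    ball has area at most 16 * 4^n. *)
Lemma kabs_far_lty : (\int[@area R]_z ((kabs z)%:E * (\1_(~` (eball 1)) z)%:E) < +oo)%E.
Proof.
pose q := 2 `^ (- (2 * s)) : R.
have q0 : 0 < q by rewrite powR_gt0.
have q1 : q < 1.
  rewrite /q powRN invf_lt1 ?powR_gt0//.
  have := @gt0_ltr_powR R (2 * s) _ 1 2; rewrite powR1; apply => //.
  - by rewrite mulr_gt0.
  - by rewrite nnegrE.
  - by rewrite nnegrE.
  - by rewrite ltr1n.
have mC : measurable (~` (@eball R 1)) by apply: measurableC; exact: measurable_eball.
apply: (@sum_sets_lty _ _ _ _ _ (fun n => eball (2 ^+ n.+1)) (fun n => (q / 4) ^+ n) 16 q).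
- by apply: measurable_fun_indicM; [exact: measurable_kabs|exact: mC].
- by move=> z; rewrite mule_ge0// lee_fin ?kabs_ge0.
- by move=> n; exact: measurable_eball.
- by move=> n; rewrite exprn_ge0// divr_ge0// ltW.
- by [].
- by rewrite q0.
- move=> n; apply: ball_weight_le.
  + by rewrite exprn_ge0// divr_ge0// ltW.
  + by rewrite exprn_ge0.
  rewrite expr_div_n [2 ^+ n.+1]exprS [(2 * _) ^+ 2]exprMn -exprM mulnC exprM.
  have -> : (2 ^+ 2 : R) = 4 by ring.
  have h4 : (4 ^+ n : R) != 0 by rewrite expf_neq0.
  by rewrite le_eqVlt; apply/orP; left; apply/eqP; field.
- move=> z; rewrite indicE.
  have [zb|zb] := boolP (z \in ~` (@eball R 1)); last by left; rewrite /= mule0.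
  move: zb; rewrite inE /eball /= => /negP; rewrite -leNgt => z1.
  have [n /andP[n1 n2]] := dyadic z1.
  right; exists n; split => //; rewrite mule1 lee_fin.
  have -> : (q / 4) ^+ n = (2 ^+ n) `^ (- (2 + 2 * s)).
    rewrite powR_nat_exp//; congr (_ ^+ _).
    rewrite opprD powRD ?pnatr_eq0 ?implybT// mulrC; congr (_ * _).
    by rewrite powRN powR_mulrn//; congr (_^-1); ring.
  rewrite /kabs !powRN lef_pV2 ?posrE ?powR_gt0 ?exprn_gt0//; last exact: lt_le_trans z1.
  apply: ge0_ler_powR => //; rewrite ?nnegrE ?exprn_ge0 ?enorm_ge0//.
  by rewrite addr_ge0// mulr_ge0// ltW.
Qed.

(** The weight |z| weakens the singularity to |z|^(-1 - 2s). The scale 2^(-n) then contributes a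
    multiple of 2^((2s - 1) n), summable because s < 1/2. *)
Lemma kabs_near_lty :
  (\int[@area R]_z ((kabs z * enorm z)%:E * (\1_(eball 1) z)%:E) < +oo)%E.
Proof.
pose q := 2 `^ (2 * s - 1) : R.
have q0 : 0 < q by rewrite powR_gt0.
have q1 : q < 1.
  rewrite /q -opprB powRN invf_lt1 ?powR_gt0//.
  have := @gt0_ltr_powR R (1 - 2 * s) _ 1 2; rewrite powR1; apply => //.
  - by move: s1; lra.
  - by rewrite nnegrE.
  - by rewrite nnegrE.
  - by rewrite ltr1n.
have mB : measurable (@eball R 1) by exact: measurable_eball.
apply: (@sum_sets_lty _ _ _ _ _ (fun n => eball (2 * (2 ^+ n)^-1))
  (fun n => (4 * q) ^+ n.+1) (64 * q) q).
- apply: measurable_fun_indicM; last exact: mB.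
  by apply: measurable_funM; [exact: measurable_kabs|exact: measurable_enorm_plane].
- by move=> z; rewrite mule_ge0// lee_fin ?mulr_ge0 ?kabs_ge0 ?enorm_ge0.
- by move=> n; exact: measurable_eball.
- by move=> n; rewrite exprn_ge0// mulr_ge0// ltW.
- by rewrite mulr_ge0// ltW.
- by rewrite q0.
- move=> n; apply: ball_weight_le.
  + by rewrite exprn_ge0// mulr_ge0// ltW.
  + by rewrite mulr_ge0// invr_ge0 exprn_ge0.
  rewrite [(4 * q) ^+ _]exprS exprMn [(2 * _) ^+ 2]exprMn exprVn -exprM mulnC exprM.
  have -> : (2 ^+ 2 : R) = 4 by ring.
  have h4 : (4 ^+ n : R) != 0 by rewrite expf_neq0.
  by rewrite le_eqVlt; apply/orP; left; apply/eqP; field.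
- move=> z; rewrite indicE.
  have [zb|zb] := boolP (z \in @eball R 1); last by left; rewrite /= mule0.
  move: zb; rewrite inE /eball /= => z1.
  have [z0|z0] := eqVneq (enorm z) 0.
    by left; rewrite z0 mulr0 mul0e.
  have {}z0 : 0 < enorm z by rewrite lt0r z0 enorm_ge0.
  have z1' : 1 <= (enorm z)^-1 by rewrite invf_ge1// ltW.
  have [n /andP[n1 n2]] := dyadic z1'.
  have e0 : 0 < (2 ^+ n : R) by rewrite exprn_gt0.
  have e1 : 0 < (2 ^+ n.+1 : R) by rewrite exprn_gt0.
  right; exists n; split.
    rewrite -[enorm z]invrK; apply: (@le_lt_trans _ _ (2 ^+ n)^-1).
      by rewrite lef_pV2 ?posrE ?invr_gt0.
    by rewrite ltr_pMl ?invr_gt0// ltr1n.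
  rewrite mule1 lee_fin.
  have -> : kabs z * enorm z = (enorm z)^-1 `^ (1 + 2 * s).
    rewrite /kabs -{2}[enorm z]powRr1 ?(ltW z0)// -powRD ?(gt_eqF z0) ?implybT//.
    rewrite -powR_inv1 ?(ltW z0)// -powRrM; congr (_ `^ _); ring.
  have -> : (4 * q) ^+ n.+1 = (2 ^+ n.+1) `^ (1 + 2 * s).
    rewrite powR_nat_exp//; congr (_ ^+ _).
    have -> : 1 + 2 * s = 2 + (2 * s - 1) by ring.
    rewrite powRD ?pnatr_eq0 ?implybT//; congr (_ * _).
    by rewrite powR_mulrn//; ring.
  apply: ge0_ler_powR => //; rewrite ?nnegrE ?invr_ge0 ?(ltW e1) ?(ltW z0)//.
    by rewrite addr_ge0// mulr_ge0// ltW.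
  exact: ltW.
Qed.

End energy.

Lemma measurable_comp_fst {d1 d2 d3 : measure_display} {T1 : measurableType d1}
    {T2 : measurableType d2} {T3 : measurableType d3} (f : T1 -> T3) :
  measurable_fun setT f -> measurable_fun setT (fun z : T1 * T2 => f z.1).
Proof. by move=> mf; exact: measurableT_comp mf measurable_fst. Qed.

Lemma measurable_comp_snd {d1 d2 d3 : measure_display} {T1 : measurableType d1}
    {T2 : measurableType d2} {T3 : measurableType d3} (f : T2 -> T3) :
  measurable_fun setT f -> measurable_fun setT (fun z : T1 * T2 => f z.2).
Proof. by move=> mf; exact: measurableT_comp mf measurable_snd. Qed.

(** * The perimeter of discs *)

Section kernel_energy.
Context {R : realType}.
Notation pp := (plane R * plane R)%type.

Lemma measurable_pp11 : measurable_fun setT (fun z : pp => z.1.1).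
Proof. exact: measurable_comp_fst (measurableT_comp measurable_fst measurable_plane_id). Qed.

Lemma measurable_pp12 : measurable_fun setT (fun z : pp => z.1.2).
Proof. exact: measurable_comp_fst (measurableT_comp measurable_snd measurable_plane_id). Qed.

Lemma measurable_pp21 : measurable_fun setT (fun z : pp => z.2.1).
Proof. exact: measurable_comp_snd (measurableT_comp measurable_fst measurable_plane_id). Qed.

Lemma measurable_pp22 : measurable_fun setT (fun z : pp => z.2.2).
Proof. exact: measurable_comp_snd (measurableT_comp measurable_snd measurable_plane_id). Qed.

Lemma measurable_enorm_pair {d : measure_display} {T : measurableType d} (f g : T -> R) :
  measurable_fun setT f -> measurable_fun setT g ->
  measurable_fun setT (fun x => @enorm R (f x, g x)).
Proof.
move=> mf mg; apply: (measurableT_comp measurable_enorm).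
by apply: measurable_fun_pair; [exact: mf|exact: mg].
Qed.

Lemma measurable_skernel s : measurable_fun setT (@Defs.kernel R s).
Proof.
apply: (measurableT_comp (measurable_powR _)); apply: measurable_enorm_pair.
  by apply: measurable_funB; [exact: measurable_pp11|exact: measurable_pp21].
by apply: measurable_funB; [exact: measurable_pp12|exact: measurable_pp22].
Qed.

Lemma skernel_ge0 s (z : pp) : 0 <= Defs.kernel s z.
Proof. exact: powR_ge0. Qed.

Lemma enorm_triangle (x z : plane R) : enorm (pmove z x) <= enorm x + enorm z.
Proof.
rewrite -(@ler_pXn2r _ 2)// ?nnegrE ?addr_ge0 ?enorm_ge0//.
have -> : enorm (pmove z x) ^+ 2 = enorm x ^+ 2 + enorm z ^+ 2 + 2 * dotp x z.
  by rewrite !sqr_enorm /dotp /pmove /=; ring.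
have := ler_norm (dotp x z); have := norm_dotp_le x z => h1 h2.
have -> : (enorm x + enorm z) ^+ 2 = enorm x ^+ 2 + enorm z ^+ 2 + 2 * (enorm x * enorm z).
  ring.
rewrite lerD2l ler_pM2l//; exact: le_trans h2 h1.
Qed.

Lemma enorm_scale (k : R) (x : plane R) : enorm (k * x.1, k * x.2) = `|k| * enorm x.
Proof.
rewrite /enorm /dotp /=.
have -> : k * x.1 * (k * x.1) + k * x.2 * (k * x.2) = k ^+ 2 * (x.1 * x.1 + x.2 * x.2) by ring.
by rewrite sqrtrM ?sqr_ge0// sqrtr_sqr.
Qed.

Lemma area_eball_scale (r : R) : 0 < r ->
  (area (@eball R r) = (r ^+ 2)%:E * area (@eball R 1))%E.
Proof.
move=> r0; rewrite (transports_area (transports_dilation r0)); last exact: measurable_eball.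
have -> : (fun z : plane R => (r * z.1, r * z.2) : plane R) @^-1` (eball r) = eball 1.
  apply/seteqP; split => x; rewrite /eball /= enorm_scale gtr0_norm//.
    by rewrite -ltr_pdivlMl// mulVf ?gt_eqF.
  by move=> h; rewrite -ltr_pdivlMl// mulVf ?gt_eqF.
by rewrite integral_cst//; exact: measurable_eball.
Qed.

Lemma area_eball_fin (r : R) : 0 <= r -> area (@eball R r) \is a fin_num.
Proof.
move=> r0; rewrite ge0_fin_numE; last exact: mu_ext_ge0.
exact: le_lt_trans (area_eball_le r0) (ltry _).
Qed.

(** If |z| < 1, the points that [z] moves out of the disc lie in the annulus of width |z| along its
    boundary, of area |B_1| (1 - (1 - |z|)^2) <= 8 |z|. This factor |z| is what tames the kernel at
    the origin. *)
Lemma area_escape_le (z : plane R) :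
  (area (@eball R 1 `&` [set x | ~ eball 1 (pmove x z)]) <=
   8%:E * ((\1_(~` (@eball R 1)) z)%:E + (enorm z)%:E * (\1_(@eball R 1) z)%:E))%E.
Proof.
have h4 := @area_eball_le R 1 ler01; rewrite expr1n mulr1 in h4.
have [z1|z1] := ltP (enorm z) 1; last first.
  have zn : ~ @eball R 1 z by rewrite /eball /= => h; move: z1; rewrite leNgt h.
  rewrite !indicE mem_set// memNset// mule0 adde0 mule1.
  apply: (le_trans (le_area (@subIsetl _ _ _))); apply: (le_trans h4).
  by rewrite lee_fin; lra.
have zB : @eball R 1 z by [].
rewrite !indicE (mem_set zB) memNset//= add0e mule1 -EFinM.
have fin1 := area_eball_fin ler01.
have [z0|z0] := eqVneq (enorm z) 1; first by move: z1; rewrite z0 ltxx.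
have p0 : 0 < 1 - enorm z by rewrite subr_gt0.
have m1 := @measurable_eball R 1; have m2 := @measurable_eball R (1 - enorm z).
apply: (@le_trans _ _ (area (@eball R 1 `\` eball (1 - enorm z)))).
  apply: le_area => x [x1 xz]; split => // xz'; apply: xz.
  rewrite /eball /=; have := enorm_triangle z x; rewrite /eball /= in xz'; lra.
have -> : area (@eball R 1 `\` eball (1 - enorm z)) =
    (area (@eball R 1) - area (@eball R 1 `&` eball (1 - enorm z)))%E.
  by apply: measureD; [exact: m1|exact: m2|rewrite -ge0_fin_numE//; exact: mu_ext_ge0].
have -> : @eball R 1 `&` eball (1 - enorm z) = eball (1 - enorm z).
  apply/setIidr => x; rewrite /eball /=; have := enorm_ge0 z; lra.
rewrite (area_eball_scale p0).
move: h4; rewrite -(fineK fin1) -EFinM -EFinB !lee_fin => h4.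
have a0 : 0 <= fine (area (@eball R 1)) by apply: fine_ge0; exact: mu_ext_ge0.
have := enorm_ge0 z; nra.
Qed.

Section ball_energy.
Variable s : R.
Hypotheses (s0 : 0 < s) (s1 : s < 1 / 2).

Lemma kernel_pmove (x z : plane R) : Defs.kernel s (x, pmove x z) = kabs s z.
Proof.
rewrite /Defs.kernel /kabs /pmove /=; congr (_ `^ _).
have := enorm_scale (-1) z; rewrite normrN1 mul1r => <-.
by congr (enorm (_, _)); ring.
Qed.

Definition escape : set pp := [set z | eball 1 z.1 /\ ~ eball 1 (pmove z.1 z.2)].

Lemma measurable_escape : measurable escape.
Proof.
have mD : measurable [set z : pp | eball 1 (pmove z.1 z.2)].
  have mf : measurable_fun setT (fun z : pp => enorm (pmove z.1 z.2)).
    apply: measurable_enorm_pair.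
      by apply: measurable_funD; [exact: measurable_pp21|exact: measurable_pp11].
    by apply: measurable_funD; [exact: measurable_pp22|exact: measurable_pp12].
  have -> : [set z : pp | eball 1 (pmove z.1 z.2)] =
      (fun z : pp => enorm (pmove z.1 z.2)) @^-1` `]-oo, 1[.
    by apply/seteqP; split => x; rewrite /eball /= in_itv.
  by rewrite -[X in measurable X]setTI; exact: mf.
have mB : measurable (@fst (plane R) (plane R) @^-1` (eball 1)).
  rewrite -[X in measurable X]setTI; apply: measurable_fst => //.
  exact: measurable_eball.
exact: (measurableI _ _ mB (measurableC mD)).
Qed.

(** After the substitution y = x + z and Tonelli, the interaction is the integral over z of the
    kernel times the area of the points that z moves out of the disc. *)
Lemma interaction_ball_lty : (interaction s (@eball R 1) (~` (eball 1)) < +oo)%E.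
Proof.
have mB := @measurable_eball R 1; have mC := measurableC mB.
have mX : measurable ((@eball R 1) `*` ~` (@eball R 1)) by exact: measurableX.
rewrite /interaction integral_indicM fubini_tonelli1; last 2 first.
- by apply: measurable_fun_indicM; [exact: measurable_skernel|exact: mX].
- by move=> z; rewrite mule_ge0// lee_fin ?skernel_ge0.
pose g (z : pp) : \bar R := ((kabs s z.2)%:E * (\1_escape z)%:E)%E.
have mk2 : measurable_fun setT (fun z : pp => kabs s z.2).
  exact: (measurableT_comp (measurable_kabs s) measurable_snd).
have mg : measurable_fun setT g.
  by apply: measurable_fun_indicM; [exact: mk2|exact: measurable_escape].
have g0 z : (0 <= g z)%E by rewrite mule_ge0// lee_fin ?kabs_ge0.
have -> : (\int[@area R]_x fubini_F (@area R) (fun z : pp =>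
    (Defs.kernel s z)%:E * (\1_((@eball R 1) `*` ~` (@eball R 1)) z)%:E) x)%E =
    (\int[@area R]_x \int[@area R]_z g (x, z))%E.
  apply: eq_integral => x _; rewrite /fubini_F.
  have [_ _ _ h] := mpres_pmove x; rewrite h; last 2 first.
  - apply: (measurableT_comp (f := fun z : pp => ((Defs.kernel s z)%:E *
      (\1_((@eball R 1) `*` ~` (@eball R 1)) z)%:E)%E)).
      by apply: measurable_fun_indicM; [exact: measurable_skernel|exact: mX].
    exact: pair1_measurable.
  - by move=> z; rewrite mule_ge0// lee_fin ?skernel_ge0.
  apply: eq_integral => z _; rewrite mule1 kernel_pmove /g /=; congr (_ * _%:E)%E.
rewrite fubini_tonelli; [|exact: mg|exact: g0].
apply: (@le_lt_trans _ _ (\int[@area R]_z (8%:E * ((kabs s z)%:E * (\1_(~` (@eball R 1)) z)%:E +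
    (kabs s z * enorm z)%:E * (\1_(@eball R 1) z)%:E)))%E).
  apply: ge0_le_integral; [exact: measurableT| | | |].
  - by move=> z _; apply: integral_ge0 => x _.
  - by apply: measurable_fun_fubini_tonelli_G; first [exact: g0|exact: mg].
  - apply: emeasurable_funM; first exact: measurable_cst.
    apply: emeasurable_funD; apply: measurable_fun_indicM.
    + exact: measurable_kabs.
    + exact: mC.
    + by apply: measurable_funM; [exact: measurable_kabs|exact: measurable_enorm_plane].
    + exact: mB.
  - move=> z _; rewrite /g /=.
    have me : measurable (ysection escape z).
      by apply: measurable_ysection; exact: measurable_escape.
    have -> : (\int[@area R]_x ((kabs s z)%:E * (\1_escape (x, z))%:E) =
        (kabs s z)%:E * area (ysection escape z))%E.
      rewrite -integral_cst_indic; [|exact: kabs_ge0|exact: me].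
      by apply: eq_integral => x _; rewrite !indicE mem_ysection.
    rewrite EFinM -muleA -ge0_muleDr ?lee_fin ?mule_ge0 ?lee_fin ?mulr_ge0 ?enorm_ge0//.
    rewrite muleCA lee_wpmul2l ?lee_fin ?kabs_ge0//.
    apply: le_trans (area_escape_le z); apply: le_area => x.
    by rewrite /ysection /= inE /escape /=.
rewrite ge0_integralZl; last 4 first.
- exact: measurableT.
- apply: emeasurable_funD; apply: measurable_fun_indicM.
    + exact: measurable_kabs.
    + exact: mC.
    + by apply: measurable_funM; [exact: measurable_kabs|exact: measurable_enorm_plane].
    + exact: mB.
- by move=> z _; rewrite adde_ge0// mule_ge0// lee_fin ?mulr_ge0 ?kabs_ge0 ?enorm_ge0.
- by rewrite lee_fin.
rewrite ge0_integralD; last 5 first.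
- exact: measurableT.
- by move=> z _; rewrite mule_ge0// lee_fin ?kabs_ge0.
- by apply: measurable_fun_indicM; [exact: measurable_kabs|exact: mC].
- by move=> z _; rewrite mule_ge0// lee_fin ?mulr_ge0 ?kabs_ge0 ?enorm_ge0.
- apply: measurable_fun_indicM; last exact: mB.
  by apply: measurable_funM; [exact: measurable_kabs|exact: measurable_enorm_plane].
rewrite lte_mul_pinfty ?lee_fin//.
by rewrite lte_add_pinfty//; [exact: kabs_far_lty|exact: kabs_near_lty].
Qed.

(** The dilation gives r^4 from the two Jacobians and r^(-(2 + 2s)) from the kernel. *)
Lemma interaction_ball_scale (r : R) : 0 < r ->
  (interaction s (@eball R r) (~` (eball r)) =
   (r `^ (2 - 2 * s))%:E * interaction s (@eball R 1) (~` (eball 1)))%E.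
Proof.
move=> r0.
have mXr q : measurable ((@eball R q) `*` ~` (@eball R q)).
  by apply: measurableX; [|apply: measurableC]; exact: measurable_eball.
rewrite /interaction [in LHS]integral_indicM [in RHS]integral_indicM.
have [_ _ _ h] := transports_prod (transports_dilation r0).
rewrite h; last 2 first.
- by apply: measurable_fun_indicM; [exact: measurable_skernel|exact: mXr].
- by move=> z; rewrite mule_ge0// lee_fin ?skernel_ge0.
rewrite -ge0_integralZl; last 4 first.
- exact: measurableT.
- by apply: measurable_fun_indicM; [exact: measurable_skernel|exact: mXr].
- by move=> z _; rewrite mule_ge0// lee_fin ?skernel_ge0.
- by rewrite lee_fin powR_ge0.
apply: eq_integral => z _ /=.
have -> : Defs.kernel s ((r * z.1.1, r * z.1.2) : plane R, (r * z.2.1, r * z.2.2) : plane R) =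
    r `^ (- (2 + 2 * s)) * Defs.kernel s z.
  rewrite /Defs.kernel /= -powRM ?(ltW r0) ?enorm_ge0//; congr (_ `^ _).
  have := enorm_scale r (z.1.1 - z.2.1, z.1.2 - z.2.2); rewrite gtr0_norm// => <- /=.
  by rewrite !mulrBr.
have rb (x : plane R) : (eball r (r * x.1, r * x.2)) = eball 1 x.
  rewrite /eball /= enorm_scale gtr0_norm//.
  by apply/propext; split => ?; [rewrite -(ltr_pM2l r0) mulr1|rewrite -[ltRHS]mulr1 ltr_pM2l].
rewrite muleAC muleA -!EFinM !indicE.
have -> : ((r * z.1.1, r * z.1.2), (r * z.2.1, r * z.2.2)) \in
   ((@eball R r) `*` ~` (@eball R r)) = (z \in ((@eball R 1) `*` ~` (@eball R 1))).
  by apply/idP/idP; rewrite !inE /= => -[h1 h2]; split; move: h1 h2; rewrite /= ?rb.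
congr (_%:E); congr (_ * _); rewrite mulrAC; congr (_ * _).
have -> : 2 - 2 * s = - (2 + 2 * s) + 4 by ring.
rewrite powRD ?(gt_eqF r0) ?implybT//; congr (_ * _).
by rewrite powR_mulrn ?ltW//; ring.
Qed.

End ball_energy.
End kernel_energy.

(** * Perimeter and minimality *)

Section perimeter.
Context {R : realType}.
Notation pp := (plane R * plane R)%type.
Variable s : R.

Definition Kint (X : set pp) : \bar R :=
  (\int[@area R \x @area R]_(z in X) (Defs.kernel s z)%:E)%E.

Lemma Kint_ge0 X : (0 <= Kint X)%E.
Proof. by apply: integral_ge0 => z _; rewrite lee_fin skernel_ge0. Qed.

Lemma measurable_kernel_on (X : set pp) :
  measurable_fun X (fun z => (Defs.kernel s z)%:E).
Proof.
have /measurable_EFinP h := measurable_skernel s.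
exact: (measurable_funTS h).
Qed.

Lemma le_Kint X Y : measurable X -> measurable Y -> X `<=` Y -> (Kint X <= Kint Y)%E.
Proof.
move=> mX mY XY; apply: ge0_subset_integral; [exact: mX|exact: mY| | |exact: XY].
  exact: measurable_kernel_on.
by move=> z _; rewrite lee_fin skernel_ge0.
Qed.

Lemma Kint_setU X Y : measurable X -> measurable Y -> [disjoint X & Y]%classic ->
  Kint (X `|` Y) = (Kint X + Kint Y)%E.
Proof.
move=> mX mY XY; apply: ge0_integral_setU; [exact: mX|exact: mY| | |exact: XY].
  exact: measurable_kernel_on.
by move=> z _; rewrite lee_fin skernel_ge0.
Qed.

Lemma Kint_setUI X Y : measurable X -> measurable Y ->
  (Kint (X `|` Y) + Kint (X `&` Y) = Kint X + Kint Y)%E.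
Proof.
move=> mX mY; have mD : measurable (Y `\` X) by exact: measurableD.
have mI : measurable (X `&` Y) by exact: measurableI.
have -> : X `|` Y = X `|` (Y `\` X).
  by apply/seteqP; split => x /=; have [?|?] := pselect (X x); tauto.
rewrite Kint_setU//; last by apply/disj_set2P; rewrite setDE setICA setICr setI0.
have {3}-> : Y = (Y `\` X) `|` (X `&` Y).
  by apply/seteqP; split => x /=; have [?|?] := pselect (X x); tauto.
have dis : [disjoint (Y `\` X) & (X `&` Y)]%classic.
  by apply/disj_set2P; rewrite setDE -setIA [~` X `&` _]setIA setICl set0I setI0.
by rewrite (Kint_setU mD mI dis) [RHS]addeA.
Qed.

(* The pairs counted by the perimeter of [E] in [Om]: those separated by [E] with
   at least one point in [Om]. *)
Definition cross (Om E : set (plane R)) : set pp :=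
  (E `*` ~` E) `&` ~` (~` Om `*` ~` Om).

Lemma measurable_cross Om E : measurable Om -> measurable E -> measurable (cross Om E).
Proof.
move=> mO mE; apply: measurableI.
  by apply: measurableX; [exact: mE|exact: measurableC].
apply: measurableC; apply: measurableX; exact: measurableC.
Qed.

(** Once the three interactions are merged into one integral, perimeters are compared through
    inclusions between sets of pairs. *)
Lemma s_perimeterE E Om : measurable E -> measurable Om ->
  s_perimeter s E Om = Kint (cross Om E).
Proof.
move=> mE mO; have mEc := measurableC mE; have mOc := measurableC mO.
rewrite /s_perimeter /interaction.
rewrite -![integral _ _ _]/(Kint _).
rewrite -Kint_setU; last 3 first.
- by apply: measurableX; apply: measurableI.
- by apply: measurableX; [apply: measurableI|apply: measurableD].
- by apply/disj_set2P; apply/seteqP; split => // -[x y] /= [[_ [_ +]] [_ [_]]].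
rewrite -Kint_setU; last 3 first.
- apply: measurableU; apply: measurableX; (try exact: measurableI); exact: measurableD.
- by apply: measurableX; [apply: measurableD|apply: measurableI].
- by apply/disj_set2P; apply/seteqP; split => // -[x y] /= [[[[_ +] _]|[[_ +] _]] [[_]]].
congr Kint; apply/seteqP; split => -[x y]; rewrite /cross /=.
  by move=> [[[[? ?] [? ?]]|[[? ?] [? ?]]]|[[? ?] [? ?]]]; split => //; tauto.
move=> [[Ex Ey] nO].
have [Ox|Ox] := pselect (Om x); have [Oy|Oy] := pselect (Om y).
- by left; left.
- by left; right.
- by right.
- by exfalso; apply: nO.
Qed.

(** The inequality reduces to two inclusions. A pair leading from [E] minus [A] to [A] minus [E] is
    counted for [E], but neither for the union nor for the intersection: this is the defect term.
    Agreement outside [Om] puts its first point in [Om]. *)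
Lemma perimeter_submodular Om E A : measurable Om -> measurable E -> measurable A ->
  A `\` Om = E `\` Om ->
  (Kint (cross Om (E `|` A)) + Kint (cross Om (E `&` A)) +
   Kint ((E `\` A) `*` (A `\` E)) <= Kint (cross Om E) + Kint (cross Om A))%E.
Proof.
move=> mO mE mA AE.
have mU : measurable (E `|` A) by exact: measurableU.
have mI : measurable (E `&` A) by exact: measurableI.
have mcU := measurable_cross mO mU; have mcI := measurable_cross mO mI.
have mcE := measurable_cross mO mE; have mcA := measurable_cross mO mA.
have mbc : measurable ((E `\` A) `*` (A `\` E)).
  by apply: measurableX; exact: measurableD.
have EO x : E x -> ~ A x -> Om x.
  move=> Ex nAx; apply: contrapT => nO.
  by have : (E `\` Om) x by []; rewrite -AE => -[].
rewrite -Kint_setUI// -[leRHS]Kint_setUI// addeAC; apply: leeD.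
  rewrite -Kint_setU//; last 2 first.
  - exact: measurableU.
  - apply/disj_set2P; apply/seteqP; split => // -[x y]; rewrite /cross /=.
    by move=> [[[[_ +] _]|[[+ _] _]] [[? ?] [? ?]]]; tauto.
  apply: le_Kint; [by do 2?apply: measurableU|exact: measurableU|].
  move=> -[x y]; rewrite /cross /= => -[[[[? ?] ?]|[[? ?] ?]]|[[Ex ?] [? ?]]].
  + by tauto.
  + by have [?|?] := pselect (E y); tauto.
  + by left; split => //; have := EO _ Ex; tauto.
apply: le_Kint; [exact: measurableI|exact: measurableI|].
by move=> -[x y]; rewrite /cross /=; tauto.
Qed.

(** Union and intersection agree with [E] outside [Om], so each has perimeter at least that of [E],
    which is finite and can be cancelled. *)
Lemma minimizer_exchange Om E A (eta : R) : measurable Om -> s_minimizer s Om E ->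
  measurable A -> A `\` Om = E `\` Om ->
  (s_perimeter s A Om <= (1 + eta)%:E * s_perimeter s E Om)%E ->
  (Kint ((E `\` A) `*` (A `\` E)) <= eta%:E * s_perimeter s E Om)%E.
Proof.
move=> mO [mE Efin Emin] mA AE hA.
have mU : measurable (E `|` A) by exact: measurableU.
have mI : measurable (E `&` A) by exact: measurableI.
have := perimeter_submodular mO mE mA AE.
have hU := Emin _ mU; have hI := Emin _ mI.
move: hA hU hI; rewrite !s_perimeterE// => hA hU hI hs.
have P0 := Kint_ge0 (cross Om E).
have Pfin : Kint (cross Om E) \is a fin_num.
  by rewrite ge0_fin_numE//; move: Efin; rewrite s_perimeterE.
have {}hU : (Kint (cross Om E) <= Kint (cross Om (E `|` A)))%E.
  by apply: hU; rewrite setDUl AE setUid.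
have {}hI : (Kint (cross Om E) <= Kint (cross Om (E `&` A)))%E.
  by apply: hI; rewrite setDE setIIl -!setDE AE setIid.
have := leeD (leeD hU hI) (lexx (Kint ((E `\` A) `*` (A `\` E)))).
move=> /le_trans/(_ hs)/le_trans/(_ (leeD (lexx (Kint (cross Om E))) hA)).
move: Pfin P0 => /fineK <-; set p := fine _ => _; clearbody p.
case: (Kint _) => [k| |].
- by rewrite -!EFinM -!EFinD !lee_fin; clear => h; lra.
- by rewrite addey// -!EFinM -EFinD leye_eq.
- by move=> _; rewrite leNye.
Qed.

End perimeter.

(** * Energy bound and second variation of the perimeter *)

Section second_variation.
Context {R : realType}.
Notation pp := (plane R * plane R)%type.
Variable s : R.
Hypotheses (s0 : 0 < s) (s1 : s < 1 / 2).

(** The competitor is [E] emptied inside the ball: only pairs with exactly one point in the ball are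
    left. *)
Lemma minimizer_energy (r : R) E : 0 < r -> s_minimizer s (eball r) E ->
  (s_perimeter s E (eball r) <=
   (r `^ (2 - 2 * s))%:E * interaction s (@eball R 1) (~` (eball 1)))%E.
Proof.
move=> r0 [mE _ Emin]; have mB := @measurable_eball R r.
have mD : measurable (E `\` eball r) by exact: measurableD.
apply: (@le_trans _ _ (s_perimeter s (E `\` eball r) (eball r))).
  by apply: Emin => //; rewrite setDDl setUid.
rewrite -interaction_ball_scale// s_perimeterE//.
have -> : Kint s (cross (eball r) (E `\` eball r)) =
    Kint s ((E `\` eball r) `*` eball r).
  congr Kint; apply/seteqP; split => -[x y]; rewrite /cross /=; last by tauto.
  by have [?|?] := pselect (@eball R r y); tauto.
apply: (@le_trans _ _ (Kint s (~` (eball r) `*` eball r))).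
  apply: le_Kint.
  - by apply: measurableX; [exact: mD|exact: mB].
  - by apply: measurableX; [exact: measurableC|exact: mB].
  - by move=> [x y] /= [[]].
have mX : measurable (@eball R r `*` ~` (eball r)).
  by apply: measurableX; [exact: mB|exact: measurableC].
have mY : measurable (~` (@eball R r) `*` eball r).
  by apply: measurableX; [exact: measurableC|exact: mB].
rewrite /Kint /interaction.
rewrite integral_indicM [leRHS]integral_indicM fubini_tonelli1; last 2 first.
- by apply: measurable_fun_indicM; [exact: measurable_skernel|exact: mY].
- by move=> z; rewrite mule_ge0// lee_fin skernel_ge0.
rewrite fubini_tonelli2; last 2 first.
- by apply: measurable_fun_indicM; [exact: measurable_skernel|exact: mX].
- by move=> z; rewrite mule_ge0// lee_fin skernel_ge0.
rewrite le_eqVlt; apply/orP; left; apply/eqP.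
apply: eq_integral => x _; apply: eq_integral => y _; congr (_%:E * _%:E)%E.
  rewrite /Defs.kernel /=; congr (_ `^ _).
  have := enorm_scale (-1) (y.1 - x.1, y.2 - x.2); rewrite normrN1 mul1r => <- /=.
  by congr (enorm (_, _)); ring.
by rewrite !indicE; congr (nat_of_bool _)%:R; apply/idP/idP; rewrite !inE /= => -[].
Qed.

(** Both perimeters are pulled back to the pairs separated by [E], where the kernel estimate holds
    pointwise with kap = 16 |t| / r; |t| <= r/128 means kap <= 1/8. Separated points are distinct,
    so the diagonal is avoided. *)
Lemma perimeter_variation (r t : R) (v : plane R) E : 0 < r -> dotp v v = 1 ->
  `|t| <= r / 128 -> measurable E ->
  forall phi a : plane R -> R,
  (forall x y, `|phi x - phi y| <= 16 / r * enorm (pdiff x y)) ->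
  (forall x, r <= enorm x -> phi x = 0) ->
  (forall x, `|a x| <= 4 / r) ->
  (forall t, `|t| <= r / 16 ->
     transports (@area R) (@area R) (fun x => pshift v (t * phi x) x)
          (fun x => 1 + t * a x)) ->
  forall A A', measurable A -> measurable A' ->
  (forall x, A (pshift v (t * phi x) x) <-> E x) ->
  (forall x, A' (pshift v (- t * phi x) x) <-> E x) ->
  injective (fun x => pshift v (t * phi x) x) ->
  injective (fun x => pshift v (- t * phi x) x) ->
  (s_perimeter s A (eball r) + s_perimeter s A' (eball r) <=
   (2 + 110 * (16 * `|t| / r) ^+ 2)%:E * s_perimeter s E (eball r))%E.
Proof.
move=> r0 v1 tr mE; have t16 : `|t| <= r / 16 by lra.
have tN16 : `|- t| <= r / 16 by rewrite normrN.
have t8 : 16 * `|t| / r <= 1 / 8 by rewrite ler_pdivrMr//; lra.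
move=> phi a phiL phi0 ha hT A A' mA mA' AP AP' inj inj'.
have mB := @measurable_eball R r.
(* The map is injective and fixes every point outside the ball, so it cannot send a point of the
   ball outside. *)
have ballP c : injective (fun x => pshift v (c * phi x) x) ->
    forall x, eball r (pshift v (c * phi x) x) <-> eball r x.
  move=> cinj x.
  have fixP y : ~ eball r y -> pshift v (c * phi y) y = y.
    move=> /negP; rewrite -leNgt => /phi0 ->; rewrite mulr0 /pshift !mul0r !addr0.
    by rewrite -surjective_pairing.
  split=> h; apply: contrapT => h'.
    by move: h; rewrite fixP.
  have := fixP _ h' => /cinj e.
  by move: h'; rewrite e.
have perE c (A0 : set (plane R)) : `|c| <= r / 16 -> measurable A0 ->
    (forall x, A0 (pshift v (c * phi x) x) <-> E x) ->
    injective (fun x => pshift v (c * phi x) x) ->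
    s_perimeter s A0 (eball r) = (\int[@area R \x @area R]_z
      ((Defs.kernel s (pshift v (c * phi z.1) z.1, pshift v (c * phi z.2) z.2) *
       ((1 + c * a z.1) * (1 + c * a z.2)))%:E * (\1_(cross (eball r) E) z)%:E))%E.
  move=> cr mA0 A0P cinj; rewrite s_perimeterE// /Kint integral_indicM.
  have mc := measurable_cross mB mA0.
  have [_ _ _ h] := transports_prod (hT c cr).
  rewrite h; last 2 first.
  - by apply: measurable_fun_indicM; [exact: measurable_skernel|exact: mc].
  - by move=> z; rewrite mule_ge0// lee_fin skernel_ge0.
  apply: eq_integral => z _ /=; rewrite muleAC -!EFinM.
  congr (_%:E); congr (_ * _); rewrite !indicE; congr (nat_of_bool _)%:R.
  apply/idP/idP; rewrite !inE /cross /=.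
    by rewrite !(ballP _ cinj) !A0P.
  by rewrite !(ballP _ cinj) !A0P.
rewrite (perE t A t16 mA AP inj) (perE (- t) A' tN16 mA' AP' inj').
rewrite (s_perimeterE s mE mB) /Kint [in leRHS]integral_indicM.
have mcE := measurable_cross mB mE.
have mkp c : `|c| <= r / 16 -> measurable_fun setT (fun z : pp => Defs.kernel s
    (pshift v (c * phi z.1) z.1, pshift v (c * phi z.2) z.2) *
       ((1 + c * a z.1) * (1 + c * a z.2))).
  by move=> cr; exact: (transports_prod_integrand (hT c cr) (measurable_skernel s)).
have J0 c x : `|c| <= r / 16 -> 0 <= 1 + c * a x.
  by move=> cr; have [_ _ + _] := hT c cr; apply.
rewrite -ge0_integralD; last 5 first.
- exact: measurableT.
- by move=> z _; rewrite mule_ge0// lee_fin mulr_ge0 ?skernel_ge0// mulr_ge0// J0.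
- by apply: measurable_fun_indicM; [exact: mkp|exact: mcE].
- by move=> z _; rewrite mule_ge0// lee_fin mulr_ge0 ?skernel_ge0// mulr_ge0// J0.
- by apply: measurable_fun_indicM; [exact: mkp|exact: mcE].
rewrite -ge0_integralZl; last 4 first.
- exact: measurableT.
- by apply: measurable_fun_indicM; [exact: measurable_skernel|exact: mcE].
- by move=> z _; rewrite mule_ge0// lee_fin skernel_ge0.
- by rewrite lee_fin addr_ge0// mulr_ge0// sqr_ge0.
apply: ge0_le_integral; [exact: measurableT| | | |].
- by move=> z _; rewrite adde_ge0// mule_ge0// lee_fin mulr_ge0 ?skernel_ge0// mulr_ge0// J0.
- apply: emeasurable_funD; (apply: measurable_fun_indicM; [exact: mkp|exact: mcE]).
- apply: emeasurable_funM; first exact: measurable_cst.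
  by apply: measurable_fun_indicM; [exact: measurable_skernel|exact: mcE].
move=> [x y] _ /=; rewrite -ge0_muleDl ?lee_fin ?mulr_ge0 ?skernel_ge0 ?J0//.
rewrite mulrA !indicE.
have [|_] := boolP ((x, y) \in _); last by rewrite !mulr0.
rewrite inE /cross /= !mulr1 => -[[Ex nEy] _].
rewrite !kernelE.
pose d := pdiff x y.
have d0 : 0 < dotp d d.
  rewrite lt0r dotp_ge0 andbT; apply/eqP => d0; apply: nEy; suff <- : x = y by [].
  have h1 : `|d.1| <= 0 by rewrite (le_trans (enorm_fst d))// /enorm d0 sqrtr0.
  have h2 : `|d.2| <= 0 by rewrite (le_trans (enorm_snd d))// /enorm d0 sqrtr0.
  rewrite !normr_le0 /d /pdiff /= !subr_eq0 in h1 h2.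
  by rewrite [LHS]surjective_pairing (eqP h1) (eqP h2) -surjective_pairing.
have shiftE c : pdiff (pshift v (c * phi x) x) (pshift v (c * phi y) y) =
    pshift v (c * (phi x - phi y)) d.
  by rewrite pdiff_pshift -mulrBr.
rewrite !shiftE.
have tr0 : 0 <= `|t| by [].
have := @kernel_second_variation R s s0 s1 d v (t * (phi x - phi y)) (16 * `|t| / r)
  (t * a x) (t * a y) d0 v1.
rewrite /kpow !mulNr; apply.
- exact: t8.
- rewrite normrM; apply: (le_trans (ler_wpM2l tr0 (phiL x y))).
  by rewrite -/d le_eqVlt; apply/orP; left; apply/eqP; ring.
- rewrite normrM; apply: (le_trans (ler_wpM2l tr0 (ha x))).
  rewrite mulrA [16 * _]mulrC ler_wpM2r ?invr_ge0 ?(ltW r0)//.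
  by rewrite ler_wpM2l// ler_nat.
- rewrite normrM; apply: (le_trans (ler_wpM2l tr0 (ha y))).
  rewrite mulrA [16 * _]mulrC ler_wpM2r ?invr_ge0 ?(ltW r0)//.
  by rewrite ler_wpM2l// ler_nat.
Qed.

End second_variation.

(** * Flux of a minimizer under translations *)

Section flux.
Context {R : realType}.
Notation pp := (plane R * plane R)%type.

Definition gain (E : set (plane R)) (v : plane R) (t : R) : set (plane R) :=
  [set x | E x /\ ~ E (pshift v (- t) x)].

Lemma mpres_pshift v c : mpres (@pshift R v c).
Proof. exact: (mpres_pmove (c * v.1, c * v.2)). Qed.

Lemma measurable_gain E v t : measurable E -> measurable (gain E v t).
Proof.
move=> mE; have [mT _ _ _] := mpres_pshift v (- t).
have mP : measurable (pshift v (- t) @^-1` E).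
  by rewrite -[X in measurable X]setTI; exact: mT.
exact: (measurableI _ _ mE (measurableC mP)).
Qed.

Lemma pshiftK (v : plane R) (c : R) : cancel (pshift v (- c)) (pshift v c).
Proof.
move=> x; rewrite [RHS]surjective_pairing /pshift /=; congr (_, _); ring.
Qed.

Variable s : R.
Hypotheses (s0 : 0 < s) (s1 : s < 1 / 2).

(** The diameter of B_10 is 20, and s < 1/2 gives 20^(2 + 2s) <= 20^3. *)
Lemma kernel_ge (x y : plane R) : enorm (pdiff x y) <= 20 -> x <> y ->
  (20 ^+ 3)^-1 <= Defs.kernel s (x, y).
Proof.
move=> h xy; rewrite /Defs.kernel /= -/(pdiff x y) powRN.
have q0 : 0 < enorm (pdiff x y).
  rewrite lt0r enorm_ge0 andbT; apply/eqP => q0; apply: xy.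
  have := enorm_fst (pdiff x y); have := enorm_snd (pdiff x y).
  rewrite q0 !normr_le0 /pdiff /= !subr_eq0 => /eqP h2 /eqP h1.
  by rewrite [LHS]surjective_pairing h1 h2 -surjective_pairing.
rewrite lef_pV2 ?posrE ?powR_gt0//.
apply: (@le_trans _ _ (20 `^ (2 + 2 * s))).
  apply: ge0_ler_powR => //; rewrite ?nnegrE ?enorm_ge0//.
  by rewrite addr_ge0// mulr_ge0// ltW.
apply: (@le_trans _ _ (20 `^ 3)); first by apply: ler_powR; [rewrite ler1n|move: s1; lra].
by rewrite powR_mulrn.
Qed.

Lemma Kint_ge (X Y : set (plane R)) : measurable X -> measurable Y ->
  X `<=` eball 10 -> Y `<=` eball 10 -> [disjoint X & Y]%classic ->
  (((20 ^+ 3)^-1)%:E * (area X * area Y) <= Kint s (X `*` Y))%E.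
Proof.
move=> mX mY XB YB /disj_set2P XY.
have mXY : measurable (X `*` Y) by exact: measurableX.
have -> : (((20 ^+ 3)^-1)%:E * (area X * area Y) =
    \int[@area R \x @area R]_(z in X `*` Y) ((20 ^+ 3)^-1)%:E)%E.
  rewrite integral_cst; last exact: mXY.
  by congr (_ * _)%E; apply/esym; apply: product_measure1E.
apply: ge0_le_integral; [exact: mXY| | | |].
- by move=> z _; rewrite lee_fin invr_ge0 exprn_ge0.
- exact: measurable_cst.
- exact: measurable_kernel_on.
move=> [x y] [/= Xx Yy]; rewrite lee_fin; apply: kernel_ge; last first.
  move=> xy; have : (X `&` Y) x by split => //; rewrite xy.
  by rewrite XY.
have := enorm_triangle x (- 1 * y.1, - 1 * y.2); rewrite enorm_scale normrN1 mul1r.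
have -> : pmove (- 1 * y.1, - 1 * y.2) x = pdiff x y.
  by rewrite /pmove /pdiff /=; congr (_, _); ring.
by have := XB _ Xx; have := YB _ Yy; rewrite /eball /=; lra.
Qed.

(** Inside B_10 the deformed set is the translate E + t v, so the two gains lie in the two
    differences of [E] and its deformation, where the kernel is at least 20^(-3). *)
Lemma minimizer_product r t v E : 128 * 10 <= r -> 0 <= t <= 10 -> dotp v v = 1 ->
  s_minimizer s (eball r) E ->
  (((20 ^+ 3)^-1)%:E * (area (eball 10 `&` gain E v t) * area (eball 10 `&` gain (~` E) v t)) <=
   (110 * 16 ^+ 2 * t ^+ 2 / r ^+ 2)%:E *
   ((r `^ (2 - 2 * s))%:E * interaction s (@eball R 1) (~` (eball 1))))%E.
Proof.
move=> r1280 /andP[t0 t10] v1; have r0 : 0 < r by lra.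
(* With l = r/4 the cutoff vanishes where |x| >= 4l = r, as a competitor requires. *)
have l0 : 0 < r / 4 by lra.
have tr : `|t| <= r / 128 by rewrite ger0_norm//; lra.
have tr' : `|t| <= r / 16 by lra.
move=> Emin; have [mE Efin Eopt] := Emin.
have [phi [a [phiL phi1 phi0 ha hT]]] := directional_bump v1 l0.
have e1 : 4 / (r / 4) = 16 / r by field; rewrite gt_eqF.
have e2 : (r / 4)^-1 = 4 / r by field; rewrite gt_eqF.
have e3 : r / 4 / 4 = r / 16 by field.
have e4 : 4 * (r / 4) = r by field.
rewrite e1 in phiL; rewrite e2 in ha; rewrite e3 in hT; rewrite e4 in phi0.
have tNr' : `|- t| <= r / 16 by rewrite normrN.
have hT' c (h : `|c| <= r / 16) := (hT c h).1.
have [_ [T [mT TK KT]]] := hT t tr'; have [_ [T' [mT' TK' KT']]] := hT (- t) tNr'.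
pose A : set (plane R) := T @^-1` E; pose A' : set (plane R) := T' @^-1` E.
have mA : measurable A by rewrite -[X in measurable X]setTI; exact: mT.
have mA' : measurable A' by rewrite -[X in measurable X]setTI; exact: mT'.
have outP c (S : plane R -> plane R) : cancel (fun x => pshift v (c * phi x) x) S ->
    S @^-1` E `\` eball r = E `\` eball r.
  move=> KS; apply/seteqP; split => x /= [Ex nB]; split => //; move: Ex.
    have fx : pshift v (c * phi x) x = x.
      rewrite phi0 ?mulr0; last by rewrite leNgt; apply/negP.
      by rewrite /pshift !mul0r !addr0 -surjective_pairing.
    by have := KS x; rewrite fx => ->.
  have fx : pshift v (c * phi x) x = x.
    rewrite phi0 ?mulr0; last by rewrite leNgt; apply/negP.
    by rewrite /pshift !mul0r !addr0 -surjective_pairing.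
  by have := KS x; rewrite fx => ->.
have AO : A `\` eball r = E `\` eball r by exact: (outP t).
have AO' : A' `\` eball r = E `\` eball r by exact: (outP (- t)).
have mB := @measurable_eball R r.
pose eta := 110 * (16 * `|t| / r) ^+ 2.
have hsum : (s_perimeter s A (eball r) + s_perimeter s A' (eball r) <=
   (2 + eta)%:E * s_perimeter s E (eball r))%E.
  apply: (perimeter_variation s0 s1 r0 v1 tr mE phiL phi0 ha hT' mA mA').
  - by move=> x; rewrite /A /= KT.
  - by move=> x; rewrite /A' /= KT'.
  - exact: can_inj KT.
  - exact: can_inj KT'.
have hA' := Eopt _ mA' AO'.
have P0 : (0 <= s_perimeter s E (eball r))%E by rewrite s_perimeterE//; exact: Kint_ge0.
have eta0 : 0 <= eta by rewrite mulr_ge0// sqr_ge0.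
(* By minimality the perimeter of [A'] is at least that of [E], and is subtracted from the sum. *)
have hA : (s_perimeter s A (eball r) <= (1 + eta)%:E * s_perimeter s E (eball r))%E.
  have Pfin : s_perimeter s E (eball r) \is a fin_num by rewrite ge0_fin_numE.
  have := le_trans (leeD (lexx (s_perimeter s A (eball r))) hA') hsum.
  move: Pfin => /fineK <-; set p := fine _; clearbody p.
  case: (s_perimeter s A _) => [k| |].
  - by rewrite -!EFinM -!EFinD !lee_fin; clear => h; lra.
  - by rewrite addye// -!EFinM leye_eq.
  - by move=> _; rewrite leNye.
have hK := minimizer_exchange mB Emin mA AO hA.
have mX : measurable (eball 10 `&` gain E v t).
  by apply: measurableI; [exact: measurable_eball|exact: measurable_gain].
have mY : measurable (eball 10 `&` gain (~` E) v t).
  apply: measurableI; first exact: measurable_eball.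
  by apply: measurable_gain; exact: measurableC.
have mAE : measurable ((E `\` A) `*` (A `\` E)).
  by apply: measurableX; exact: measurableD.
(* Since |x - t v| < 20 <= r/4, the cutoff is 1 at x - t v, and the deformation carries that point
   to x. *)
have TE x : eball 10 x -> T x = pshift v (- t) x.
  rewrite /eball /= => x10.
  have nv : enorm v = 1 by rewrite /enorm v1 sqrtr1.
  have ht : enorm (pshift v (- t) x) <= r / 4.
    have := enorm_triangle x (- t * v.1, - t * v.2).
    rewrite enorm_scale nv normrN ger0_norm// mulr1.
    have -> : pmove (- t * v.1, - t * v.2) x = pshift v (- t) x.
      by rewrite /pmove /pshift /=; congr (_, _); ring.
    by move: x10 t10 r1280; clear; lra.
  have := KT (pshift v (- t) x); rewrite (phi1 _ ht) mulr1 => <-.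
  by rewrite pshiftK.
apply: (@le_trans _ _ (eta%:E * s_perimeter s E (eball r))%E); last first.
  have -> : 110 * 16 ^+ 2 * t ^+ 2 / r ^+ 2 = eta.
    by rewrite /eta (ger0_norm t0); field; rewrite gt_eqF.
  apply: lee_wpmul2l; first by rewrite lee_fin.
  exact: minimizer_energy.
apply: le_trans hK.
apply: (@le_trans _ _ (Kint s ((eball 10 `&` gain E v t) `*` (eball 10 `&` gain (~` E) v t)))).
  apply: Kint_ge; [exact: mX|exact: mY|by move=> x []|by move=> x []|].
  apply/disj_set2P; apply/seteqP; split => // x [[_ [Ex _]] [_ [nEx _]]].
  exact: nEx.
apply: le_Kint; [by apply: measurableX; [exact: mX|exact: mY]|exact: mAE|].
move=> [x y] [/= [x10 [Ex nEx]] [y10 [nEy nnEy]]]; split; split => //.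
  by rewrite /A /= TE.
by rewrite /A /= TE//; exact: contrapT.
Qed.

(** With u = r^(-s), the product of the areas is at most M (t u)^2, so both cannot exceed C u t once
    C^2 > M; C = M + 1 is such a choice. *)
Lemma minimizer_flux : exists C : R, 0 < C /\ forall r t v E, 128 * 10 <= r -> 0 <= t <= 10 ->
  dotp v v = 1 -> s_minimizer s (eball r) E ->
  (area (eball 10 `&` gain E v t) <= (C / r `^ s * t)%:E)%E \/
  (area (eball 10 `&` gain (~` E) v t) <= (C / r `^ s * t)%:E)%E.
Proof.
have sqr_gt (m : R) : 0 <= m -> m < (m + 1) ^+ 2 by move=> m0; nra.
have c0fin : interaction s (@eball R 1) (~` (eball 1)) \is a fin_num.
  rewrite ge0_fin_numE; first exact: interaction_ball_lty.
  by apply: integral_ge0 => z _; rewrite lee_fin skernel_ge0.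
pose c0 := fine (interaction s (@eball R 1) (~` (eball 1))).
have c00 : 0 <= c0.
  by apply: fine_ge0; apply: integral_ge0 => z _; rewrite lee_fin skernel_ge0.
pose M := 20 ^+ 3 * (110 * 16 ^+ 2) * c0.
have M0 : 0 <= M by rewrite /M !mulr_ge0// ?exprn_ge0.
pose C := M + 1.
have CM : M < C ^+ 2 by exact: sqr_gt.
have C0 : 0 < C by rewrite /C; lra.
exists C; split => // r t v E r1280 tb v1 Emin.
have r0 : 0 < r by lra.
have [mE _ _] := Emin; have /andP[t0 t10] := tb.
have := minimizer_product r1280 tb v1 Emin.
rewrite -(fineK c0fin) -/c0.
have afin (S : set (plane R)) : area (eball 10 `&` S) \is a fin_num.
  rewrite ge0_fin_numE; last exact: mu_ext_ge0.
  apply: (le_lt_trans (le_area (@subIsetl _ _ _))).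
  by apply: (le_lt_trans (area_eball_le _)) => //; exact: ltry.
rewrite -(fineK (afin (gain E v t))) -(fineK (afin (gain (~` E) v t))).
set a := fine _; set b := fine _.
have a0 : 0 <= a by apply: fine_ge0; exact: mu_ext_ge0.
have b0 : 0 <= b by apply: fine_ge0; exact: mu_ext_ge0.
rewrite -!EFinM !lee_fin => h.
pose u := (r `^ s)^-1.
have u0 : 0 < u by rewrite invr_gt0 powR_gt0.
have ru : r `^ (2 - 2 * s) / r ^+ 2 = u ^+ 2.
  rewrite /u exprVn -(powR_mulrn 2 (powR_ge0 r s)) -powRrM -(powR_mulrn 2 (ltW r0)).
  rewrite -!powRN -powRD ?(gt_eqF r0) ?implybT//; congr (_ `^ _); ring.
have hab : a * b <= M * (t * u) ^+ 2.
  have -> : M * (t * u) ^+ 2 = 20 ^+ 3 * (110 * 16 ^+ 2 * t ^+ 2 / r ^+ 2 * (r `^ (2 - 2 * s) * c0)).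
    rewrite exprMn -ru /M; ring.
  rewrite -ler_pdivrMl ?exprn_gt0//.
have [t00|tn0] := eqVneq t 0.
  left; suff -> : a = 0 by rewrite t00 mulr0.
  rewrite /a; suff -> : eball 10 `&` gain E v t = set0 by rewrite (measure0 area).
  apply/seteqP; split => // x [_ [Ex]]; apply.
  by rewrite t00 oppr0 /pshift !mul0r !addr0 -surjective_pairing.
have {}t0 : 0 < t by rewrite lt0r tn0.
have tu : 0 < t * u by rewrite mulr_gt0.
have [ha|ha] := leP a (C * u * t); first by left.
have [hb|hb] := leP b (C * u * t); first by right.
exfalso; have q0 : 0 < C * u * t by rewrite !mulr_gt0.
have : (C * u * t) * (C * u * t) <= a * b by apply: ler_pM; rewrite ?(ltW q0)// ltW.
move=> /le_trans/(_ hab).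
have -> : C * u * t * (C * u * t) = C ^+ 2 * (t * u) ^+ 2 by ring.
by rewrite ler_pM2r ?exprn_gt0// leNgt CM.
Qed.

End flux.

(** * Geometry of sets with small flux *)

Section rises.
Context {R : realType}.
Implicit Types (E X : set (plane R)) (v w x : plane R) (d r t : R).

Definition pscale t w : plane R := (t * w.1, t * w.2).

(** This is the part of [E] outside E + w. For the complement it is the part of E + w outside [E],
    so [changes] is the symmetric difference of [E] and E + w. *)
Definition rise E w : set (plane R) := [set x | E x /\ ~ E (pdiff x w)].

Definition changes E w : set (plane R) := rise E w `|` rise (~` E) w.

(** Which alternative holds may depend on [w]; the search for a still direction exploits the switch
    between them. *)
Definition flux_bound E d : Prop := forall w, enorm w <= 10 ->
  (area (eball 10 `&` rise E w) <= (d * enorm w)%:E)%E \/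
  (area (eball 10 `&` rise (~` E) w) <= (d * enorm w)%:E)%E.

Lemma area_setU_le (A B : set (plane R)) : (area (A `|` B) <= area A + area B)%E.
Proof. exact: (outer_measureU2 (borel_area R)^*%mu). Qed.

Lemma area_cover_le (A B C : set (plane R)) : A `<=` B `|` C ->
  (area A <= area B + area C)%E.
Proof. by move=> /le_area/le_trans; apply; exact: area_setU_le. Qed.

Lemma flux_boundC E d : flux_bound E d -> flux_bound (~` E) d.
Proof. by move=> h w /h; rewrite setCK => -[]; [right|left]. Qed.

Lemma changesC E w : changes (~` E) w = changes E w.
Proof. by rewrite /changes setCK setUC. Qed.

Lemma enorm_eq0 w : enorm w = 0 -> w = (0, 0).
Proof.
move=> w0; have := enorm_fst w; have := enorm_snd w.
by rewrite w0 !normr_le0 => /eqP h2 /eqP h1; rewrite [LHS]surjective_pairing h1 h2.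
Qed.

Lemma pdiff0 x : pdiff x (0, 0) = x.
Proof. by rewrite [RHS]surjective_pairing /pdiff /= !subr0. Qed.

Lemma pdiffA x v w : pdiff (pdiff x v) w = pdiff x (pmove w v).
Proof. by rewrite /pdiff /pmove /=; congr (_, _); ring. Qed.

Lemma enorm_pscale t w : enorm (pscale t w) = `|t| * enorm w.
Proof. exact: enorm_scale. Qed.

Lemma enorm_pdiff x w : enorm (pdiff x w) <= enorm x + enorm w.
Proof.
have := enorm_triangle x (pscale (-1) w); rewrite enorm_pscale normrN1 mul1r.
suff -> : pmove (pscale (-1) w) x = pdiff x w by [].
by rewrite /pmove /pdiff /pscale /=; congr (_, _); ring.
Qed.

Lemma mpres_pdiff w : mpres (fun x => pdiff x w).
Proof. exact: (mpres_pmove (- w.1, - w.2)). Qed.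

Lemma measurable_preimage_pdiff X w : measurable X ->
  measurable ((fun x => pdiff x w) @^-1` X).
Proof.
move=> mX; have [mT _ _ _] := mpres_pdiff w.
by rewrite -[Y in measurable Y]setTI; exact: mT.
Qed.

Lemma measurable_rise E w : measurable E -> measurable (rise E w).
Proof.
move=> mE.
exact: (measurableI _ _ mE (measurableC (measurable_preimage_pdiff w mE))).
Qed.

Lemma measurable_changes E w : measurable E -> measurable (changes E w).
Proof.
move=> mE; apply: measurableU; apply: measurable_rise; first exact: mE.
exact: measurableC.
Qed.

Lemma area_shift_le X w r r' : measurable X -> r + enorm w <= r' ->
  (area (eball r `&` (fun x => pdiff x w) @^-1` X) <= area (eball r' `&` X))%E.
Proof.
move=> mX h; have mB : measurable (eball r' `&` X).
  by apply: measurableI; [exact: measurable_eball|exact: mX].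
rewrite -(mpres_area (mpres_pdiff w) mB); apply: le_area => x [xr Xx]; split => //.
apply: lt_le_trans h; apply: le_lt_trans (enorm_pdiff x w) _.
by rewrite ltrD2r.
Qed.

Lemma rise0 E : rise E (0, 0) = set0.
Proof. by apply/seteqP; split => // x [Ex]; rewrite pdiff0. Qed.

Lemma flux_bound_directional E d :
  (forall v t, dotp v v = 1 -> 0 <= t <= 10 ->
    (area (eball 10 `&` gain E v t) <= (d * t)%:E)%E \/
    (area (eball 10 `&` gain (~` E) v t) <= (d * t)%:E)%E) ->
  flux_bound E d.
Proof.
move=> h w w10; have [w0|w0] := eqVneq (enorm w) 0.
  left; rewrite w0 mulr0 (enorm_eq0 w0) rise0 setI0 (measure0 area) //.
have wpos : 0 < enorm w by rewrite lt0r w0 enorm_ge0.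
have v1 : dotp (pscale (enorm w)^-1 w) (pscale (enorm w)^-1 w) = 1.
  rewrite -sqr_enorm enorm_pscale ger0_norm ?invr_ge0 ?enorm_ge0// mulVf// expr1n//.
have gainE F : gain F (pscale (enorm w)^-1 w) (enorm w) = rise F w.
  rewrite /gain /rise; suff sE x : pshift (pscale (enorm w)^-1 w) (- enorm w) x = pdiff x w.
    by apply/seteqP; split => x /=; rewrite sE.
  by rewrite /pshift /pdiff /pscale /=; congr (_, _); field.
by have := h _ (enorm w) v1; rewrite !gainE enorm_ge0 w10 => /(_ isT).
Qed.

Lemma area_eball_diff w : enorm w <= 1 ->
  (area (eball 10 `\` eball (10 - enorm w)) <= (80 * enorm w)%:E)%E.
Proof.
move=> w1; have w0 := enorm_ge0 w.
have sub : @eball R (10 - enorm w) `<=` eball 10.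
  by move=> x; rewrite /eball /=; lra.
have -> : area (eball 10 `\` eball (10 - enorm w)) =
    (area (@eball R 10) - area (@eball R (10 - enorm w)))%E.
  have := @measureD _ _ _ area (eball 10) (eball (10 - enorm w)).
  rewrite (setIidr sub); apply; try exact: measurable_eball.
  by rewrite -ge0_fin_numE; [exact: area_eball_fin|exact: mu_ext_ge0].
rewrite (@area_eball_scale R 10)//.
have a1 : @area R (eball 1) \is a fin_num by exact: area_eball_fin.
have := @area_eball_le R 1 ler01; rewrite expr1n mulr1.
rewrite (@area_eball_scale R (10 - _)); last by lra.
rewrite -(fineK a1); set k := fine _; rewrite lee_fin => k4.
have k0 : 0 <= k by apply: fine_ge0; exact: mu_ext_ge0.
rewrite -!EFinM -EFinB lee_fin; clearbody k; move: w0 w1; set q := enorm w.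
clearbody q; clear -k4 k0 => q0 q1.
have : k * q <= 4 * q by rewrite ler_wpM2r.
have : 0 <= k * q ^+ 2 by rewrite mulr_ge0// sqr_ge0.
by rewrite !expr2 => h1 h2; lra.
Qed.

Lemma area_ball_fin r X : 0 <= r -> area (eball r `&` X) \is a fin_num.
Proof.
move=> r0; rewrite ge0_fin_numE; last exact: mu_ext_ge0.
apply: (le_lt_trans (le_area (@subIsetl _ _ _))).
by apply: (le_lt_trans (area_eball_le _)) => //; exact: ltry.
Qed.

(* The area of [E] in the ball and in the shifted ball differ by [O(|w|)], hence
   so do the areas of the rises of [E] and of its complement, and the smaller
   of them is controlled by the flux bound. *)
Lemma rise_bv E d w : measurable E -> d <= 1 -> flux_bound E d -> enorm w <= 1 ->
  (area (eball 10 `&` rise E w) <= (81 * enorm w)%:E)%E.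
Proof.
move=> mE d1 hE w1; have w0 := enorm_ge0 w.
have mB : measurable (@eball R 10) by exact: measurable_eball.
have mP := measurable_preimage_pdiff w mE.
have mEc := measurableC mE; have mPc := measurableC mP.
have w10 : enorm w <= 10 by lra.
have dw : d * enorm w <= enorm w by rewrite ler_piMl.
case: (hE w w10) => h.
  by apply: (le_trans h); rewrite lee_fin; lra.
pose I := area (eball 10 `&` (E `&` (fun x => pdiff x w) @^-1` E)).
have eP : area (eball 10 `&` E) = (area (eball 10 `&` rise E w) + I)%E.
  have -> : eball 10 `&` E = (eball 10 `&` rise E w) `|`
     (eball 10 `&` (E `&` (fun x => pdiff x w) @^-1` E)).
    apply/seteqP; split=> x.
      by move=> [xB Ex]; have [|] := pselect (E (pdiff x w)); [right|left].
    by move=> [[xB []]|[xB []]].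
  apply: (measureU area).
  - by apply: measurableI; [exact: mB|exact: measurable_rise].
  - by apply: measurableI; [exact: mB|apply: measurableI; [exact: mE|exact: mP]].
  - by apply/seteqP; split => // x [[_ [_ nE]] [_ []]].
have eQ : area (eball 10 `&` (fun x => pdiff x w) @^-1` E) =
    (area (eball 10 `&` rise (~` E) w) + I)%E.
  have -> : eball 10 `&` (fun x => pdiff x w) @^-1` E =
      (eball 10 `&` rise (~` E) w) `|`
      (eball 10 `&` (E `&` (fun x => pdiff x w) @^-1` E)).
    apply/seteqP; split=> x.
      by move=> [xB Ex]; have [|] := pselect (E x); [right|left; split => //; split].
    by move=> [[xB [_ /contrapT]]|[xB []]].
  apply: (measureU area).
  - by apply: measurableI; [exact: mB|exact: measurable_rise].
  - by apply: measurableI; [exact: mB|apply: measurableI; [exact: mE|exact: mP]].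
  - by apply/seteqP; split => // x [[_ [nE _]] [_ []]].
have PQ : (area (eball 10 `&` E) <=
    area (eball 10 `&` (fun x => pdiff x w) @^-1` E) + (80 * enorm w)%:E)%E.
  apply: (@le_trans _ _ (area (eball (10 - enorm w) `&` E) +
      area (eball 10 `\` eball (10 - enorm w)))%E).
    apply: area_cover_le => x [xB Ex].
    by have [|] := pselect (eball (10 - enorm w) x); [left|right].
  apply: leeD; last exact: area_eball_diff.
  have mB' : measurable (eball (10 - enorm w) `&` E).
    by apply: measurableI; [exact: measurable_eball|exact: mE].
  rewrite -(mpres_area (mpres_pdiff w) mB'); apply: le_area => x [xB Ex]; split => //.
  have := enorm_triangle (pdiff x w) w.
  have -> : pmove w (pdiff x w) = x.
    by rewrite [RHS]surjective_pairing /pmove /pdiff /= !subrK.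
  by move: xB; rewrite /eball /=; lra.
have fI : I \is a fin_num by exact: area_ball_fin.
have fA : area (eball 10 `&` rise E w) \is a fin_num by exact: area_ball_fin.
have fB : area (eball 10 `&` rise (~` E) w) \is a fin_num by exact: area_ball_fin.
move: PQ h; rewrite eP eQ -(fineK fI) -(fineK fA) -(fineK fB) -!EFinD !lee_fin.
by move: dw; clear => *; lra.
Qed.

Lemma changes_bv E d w : measurable E -> d <= 1 -> flux_bound E d -> enorm w <= 1 ->
  (area (eball 10 `&` changes E w) <= (162 * enorm w)%:E)%E.
Proof.
move=> mE d1 hE w1; rewrite setIUr; apply: (le_trans (area_setU_le _ _)).
have -> : 162 * enorm w = 81 * enorm w + 81 * enorm w by ring.
rewrite EFinD; apply: leeD; first exact: (rise_bv mE d1 hE w1).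
exact: (rise_bv (measurableC mE) d1 (flux_boundC hE) w1).
Qed.

(** A point of [E] outside E + w is either outside E + w' or in E + w' but not in E + w. The latter
    set is a translate of a rise for w - w', to which [rise_bv] applies. *)
Lemma rise_lipschitz E d w w' : measurable E -> d <= 1 -> flux_bound E d ->
  enorm w' <= 1 -> enorm (pdiff w w') <= 1 ->
  (area (eball 9 `&` rise E w) <=
   area (eball 10 `&` rise E w') + (81 * enorm (pdiff w w'))%:E)%E.
Proof.
move=> mE d1 hE w'1 ww'.
apply: (@le_trans _ _ (area (eball 10 `&` rise E w') +
   area (eball 9 `&` (fun x => pdiff x w') @^-1` (rise E (pdiff w w'))))%E).
  apply: area_cover_le => x [x9 [Ex nEx]].
  have [Ew|nEw] := pselect (E (pdiff x w')).
    right; split => //; split => //; rewrite pdiffA.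
    suff -> : pmove (pdiff w w') w' = w by [].
    by rewrite [RHS]surjective_pairing /pmove /pdiff /=; congr (_, _); ring.
  by left; split => //; move: x9; rewrite /eball /=; lra.
apply: leeD => //; apply: le_trans (rise_bv mE d1 hE ww').
by apply: area_shift_le; [exact: measurable_rise|lra].
Qed.

(** Translation by [w] carries the part of [E] outside E - w onto the part of E + w outside [E]. *)
Lemma rise_opp E w r r' : measurable E -> r + enorm w <= r' ->
  (area (eball r `&` rise E (pscale (-1) w)) <= area (eball r' `&` rise (~` E) w))%E.
Proof.
move=> mE h.
have h' : r + enorm (pscale (-1) w) <= r' by rewrite enorm_pscale normrN1 mul1r.
have mX := measurable_rise w (measurableC mE).
apply: le_trans (area_shift_le mX h'); apply: le_area => x [xB [Ex nEx]].
split => //; split => // nEx'; apply: nEx'.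
suff -> : pdiff (pdiff x (pscale (-1) w)) w = x by [].
by rewrite [RHS]surjective_pairing /pdiff /pscale /=; congr (_, _); ring.
Qed.

Lemma changes_opp E w r r' : measurable E -> r + enorm w <= r' ->
  (area (eball r `&` changes E (pscale (-1) w)) <= area (eball r' `&` changes E w))%E.
Proof.
move=> mE h.
have h' : r + enorm (pscale (-1) w) <= r' by rewrite enorm_pscale normrN1 mul1r.
have mX := measurable_changes w mE.
have xE x : pdiff (pdiff x (pscale (-1) w)) w = x.
  by rewrite [RHS]surjective_pairing /pdiff /pscale /=; congr (_, _); ring.
apply: le_trans (area_shift_le mX h'); apply: le_area => x [xB [[Ex nEx]|[Ex nEx]]].
  by split => //; right; split => //=; rewrite xE => nEx'; exact: nEx'.
by split => //; left; split => //=; [exact: contrapT|rewrite xE].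
Qed.

(** The triangle inequality for symmetric differences, through the intermediate translate E + v. *)
Lemma changes_add E v w r r' : measurable E -> r + enorm v <= r' ->
  (area (eball r `&` changes E (pmove w v)) <=
   area (eball r `&` changes E v) + area (eball r' `&` changes E w))%E.
Proof.
move=> mE h; apply: (@le_trans _ _ (area (eball r `&` changes E v) +
   area (eball r `&` (fun x => pdiff x v) @^-1` (changes E w)))%E); last first.
  by apply: leeD => //; apply: area_shift_le => //; exact: measurable_changes.
apply: area_cover_le => x [xB]; rewrite /changes /rise /= -pdiffA => hx.
have [Ex|Ex] := pselect (E x); have [Ev|Ev] := pselect (E (pdiff x v)).
- case: hx => -[nE nEw]; last exact: (False_ind _ (nE Ex)).
  by right; split => //; left.
- by left; split => //; left.
- by left; split => //; right; split => //; apply.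
- case: hx => -[nE nEw]; first exact: (False_ind _ (Ex nE)).
  by right; split => //; right.
Qed.

End rises.

(** * The still direction and the adapted frame *)

Section direction.
Context {R : realType}.
Implicit Types (E X : set (plane R)) (v w x : plane R) (d r t : R).

(* For [t] in [-1, 1] this is the upper half of the l1 unit circle, a path of
   Lipschitz constant 2 joining [(1, 0)] to its opposite. *)
Definition diamond t : plane R := (t, 1 - `|t|).

Lemma diamond_ge t : 1 / 2 <= enorm (diamond t).
Proof.
have := enorm_fst (diamond t); have := enorm_snd (diamond t); rewrite /diamond /=.
have := ler_norm (1 - `|t|); set p := enorm _; clearbody p.
by move: (`|t|) => q h1 h2 h3; lra.
Qed.

Lemma diamond_le t : `|t| <= 1 -> enorm (diamond t) <= 1.
Proof.
move=> t1; have := enorm_le_add (diamond t); rewrite /diamond /=.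
by rewrite (@ger0_norm _ (1 - `|t|)) ?subr_ge0//; set p := enorm _; clearbody p; lra.
Qed.

Lemma diamond_lipschitz t t' :
  enorm (pdiff (diamond t) (diamond t')) <= 2 * `|t - t'|.
Proof.
apply: (le_trans (enorm_le_add _)); rewrite /pdiff /diamond /=.
have -> : 1 - `|t| - (1 - `|t'|) = `|t'| - `|t| by ring.
have := ler_dist_dist t' t; rewrite (distrC t' t); lra.
Qed.

Lemma pdiff_pscale t x y : pdiff (pscale t x) (pscale t y) = pscale t (pdiff x y).
Proof. by rewrite /pdiff /pscale /=; congr (_, _); ring. Qed.

(* Along the path from [w] to [-w] the roles of the rises of [E] and of [~` E]
   are exchanged, so somewhere in between both are small. *)
Lemma still_direction_aux E d : measurable E -> 0 < d <= 1 -> flux_bound E d ->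
  (area (eball 10 `&` rise E (pscale d (diamond 1))) <=
    (d * enorm (pscale d (diamond 1)))%:E)%E ->
  exists w, [/\ d / 2 <= enorm w, enorm w <= d &
    (area (eball 9 `&` changes E w) <= (6 * d * enorm w)%:E)%E].
Proof.
move=> mE /andP[d0 d1] hE h0.
(* The parameter advances by 2/N along a 2-Lipschitz path scaled by d; this N makes 81 times each
   displacement at most d^2. *)
pose N := (Num.truncn (4 * 81 / d)).+1.
have NR : 4 * 81 / d < N%:R by exact: truncnS_gt.
have N0 : 0 < N%:R :> R by rewrite ltr0n.
pose sg i : R := 1 - 2 * (i%:R / N%:R).
pose c i := pscale d (diamond (sg i)).
have sg1 i : (i <= N)%N -> `|sg i| <= 1.
  move=> iN; have : 0 <= (i%:R / N%:R : R) <= 1.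
    by rewrite divr_ge0//= ler_pdivrMr// mul1r ler_nat.
  by rewrite ler_norml /sg; lra.
have cn i : (i <= N)%N -> d / 2 <= enorm (c i) <= d.
  move=> iN; rewrite enorm_pscale gtr0_norm// ler_wpM2l ?(ltW d0)//=; last first.
    by have := diamond_ge (sg i); lra.
  by rewrite ler_piMr ?(ltW d0)// diamond_le// sg1.
have step i : 81 * enorm (pdiff (c i.+1) (c i)) <= d ^+ 2.
  rewrite pdiff_pscale enorm_pscale gtr0_norm//.
  have hd := diamond_lipschitz (sg i.+1) (sg i).
  have e : `|sg i.+1 - sg i| = 2 / N%:R.
    have -> : sg i.+1 - sg i = - (2 / N%:R) by rewrite /sg -natr1; field; rewrite gt_eqF.
    by rewrite normrN ger0_norm// divr_ge0.
  rewrite e in hd.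
  have hN : 4 * 81 / N%:R <= d by rewrite ler_pdivrMr// [d * _]mulrC -ler_pdivrMr// ltW.
  have : 81 * enorm (pdiff (diamond (sg i.+1)) (diamond (sg i))) <= d.
    by move: hN hd; rewrite !mulrA; set p := enorm _; clearbody p; clear => *; lra.
  by rewrite mulrCA expr2 ler_pM2l.
(* The last vector is opposite to the first, for which the rise of [E] is small by hypothesis; hence
   the index [N] qualifies and a least one exists. *)
have ex : exists i, (i <= N)%N && `[< area (eball 9 `&` rise (~` E) (c i)) <= (d ^+ 2)%:E >]%E.
  exists N; rewrite leqnn /=; apply/asboolP.
  have -> : c N = pscale (-1) (c 0%N).
    rewrite /c /sg mul0r mulr0 subr0 divff ?gt_eqF//.
    have -> : 1 - 2 * 1 = -1 :> R by ring.
    by rewrite /diamond /pscale /= normrN normr1; congr (_, _); ring.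
  have /andP[_ c0d] := cn 0%N isT.
  apply: (@le_trans _ _ (area (eball 10 `&` rise (~` (~` E)) (c 0%N)))).
    by apply: rise_opp; [exact: measurableC|lra].
  have ec : c 0%N = pscale d (diamond 1) by rewrite /c /sg mul0r mulr0 subr0.
  rewrite setCK; move: c0d; rewrite ec => c0d; apply: (le_trans h0).
  by rewrite lee_fin expr2 ler_pM2l.
have [i /andP[iN /asboolP iP] imin] := find_ex_minn ex.
have /andP[ci1 ci2] := cn i iN.
exists (c i); split => //.
suff hQ : (area (eball 9 `&` rise E (c i)) <= (2 * d ^+ 2)%:E)%E.
  rewrite setIUr; apply: (le_trans (area_setU_le _ _)); apply: (le_trans (leeD hQ iP)).
  rewrite -EFinD lee_fin; have := ler_wpM2l (ltW d0) ci1; rewrite expr2.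
  by clear => h; lra.
(* At index 0 the hypothesis bounds the rise of [E]. Otherwise, just before the least index the rise
   of the complement is too large, so the flux bound controls that of [E], and one step adds at most
   d^2. The total 3 d^2 is at most 6 d |w| as |w| >= d/2. *)
case: i => [|i] in iN iP imin ci1 ci2 *.
  have ec : c 0%N = pscale d (diamond 1) by rewrite /c /sg mul0r mulr0 subr0.
  rewrite ec in ci2 *.
  apply: (@le_trans _ _ (area (eball 10 `&` rise E (pscale d (diamond 1))))).
    by apply: le_area => x [x9 ?]; split => //; move: x9; rewrite /eball /=; lra.
  apply: (le_trans h0); rewrite lee_fin.
  have := ler_wpM2l (ltW d0) ci2; rewrite expr2; have := mulr_ge0 (ltW d0) (ltW d0).
  by clear => *; lra.
have iN' : (i <= N)%N by exact: ltnW.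
have /andP[di1 di2] := cn i iN'.
have st := step i.
have dd : d ^+ 2 <= 1 by rewrite expr_le1// ltW.
have lip : (area (eball 9 `&` rise E (c i.+1)) <=
   area (eball 10 `&` rise E (c i)) + (81 * enorm (pdiff (c i.+1) (c i)))%:E)%E.
  apply: (rise_lipschitz mE d1 hE).
    exact: le_trans di2 d1.
  by move: st dd (enorm_ge0 (pdiff (c i.+1) (c i))); clear => *; lra.
apply: (le_trans lip).
have dc : d * enorm (c i) <= d ^+ 2 by rewrite expr2 ler_pM2l.
have -> : 2 * d ^+ 2 = d ^+ 2 + d ^+ 2 by ring.
rewrite EFinD; apply: leeD; last by rewrite lee_fin.
have c10 : enorm (c i) <= 10 by move: di2 d1; clear => *; lra.
case: (hE (c i) c10) => h; first by apply: (le_trans h); rewrite lee_fin.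
suff : (i.+1 <= i)%N by rewrite ltnn.
apply: imin; rewrite iN' /=; apply/asboolP.
apply: (@le_trans _ _ (area (eball 10 `&` rise (~` E) (c i)))).
  by apply: le_area => x [x9 ?]; split => //; move: x9; rewrite /eball /=; lra.
by apply: (le_trans h); rewrite lee_fin.
Qed.

Lemma still_direction E d : measurable E -> 0 < d <= 1 -> flux_bound E d ->
  exists w, [/\ d / 2 <= enorm w, enorm w <= d &
    (area (eball 9 `&` changes E w) <= (6 * d * enorm w)%:E)%E].
Proof.
move=> mE d01 hE; have /andP[d0 d1] := d01.
have n1 : enorm (diamond 1) <= 1 by apply: diamond_le; rewrite normr1.
have n10 : enorm (pscale d (diamond 1)) <= 10.
  rewrite enorm_pscale gtr0_norm//; have := ler_wpM2l (ltW d0) n1; rewrite mulr1.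
  by move: d1; clear => *; lra.
case: (hE _ n10) => h; first exact: still_direction_aux.
have [w [w1 w2]] := still_direction_aux (measurableC mE) d01 (flux_boundC hE) h.
by rewrite changesC => h'; exists w; split.
Qed.

(** The flux bound applied to j w would control only one of its two rises; adding j small steps
    controls both, still with the factor d. The total length 3 is the gap between the radii 6 and
    9. *)
Lemma changes_multiple E w d (j : nat) : measurable E -> 0 <= d ->
  (area (eball 9 `&` changes E w) <= (6 * d * enorm w)%:E)%E ->
  j%:R * enorm w <= 3 ->
  (area (eball 6 `&` changes E (pscale j%:R w)) <= (6 * d * (j%:R * enorm w))%:E)%E.
Proof.
move=> mE d0 hw; elim: j => [|j IH] hj.
  have -> : pscale 0%:R w = (0, 0) by rewrite /pscale !mul0r.
  rewrite /changes !rise0 setU0 setI0 (measure0 area) mul0r mulr0 //.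
have w0 := enorm_ge0 w; move: hj; rewrite -natr1 mulrDl mul1r => hj.
have hj' : j%:R * enorm w <= 3 by lra.
have -> : pscale (j%:R + 1) w = pmove w (pscale j%:R w).
  by rewrite /pscale /pmove /=; congr (_, _); ring.
apply: (@le_trans _ _ (area (eball 6 `&` changes E (pscale j%:R w)) +
   area (eball 9 `&` changes E w))%E).
  apply: changes_add => //; rewrite enorm_pscale ger0_norm//; lra.
rewrite mulrDr EFinD; exact: leeD (IH hj') hw.
Qed.

(** The integer part of [t] costs 6 d * 3 = 18 d; the remaining vector has length at most [d] and
    costs 162 d by [changes_bv]. *)
Lemma changes_along E w d t : measurable E -> 0 < d <= 1 -> flux_bound E d ->
  0 < enorm w <= d ->
  (area (eball 9 `&` changes E w) <= (6 * d * enorm w)%:E)%E ->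
  0 <= t -> t * enorm w <= 3 ->
  (area (eball 6 `&` changes E (pscale t w)) <= (180 * d)%:E)%E.
Proof.
move=> mE /andP[d0 d1] hE /andP[w0 wd] hw t0 tw.
have /andP[jt tj] := truncn_itv t0; set j := Num.truncn t in jt tj.
have -> : pscale t w = pmove (pscale (t - j%:R) w) (pscale j%:R w).
  by rewrite /pscale /pmove /=; congr (_, _); ring.
have jw : j%:R * enorm w <= 3.
  by apply: le_trans tw; rewrite ler_wpM2r// ltW.
have rn : enorm (pscale (t - j%:R) w) <= d.
  rewrite enorm_pscale ger0_norm ?subr_ge0//; apply: le_trans wd.
  by rewrite ler_piMl ?(ltW w0)//; move: tj; rewrite -natr1; lra.
apply: (@le_trans _ _ (area (eball 6 `&` changes E (pscale j%:R w)) +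
   area (eball 10 `&` changes E (pscale (t - j%:R) w)))%E).
  by apply: changes_add => //; rewrite enorm_pscale ger0_norm//; lra.
have -> : 180 * d = 6 * d * 3 + 162 * d by ring.
rewrite EFinD; apply: leeD.
  apply: (le_trans (changes_multiple mE (ltW d0) hw jw)).
  by rewrite lee_fin ler_pM2l// mulr_gt0.
apply: (le_trans (changes_bv mE d1 hE (le_trans rn d1))).
by rewrite lee_fin ler_pM2l.
Qed.

(** The vector [v] is the normalized still direction, and the sign of [e] is chosen so that moving
    along [e] rarely enters [E]. A displacement in the frame costs 162 d for its short component and
    180 d along [v], hence 342 d. *)
Lemma good_frame E d : measurable E -> 0 < d <= 1 -> flux_bound E d ->
  exists e v, [/\ dotp e e = 1, dotp v v = 1, dotp e v = 0 &
    forall x, pmove (pscale (dotp x e) e) (pscale (dotp x v) v) = x] /\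
    ((area (eball 9 `&` rise E (pscale d e)) <= (d * d)%:E)%E /\
    forall a b, `|a| <= d -> `|b| <= 2 ->
      (area (eball 3 `&` changes E (pmove (pscale a e) (pscale b v))) <=
        (342 * d)%:E)%E).
Proof.
move=> mE d01 hE; have /andP[d0 d1] := d01.
have [w [w1 w2 hw]] := still_direction mE d01 hE.
have w0 : 0 < enorm w by move: w1 d0; clear => *; lra.
pose v := pscale (enorm w)^-1 w; pose e : plane R := (- v.2, v.1).
have vv : dotp v v = 1.
  by rewrite -sqr_enorm enorm_pscale gtr0_norm ?invr_gt0// mulVf ?gt_eqF// expr1n.
have ee : dotp e e = 1 by rewrite -vv /dotp /e /=; ring.
have basis (u : plane R) x : u = e \/ u = pscale (-1) e ->
    pmove (pscale (dotp x u) u) (pscale (dotp x v) v) = x.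
  have vv' : v.1 * v.1 + v.2 * v.2 = 1 by exact: vv.
  move=> ue; rewrite [RHS]surjective_pairing.
  rewrite -[x.1 in RHS]mulr1 -[x.2 in RHS]mulr1 -vv'.
  by case: ue => ->; rewrite /e /pmove /pscale /dotp /=; congr (_, _); ring.
have vdir b : 0 <= b <= 2 ->
    (area (eball 6 `&` changes E (pscale b v)) <= (180 * d)%:E)%E.
  move=> /andP[b0 b2].
  have -> : pscale b v = pscale (b / enorm w) w.
    by rewrite /v /pscale /=; congr (_, _); ring.
  apply: changes_along => //; first by rewrite w0.
    by rewrite divr_ge0// ltW.
  by rewrite divfK ?gt_eqF//; lra.
have vdir' b : `|b| <= 2 ->
    (area (eball 4 `&` changes E (pscale b v)) <= (180 * d)%:E)%E.
  have [b0|b0] := leP 0 b.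
    move=> b2; apply: (@le_trans _ _ (area (eball 6 `&` changes E (pscale b v)))).
      by apply: le_area => x [x9 ?]; split => //; move: x9; rewrite /eball /=; lra.
    by apply: vdir; rewrite b0 -(ger0_norm b0).
  rewrite ltr0_norm// => b2.
  have -> : pscale b v = pscale (-1) (pscale (- b) v).
    by rewrite /pscale /=; congr (_, _); ring.
  apply: (@le_trans _ _ (area (eball 6 `&` changes E (pscale (- b) v)))).
    apply: changes_opp => //; rewrite enorm_pscale /enorm vv sqrtr1 mulr1.
    by rewrite ger0_norm ?oppr_ge0 ?(ltW b0)//; lra.
  by apply: vdir; rewrite b2 andbT oppr_ge0 ltW.
have frame (u : plane R) : dotp u u = 1 -> forall a b, `|a| <= d -> `|b| <= 2 ->
    (area (eball 3 `&` changes E (pmove (pscale a u) (pscale b v))) <=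
      (342 * d)%:E)%E.
  move=> uu a b ad b2.
  have nu : enorm (pscale a u) = `|a| by rewrite enorm_pscale /enorm uu sqrtr1 mulr1.
  have -> : pmove (pscale a u) (pscale b v) = pmove (pscale b v) (pscale a u).
    by rewrite /pmove /pscale /=; congr (_, _); ring.
  have -> : 342 * d = 162 * d + 180 * d by ring.
  rewrite EFinD.
  apply: (@le_trans _ _ (area (eball 3 `&` changes E (pscale a u)) +
     area (eball 4 `&` changes E (pscale b v)))%E).
    by apply: changes_add => //; rewrite nu; move: ad d1; clear => *; lra.
  apply: leeD; last exact: vdir'.
  apply: (@le_trans _ _ (area (eball 10 `&` changes E (pscale a u)))).
    by apply: le_area => x [x9 ?]; split => //; move: x9; rewrite /eball /=; lra.
  apply: (le_trans (changes_bv mE d1 hE _)); first by rewrite nu (le_trans ad).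
  by rewrite lee_fin nu ler_pM2l.
have de : enorm (pscale d e) = d by rewrite enorm_pscale /enorm ee sqrtr1 mulr1 gtr0_norm.
have de10 : enorm (pscale d e) <= 10 by rewrite de; lra.
case: (hE _ de10); rewrite de => h.
  exists e, v; split.
    split=> //; first by rewrite /dotp /e /=; ring.
    by move=> x; apply: basis; left.
  split; last exact: frame.
  apply: le_trans h; apply: le_area => x [x9 ?]; split => //.
  by move: x9; rewrite /eball /=; lra.
exists (pscale (-1) e), v; split.
  split=> //.
  - by rewrite -[RHS]ee /dotp /pscale /=; ring.
  - by rewrite /dotp /pscale /e /=; ring.
  - by move=> x; apply: basis; right.
split.
- have -> : pscale d (pscale (-1) e) = pscale (-1) (pscale d e).
    by rewrite /pscale /=; congr (_, _); ring.
  by apply: le_trans h; apply: rise_opp => //; rewrite de; lra.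
- by apply: frame; rewrite -[RHS]ee /dotp /pscale /=; ring.
Qed.

End direction.

(** * A Poincare inequality by averaging over translations *)

Lemma integral_sections {d1 d2 : measure_display} {T1 : measurableType d1}
    {T2 : measurableType d2} {R : realType}
    (m1 : {sigma_finite_measure set T1 -> \bar R})
    (m2 : {sigma_finite_measure set T2 -> \bar R}) (D : set (T1 * T2)) : measurable D ->
  (\int[m1]_x m2 (xsection D x) = \int[m2]_y m1 (ysection D y))%E.
Proof.
move=> mD.
have mi : measurable_fun setT (fun z => (\1_D z : R)%:E).
  by exact/measurable_EFinP/measurable_indic.
transitivity (\int[m1 \x m2]_z (\1_D z)%:E)%E.
  rewrite fubini_tonelli1//; apply: eq_integral => x _; rewrite /fubini_F.
  transitivity (\int[m2]_y (\1_(xsection D x) y)%:E)%E.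
    by rewrite integral_indic ?setIT//; exact: measurable_xsection.
  by apply: eq_integral => y _; rewrite !indicE mem_xsection.
rewrite fubini_tonelli2//; apply: eq_integral => y _; rewrite /fubini_G.
transitivity (\int[m1]_x (\1_(ysection D y) x)%:E)%E.
  by apply: eq_integral => x _; rewrite !indicE mem_ysection.
by rewrite integral_indic ?setIT//; exact: measurable_ysection.
Qed.

Lemma measurable_comp_pair {d : measure_display} {T : measurableType d} {R : realType}
    (f g : T -> R) (B : set (bplane R)) :
  measurable_fun setT f -> measurable_fun setT g -> measurable B ->
  measurable [set z | B (f z, g z)].
Proof.
move=> mf mg mB; have mp : measurable_fun setT (fun z => (f z, g z) : bplane R).
  by apply: measurable_fun_pair.
by rewrite -[X in measurable X]setTI; exact: mp.
Qed.

Section poincare.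
Context {R : realType}.
Notation pp := (plane R * plane R)%type.
Implicit Types (E X W : set (plane R)) (v w x : plane R).

Lemma borel_core X : measurable X -> exists B : set (bplane R),
  [/\ measurable B, B `<=` X & area (B : set (plane R)) = area X].
Proof.
move=> /borel_sandwich[B1 [B2 [m1 m2 B1X XB2 B0]]]; exists B1; split => //.
apply/eqP; rewrite eq_le le_area//=.
have -> : area (B1 : set (plane R)) = (area (B1 : set (plane R)) + area (B2 `\` B1))%E.
  by rewrite (area_borel (measurableD m2 m1)) B0 adde0.
by apply: area_cover_le => x Xx; have [|] := pselect (B1 x); [left|right; split => //; exact: XB2].
Qed.

Lemma mpres_reflection x : mpres (fun w => pdiff x w).
Proof.
have u : dotp ((-1, 0) : plane R) (-1, 0) = 1 by rewrite /dotp /=; ring.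
apply: mpres_eq (mpres_comp (mpres_prot u) (mpres_pmove x)) _ => w.
by rewrite /pmove /prot /pdiff /=; congr (_, _); ring.
Qed.

(** The pairs (w, x) with x in [A] and x - w in [B], written through real coordinates: these are
    measurable on the product, so Borel sets [A] and [B] yield a measurable set. *)
Definition overlap (A B : set (bplane R)) : set pp :=
  [set z | A (z.2.1, z.2.2) /\ B (z.2.1 - z.1.1, z.2.2 - z.1.2)].

Lemma measurable_overlap A B : measurable A -> measurable B -> measurable (overlap A B).
Proof.
move=> mA mB.
have m11 := @measurable_pp11 R; have m12 := @measurable_pp12 R.
have m21 := @measurable_pp21 R; have m22 := @measurable_pp22 R.
apply: measurableI.
  exact: (measurable_comp_pair m21 m22 mA).
exact: (measurable_comp_pair (measurable_funB m21 m11) (measurable_funB m22 m12) mB).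
Qed.

Lemma xsection_overlap A B w :
  xsection (overlap A B) w = (A : set (plane R)) `&` (fun x => pdiff x w) @^-1` B.
Proof.
by apply/seteqP; split => x; rewrite /xsection /= inE /overlap /= -surjective_pairing.
Qed.

(** By Tonelli: for fixed x in [A], the reflection taking w to x - w preserves area, so the
    w-section has the area of [B]. *)
Lemma area_mul_overlap (A B : set (bplane R)) : measurable A -> measurable B ->
  area (B : set (plane R)) \is a fin_num ->
  (\int[@area R]_w area ((A : set (plane R)) `&` (fun x => pdiff x w) @^-1` B) =
   area (A : set (plane R)) * area (B : set (plane R)))%E.
Proof.
move=> mA mB Bfin.
have mB' := borel_plane_measurable mB; have mA' := borel_plane_measurable mA.
transitivity (\int[@area R]_w area (xsection (overlap A B) w))%E.
  by apply: eq_integral => w _; rewrite xsection_overlap.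
rewrite (integral_sections area area (measurable_overlap mA mB)).
transitivity (\int[@area R]_x ((fine (area (B : set (plane R))))%:E *
    (\1_(A : set (plane R)) x)%:E))%E.
  apply: eq_integral => x _; rewrite indicE.
  have [Ax|Ax] := pselect (A x).
    rewrite (mem_set (Ax : (A : set (plane R)) x)) mule1 fineK// -(mpres_area (mpres_reflection x) mB'); congr area.
    apply/seteqP; split => w; rewrite /ysection /= inE /overlap /= -surjective_pairing.
      by case.
    by split.
  rewrite (memNset (Ax : ~ (A : set (plane R)) x)) mule0; have -> : ysection (overlap A B) x = set0.
    apply/seteqP; split => // w; rewrite /ysection /= inE /overlap /= -surjective_pairing.
    by case.
  exact: (measure0 area).
rewrite integral_cst_indic; [|by apply: fine_ge0; exact: mu_ext_ge0|exact: mA'].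
by rewrite fineK// muleC.
Qed.

Lemma sum_area_trivIset (n : nat) (F : nat -> set (plane R)) X :
  (forall k, measurable (F k)) -> trivIset setT F ->
  (forall k, (k < n)%N -> F k `<=` X) -> (\sum_(k < n) area (F k) <= area X)%E.
Proof.
move=> mF tF FX; rewrite -(measure_bigsetU (@area R) mF tF); apply: le_area.
by rewrite -bigcup_mkord => x [k /= kn]; exact: FX.
Qed.

(* Integrate over [w] the area of the pairs with difference [w]. As [(x, w) |-> x - w]
   need not be measurable for the product of the Lebesgue sigma-algebras, the sets
   are first replaced by Borel subsets of full measure. *)
Lemma sum_area_mul_le (n : nat) (A B : nat -> set (plane R)) W (c : R) : 0 <= c ->
  (forall k, measurable (A k)) -> (forall k, measurable (B k)) -> measurable W ->
  (forall k, area (B k) \is a fin_num) -> trivIset setT A ->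
  (forall k x y, (k < n)%N -> A k x -> B k y -> W (pdiff x y)) ->
  (forall w, W w -> exists2 X, (area X <= c%:E)%E &
     forall k, (k < n)%N -> A k `&` (fun x => pdiff x w) @^-1` B k `<=` X) ->
  (\sum_(k < n) area (A k) * area (B k) <= c%:E * area W)%E.
Proof.
move=> c0 mA mB mW Bfin tA hW hX.
have [A' hA'] := choice (fun k => borel_core (mA k)).
have [B' hB'] := choice (fun k => borel_core (mB k)).
have mA' k : measurable (A' k) by case: (hA' k).
have mB' k : measurable (B' k) by case: (hB' k).
have sA k : A' k `<=` A k by case: (hA' k).
have sB k : B' k `<=` B k by case: (hB' k).
have eA k : area (A' k : set (plane R)) = area (A k) by case: (hA' k).
have eB k : area (B' k : set (plane R)) = area (B k) by case: (hB' k).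
pose f k w := area ((A' k : set (plane R)) `&` (fun x => pdiff x w) @^-1` (B' k)).
have mf k : measurable_fun setT (f k).
  have -> : f k = @area R \o xsection (overlap (A' k) (B' k)).
    by apply/funext => w; rewrite /f /= xsection_overlap.
  exact: (measurable_fun_xsection (@area R) (measurable_overlap (mA' k) (mB' k))).
have f0 k w : (0 <= f k w)%E by exact: mu_ext_ge0.
have -> : (\sum_(k < n) area (A k) * area (B k) = \sum_(k < n) \int[@area R]_w f k w)%E.
  apply: eq_bigr => k _; rewrite -eA -eB area_mul_overlap//.
  by rewrite eB.
rewrite -(ge0_integral_sum area measurableT (f := fun (k : 'I_n) w => f k w))//.
rewrite -(integral_cst_indic area c0 mW).
apply: ge0_le_integral; [exact: measurableT| | | |].
- by move=> w _; apply: sume_ge0.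
- by apply: emeasurable_sum => k; exact: mf.
- exact: measurable_cst_indic.
move=> w _; rewrite indicE; have [Ww|Ww] := pselect (W w); last first.
  rewrite memNset// mule0 big1// => k _; rewrite /f.
  suff -> : (A' k : set (plane R)) `&` (fun x => pdiff x w) @^-1` (B' k) = set0.
    exact: (measure0 area).
  apply/seteqP; split => // x [/sA Ax /sB Bx]; case: Ww.
  have -> : w = pdiff x (pdiff x w).
    by rewrite [LHS]surjective_pairing /pdiff /=; congr (_, _); ring.
  exact: hW Ax Bx.
rewrite mem_set// mule1; have [X Xc hk] := hX w Ww.
have mF k : measurable ((A' k : set (plane R)) `&` (fun x => pdiff x w) @^-1` (B' k)).
  apply: measurableI; first exact: borel_plane_measurable.
  by apply: measurable_preimage_pdiff; exact: borel_plane_measurable.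
apply: le_trans Xc.
apply: (@sum_area_trivIset n (fun k => (A' k : set (plane R)) `&`
   (fun x => pdiff x w) @^-1` (B' k))) => //.
  apply/trivIsetP => i j _ _ ij; apply/seteqP; split => // x [[/sA Ai _] [/sA Aj _]].
  by move/trivIsetP : tA => /(_ i j I I ij) <-; split.
move=> k kn x [Ax Bx]; apply: (hk k kn); split; [exact: sA|exact: sB].
Qed.

End poincare.

(* [K] is one more than the last index at which [g] reaches [b]. *)
Lemma threshold {R : realDomainType} (g : nat -> R) (n : nat) (a b : R) :
  (forall k l, (k <= l)%N -> (l < n)%N -> g l <= g k + (b - a)) ->
  exists K, forall k, (k < n)%N -> ((k < K)%N -> a <= g k) /\ ((K <= k)%N -> g k < b).
Proof.
elim: n => [|n IH] h; first by exists 0%N.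
have [gn|gn] := leP b (g n).
  exists n.+1 => k kn; split; last by rewrite leqNgt kn.
  move=> _; have := h k n kn (ltnSn n).
  by move=> gk; rewrite -(lerD2r (b - a)) addrC subrK (le_trans gn).
have [K hK] := IH (fun k l kl ln => h k l kl (ltnW ln)).
exists (minn K n) => k; rewrite ltnS leq_min => kn; split.
  by move=> /andP[kK kn']; case: (hK k kn') => /(_ kK).
rewrite leq_eqVlt in kn; case/orP: kn => [/eqP -> //|kn'].
by rewrite geq_min [(n <= k)%N]leqNgt kn' orbF; case: (hK k kn').
Qed.

(** * Strips parallel to the still direction *)

Section box_area.
Context {R : realType}.
Implicit Types (E : set (plane R)) (x w : plane R).

(** The disc contains the open unit square. Covering the disc by strips then bounds the area of one
    strip from below. *)
Lemma area_eball1_ge1 : (1 <= area (@eball R 1))%E.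
Proof.
pose I : set (measurableTypeR R) := `](- (1 / 2)), (1 / 2)[%classic.
have mI : measurable I by exact: measurable_itv.
have mII : measurable (I `*` I : set (bplane R)) by exact: measurableX.
have <- : area (I `*` I : set (plane R)) = 1%E.
  rewrite (area_borel mII).
  transitivity (lebesgue_measure I * lebesgue_measure I)%E.
    exact: (product_measure1E lebesgue_measure lebesgue_measure mI mI).
  rewrite lebesgue_measure_itv /=.
  by rewrite lte_fin ifT -?EFinB -?EFinM; [congr EFin; field|lra].
apply: le_area => x [/=]; rewrite /I /= !in_itv /= => /andP[a1 a2] /andP[b1 b2].
apply: le_lt_trans (enorm_le_add x) _.
have h1 : `|x.1| < 1 / 2 by rewrite ltr_norml a1.
have h2 : `|x.2| < 1 / 2 by rewrite ltr_norml b1.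
by lra.
Qed.

Variables e v : plane R.
Hypotheses (ee : dotp e e = 1) (vv : dotp v v = 1) (ev : dotp e v = 0).
Hypothesis basis : forall x, pmove (pscale (dotp x e) e) (pscale (dotp x v) v) = x.
Variable t : R.

Definition box (a b : R) : set (plane R) :=
  [set x | a <= dotp x e < a + t /\ b <= dotp x v < b + 2].

Lemma dotp_basis x : dotp x x = dotp x e ^+ 2 + dotp x v ^+ 2.
Proof. by rewrite -{2}(basis x) /dotp /pmove /pscale /=; ring. Qed.

Lemma dotp_pdiff x w u : dotp (pdiff x w) u = dotp x u - dotp w u.
Proof. by rewrite /dotp /pdiff /=; ring. Qed.

Lemma enorm_lt_sqr x c : 0 < c -> (enorm x < c) = (dotp x e ^+ 2 + dotp x v ^+ 2 < c ^+ 2).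
Proof.
by move=> c0; rewrite -dotp_basis -sqr_enorm ltr_pXn2r// ?nnegrE ?enorm_ge0// ltW.
Qed.

Lemma measurable_dotp w : measurable_fun setT (fun x => dotp x w).
Proof.
have m1 : measurable_fun setT (fun x : bplane R => dotp x w).
  apply: measurable_funD; apply: measurable_funM => //.
have [mid _ _ _] := transports_plane_borel (R := R).
exact: measurableT_comp m1 mid.
Qed.

Lemma measurable_box a b : measurable (box a b).
Proof.
have -> : box a b = ((fun x => dotp x e) @^-1` `[a, a + t[%classic) `&`
    ((fun x => dotp x v) @^-1` `[b, b + 2[%classic).
  by apply/seteqP; split => x; rewrite /box /= !in_itv.
have mp (u : plane R) (I : interval R) :
    measurable ((fun x => dotp x u) @^-1` [set` I]).
  by rewrite -[X in measurable X]setTI; apply: measurable_dotp => //; exact: measurable_itv.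
by apply: measurableI; exact: mp.
Qed.

(** The boxes differ by a translation with coordinates [a] and [b] in the frame. *)
Lemma area_box a b : area (box a b) = area (box 0 0).
Proof.
rewrite -(mpres_area (mpres_pdiff (pmove (pscale a e) (pscale b v))) (measurable_box 0 0)).
congr area; apply/seteqP; split => x; rewrite /box /= !dotp_pdiff.
  have -> : dotp (pmove (pscale a e) (pscale b v)) e = a * dotp e e + b * dotp e v.
    by rewrite /dotp /pmove /pscale /=; ring.
  have -> : dotp (pmove (pscale a e) (pscale b v)) v = a * dotp e v + b * dotp v v.
    by rewrite /dotp /pmove /pscale /=; ring.
  by rewrite ee ev vv; lra.
have -> : dotp (pmove (pscale a e) (pscale b v)) e = a * dotp e e + b * dotp e v.
  by rewrite /dotp /pmove /pscale /=; ring.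
have -> : dotp (pmove (pscale a e) (pscale b v)) v = a * dotp e v + b * dotp v v.
  by rewrite /dotp /pmove /pscale /=; ring.
by rewrite ee ev vv; lra.
Qed.

Definition strip (k : nat) := box (-1 + k%:R * t) (-1).

Lemma trivIset_strip : 0 < t -> trivIset setT strip.
Proof.
move=> t0; apply: ltn_trivIset => j i ji; apply/seteqP; split => // x.
rewrite /strip /box => -[[/andP[_ h1] _] [/andP[h2 _] _]].
have : (i.+1%:R : R) <= j%:R by rewrite ler_nat.
move=> /(ler_wpM2r (ltW t0)); rewrite -natr1 mulrDl mul1r => h.
by move: h h1 h2; clear => h h1 h2; lra.
Qed.

Lemma strip_cover x : 0 < t -> enorm x < 1 -> strip (Num.truncn ((dotp x e + 1) / t)) x.
Proof.
move=> t0; rewrite enorm_lt_sqr// expr1n => h.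
have sq (a b : R) : a ^+ 2 + b ^+ 2 < 1 -> -1 < a < 1.
  move=> ab; have b0 := sqr_ge0 b; rewrite -ltr_norml -(ltr_pXn2r (n := 2)) ?nnegrE//.
  by rewrite real_normK ?num_real// expr1n; lra.
have /andP[e1 e2] := sq _ _ h; have /andP[v1 v2] : -1 < dotp x v < 1.
  by apply: (sq _ (dotp x e)); rewrite addrC.
have y0 : 0 <= (dotp x e + 1) / t by rewrite divr_ge0 ?(ltW t0)//; lra.
have /andP[] := truncn_itv y0; rewrite /strip /box /=; set k := Num.truncn _.
rewrite ler_pdivlMr// ltr_pdivrMr// -natr1 mulrDl mul1r => h1 h2.
by split; apply/andP; split; lra.
Qed.

Lemma strip_sub_eball k : 0 < t -> k.+1%:R * t <= 3 -> strip k `<=` eball 3.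
Proof.
move=> t0; rewrite -natr1 mulrDl mul1r => kt x [/andP[h1 h2] /andP[h3 h4]].
rewrite /eball /= enorm_lt_sqr//.
have k0 : 0 <= k%:R * t by rewrite mulr_ge0// ltW.
have sq (y c : R) : -c <= y <= c -> y ^+ 2 <= c ^+ 2.
  by move=> yc; rewrite -ler_sqrt ?sqr_ge0// !sqrtr_sqr (le_trans _ (ler_norm c))// ler_norml.
have s1 : dotp x e ^+ 2 <= 2 ^+ 2 by apply: sq; apply/andP; split; lra.
have s2 : dotp x v ^+ 2 <= 1 ^+ 2 by apply: sq; apply/andP; split; lra.
by rewrite !expr2 in s1 s2 *; lra.
Qed.

End box_area.

(** * From almost monotone strips to a halfplane *)

Section halfplane_close.
Context {R : realType}.
Implicit Types (E : set (plane R)) (x w : plane R).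

(** Let m be the area of a strip and g_k that of [E] in the k-th one. Filling a strip with g_k >=
    m/2 costs m - g_k, emptying one with g_k < 3m/4 costs g_k, and both are at most 4 g_k (m - g_k)
    / m. As the g_k (m - g_k) sum to at most 342 d * 4m, the total is 342 * 16 d. *)
Lemma halfplane_close E (d : R) : measurable E -> 0 < d <= 1 / 12 -> flux_bound E d ->
  exists h, halfplane h /\
    (area (((E `\` h) `|` (h `\` E)) `&` eball 1) <= (342 * 16 * d)%:E)%E.
Proof.
move=> mE /andP[d0 d12] hE.
have d01 : 0 < d <= 1 by rewrite d0; move: d12; clear => *; lra.
have [e [v [[ee vv ev basis] [hrise hchg]]]] := good_frame mE d01 hE.
(* Then 2 < N d <= 3: the [N] strips cover B_1 and stay inside B_3. *)
pose N := (Num.truncn (2 / d)).+1.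
have dge : 0 <= 2 / d by rewrite divr_ge0// ltW.
have /andP[N1 N2] := truncn_itv dge.
have Nd2 : 2 < N%:R * d by rewrite -ltr_pdivrMr.
have Nd3 : N%:R * d <= 3.
  rewrite ler_pdivlMr// in N1.
  by rewrite /N -natr1 mulrDl mul1r; move: N1 d12; clear => *; lra.
pose S := strip e v d.
have mS k : measurable (S k) by exact: measurable_box.
have SB k : (k < N)%N -> S k `<=` eball 3.
  move=> kN; apply: strip_sub_eball => //; apply: le_trans Nd3.
  by rewrite ler_wpM2r ?(ltW d0)// ler_nat.
pose m := fine (area (S 0%N)).
have S0fin : area (S 0%N) \is a fin_num.
  have -> : S 0%N = eball 3 `&` S 0%N by rewrite setIidr//; exact: SB.
  exact: area_ball_fin.
have aS k : area (S k) = m%:E.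
  rewrite /m fineK//; transitivity (area (box e v d 0 0)); first exact: area_box.
  by apply/esym; exact: area_box.
have m0 : 0 <= m by apply: fine_ge0; exact: mu_ext_ge0.
have finS k X : area (S k `&` X) \is a fin_num.
  rewrite ge0_fin_numE; last exact: mu_ext_ge0.
  by apply: (le_lt_trans (le_area (@subIsetl _ _ _))); rewrite aS ltry.
pose g k := fine (area (S k `&` E)).
have aA k : area (S k `&` E) = (g k)%:E by rewrite /g fineK.
have g0 k : 0 <= g k by apply: fine_ge0; exact: mu_ext_ge0.
have mA k : measurable (S k `&` E) by apply: measurableI; [exact: mS|exact: mE].
have mB k : measurable (S k `&` ~` E).
  by apply: measurableI; [exact: mS|exact: measurableC].
have aB k : area (S k `&` ~` E) = (m - g k)%:E.
  have : area (S k) = (area (S k `&` E) + area (S k `&` ~` E))%E.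
    rewrite -(measureU area (mA k) (mB k)).
      by rewrite -setIUr setUCr setIT.
    by apply/seteqP; split => // x [[_ ?] []].
  rewrite aS aA -(fineK (finS k (~` E))) -EFinD => -[->].
  by rewrite addrC addKr.
have gm k : g k <= m by rewrite -lee_fin -aA -(aS k); apply: le_area; exact: subIsetl.
have tS : trivIset setT S by exact: trivIset_strip.
have tSI X : trivIset setT (fun k => S k `&` X).
  apply/trivIsetP => i j _ _ ij; apply/seteqP; split => // x [[Si _] [Sj _]].
  by move/trivIsetP : tS => /(_ i j I I ij) <-; split.
(* Two points of one strip differ by less than [d] along [e] and less than 2 along [v], so their
   difference lies in four boxes congruent to a strip. *)
pose W := (box e v d (- d) (-2) `|` box e v d (- d) 0) `|` (box e v d 0 (-2) `|` box e v d 0 0).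
have mW : measurable W.
  by apply: measurableU; apply: measurableU; exact: measurable_box.
have abox a b : area (box e v d a b) = m%:E.
  rewrite -(aS 0%N) (area_box ee vv ev) -(area_box ee vv ev d (-1 + 0%:R * d) (-1)) //.
have aW : (area W <= (4 * m)%:E)%E.
  have -> : 4 * m = (m + m) + (m + m) by ring.
  rewrite /W !EFinD; apply: (le_trans (area_setU_le _ _)).
  apply: leeD; apply: (le_trans (area_setU_le _ _)); rewrite !abox //.
have hsum : \sum_(k < N) g k * (m - g k) <= 342 * d * (4 * m).
  have c0 : 0 <= 342 * d := mulr_ge0 (ler0n R 342) (ltW d0).
  have := @sum_area_mul_le R N (fun k => S k `&` E) (fun k => S k `&` ~` E) W (342 * d) c0
    mA mB mW (fun k => finS k _) (tSI E).
  have -> : (\sum_(k < N) area (S k `&` E) * area (S k `&` ~` E) =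
      (\sum_(k < N) g k * (m - g k))%:E)%E.
    by rewrite -sumEFin; apply: eq_bigr => k _; rewrite aA aB EFinM.
  move=> hs; rewrite -lee_fin; apply: (@le_trans _ _ ((342 * d)%:E * area W)%E).
    apply: hs => [k x y kN [[/andP[a1 a2] /andP[a3 a4]] _] [[/andP[b1 b2] /andP[b3 b4]] _]|w Ww].
      rewrite /W /setU /box /= !dotp_pdiff.
      have [ha|ha] := leP 0 (dotp x e - dotp y e); have [hb|hb] := leP 0 (dotp x v - dotp y v).
      - by right; right; move: a1 a2 a3 a4 b1 b2 b3 b4; clear => *; split; apply/andP; split; lra.
      - by right; left; move: a1 a2 a3 a4 b1 b2 b3 b4 hb; clear => *; split; apply/andP; split; lra.
      - by left; right; move: a1 a2 a3 a4 b1 b2 b3 b4 ha; clear => *; split; apply/andP; split; lra.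
      - by left; left; move: a1 a2 a3 a4 b1 b2 b3 b4 ha hb; clear => *; split; apply/andP; split; lra.
    exists (eball 3 `&` changes E w).
      rewrite -{1}(basis w); apply: hchg; rewrite ler_norml.
        by case: Ww => -[] [/andP[h1 h2] _]; apply/andP; move: h1 h2 d0; clear => *; split; lra.
      by case: Ww => -[] [_ /andP[h1 h2]]; apply/andP; move: h1 h2; clear => *; split; lra.
    by move=> k kN x [[Sx Ex] [_ nE]]; split; [exact: (SB k kN)|left].
  by rewrite [in leRHS]EFinM; apply: lee_wpmul2l => //; rewrite lee_fin.
(* From one strip to the next, g grows at most by the area of the rise in the new strip. The strips
   are disjoint, so all increments together are at most d^2, however far apart k and l are. *)
have rgt k l : (k <= l)%N -> (l < N)%N -> g l <= g k + d * d.
  move=> kl lN; pose rho i := fine (area (S i `&` rise E (pscale d e))).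
  have arho i : area (S i `&` rise E (pscale d e)) = (rho i)%:E by rewrite /rho fineK.
  have rho0 i : 0 <= rho i by apply: fine_ge0; exact: mu_ext_ge0.
  have stp i : g i.+1 <= g i + rho i.+1.
    rewrite -lee_fin EFinD -aA -arho -aA.
    rewrite -(mpres_area (mpres_pdiff (pscale d e)) (mA i)).
    apply: area_cover_le => x [Sx Ex].
    have [Ep|Ep] := pselect (E (pdiff x (pscale d e))); last by right.
    left; split => //; move: Sx; rewrite /S /strip /box /= !dotp_pdiff.
    have -> : dotp (pscale d e) e = d * dotp e e by rewrite /dotp /pscale /=; ring.
    have -> : dotp (pscale d e) v = d * dotp e v by rewrite /dotp /pscale /=; ring.
    rewrite ee ev mulr0 mulr1 -natr1 subr0 mulrDl mul1r => -[/andP[h1 h2] h3].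
    by split => //; apply/andP; move: h1 h2; clear => *; split; lra.
  have tel : g l <= g k + \sum_(i < l.+1) rho i.
    suff : g l <= g k + \sum_(k <= i < l) rho i.+1.
      move=> /le_trans; apply; rewrite lerD2l big_ord_recl /= -[X in X <= _]add0r lerD//.
      rewrite -(big_mkord xpredT (fun i => rho i.+1)) [leRHS](big_cat_nat (n := k))//=.
      by rewrite lerDr sumr_ge0.
    elim: l kl {lN} => [|l IH]; first by rewrite leqn0 => /eqP ->; rewrite big_geq// addr0.
    rewrite leq_eqVlt => /orP[/eqP ->|kl]; first by rewrite big_geq// addr0.
    rewrite big_nat_recr//=; apply: (le_trans (stp l)).
    by rewrite addrA lerD2r IH.
  apply: (le_trans tel); rewrite lerD2l -lee_fin -sumEFin.
  apply: le_trans hrise.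
  rewrite (eq_bigr (fun i : 'I_l.+1 => area (S i `&` rise E (pscale d e)))); last first.
    by move=> i _; rewrite arho.
  apply: (sum_area_trivIset _ (tSI _)).
    by move=> i; apply: measurableI; [exact: mS|exact: measurable_rise].
  move=> i il x [Sx rx]; split => //; have := SB i (leq_trans il lN) _ Sx.
  by rewrite /eball /=; lra.
have cover x : eball 1 x -> exists2 k, (k < N)%N & S k x.
  move=> x1; exists (Num.truncn ((dotp x e + 1) / d)); last exact: strip_cover.
  have := strip_cover basis d0 x1; rewrite /strip /box; set k := Num.truncn _.
  move=> -[/andP[h1 _] _]; rewrite -(ltr_nat R) -(ltr_pM2r d0).
  have : dotp x e < 1.
    have := dotp_basis basis x; rewrite -sqr_enorm => hx.
    move: x1; rewrite /eball /= => x1.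
    have x0 := enorm_ge0 x; have v0 := sqr_ge0 (dotp x v).
    rewrite ltNge; apply/negP => he.
    have : 1 <= dotp x e ^+ 2 by rewrite expr_ge1// (le_trans ler01).
    have : enorm x ^+ 2 < 1 by rewrite expr_lt1.
    by rewrite hx; move: v0; clear => *; lra.
  by move: h1 Nd2; clear => *; lra.
have sumU (T : nat -> set (plane R)) X : (forall x, X x -> exists2 k, (k < N)%N & T k x) ->
    (area X <= \sum_(k < N) area (T k))%E.
  move=> XT; apply: le_trans (outer_measure_subadditive (borel_area R)^*%mu T N).
  apply: le_area => x /XT[k kN Tx]; rewrite -bigcup_mkord; by exists k.
(* From 1 <= |B_1| <= N m and N d <= 3. *)
have md : d <= 3 * m.
  have := le_trans area_eball1_ge1 (sumU S _ cover).
  rewrite (eq_bigr (fun=> m%:E)); last by move=> k _; rewrite aS.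
  rewrite sumEFin lee_fin sumr_const card_ord -[m *+ N]mulr_natl => h.
  have := ler_wpM2r (ltW d0) h; rewrite mul1r [_ * m * d]mulrAC => h1; apply: (le_trans h1).
  by rewrite ler_wpM2r.
have mpos : 0 < m by move: d0 md; clear => *; lra.
(* This is the origin of 1/12: d^2 <= d/12 <= m/4, the gap between the thresholds m/2 and 3m/4. *)
have dd : d * d <= m / 4.
  have := ler_wpM2l (ltW d0) d12; move: md; clear => *; lra.
have hth k l : (k <= l)%N -> (l < N)%N -> g l <= g k + (3 * m / 4 - m / 2).
  move=> kl lN; apply: (le_trans (rgt _ _ kl lN)); rewrite lerD2l.
  by move: dd; clear => *; lra.
have [K hK] := threshold hth.
exists [set x | dotp x e < -1 + K%:R * d]; split.
  by exists e, (-1 + K%:R * d); split => //; rewrite /enorm ee sqrtr1.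
(* The boundary of the halfplane separates strip K - 1 from strip K, so each strip lies wholly on
   one side and [T k] contains the error inside it. *)
pose T k := if (k < K)%N then S k `&` ~` E else S k `&` E.
apply: (@le_trans _ _ (\sum_(k < N) area (T k))%E).
  apply: sumU => x [hx xB]; have [k kN Sx] := cover x xB; exists k => //.
  have [/andP[h1 h2] _] := Sx; rewrite /T; case: ifPn => kK.
    split => //; case: hx => -[] // Ex /= nh; exfalso; apply: nh.
    have : (k.+1%:R : R) <= K%:R by rewrite ler_nat.
    move=> /(ler_wpM2r (ltW d0)); rewrite -natr1 mulrDl mul1r.
    by move: h2; clear => *; lra.
  split => //; case: hx => -[] // /= hh _; exfalso; move: hh.
  have : (K%:R : R) <= k%:R by rewrite ler_nat leqNgt.
  move=> /(ler_wpM2r (ltW d0)) hKk; apply/negP; rewrite -leNgt.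
  by move: hKk h1; clear => *; lra.
pose tau k := if (k < K)%N then m - g k else g k.
rewrite (eq_bigr (fun k : 'I_N => (tau k)%:E)); last first.
  by move=> k _; rewrite /T /tau; case: ifP => _; rewrite ?aA ?aB.
rewrite sumEFin lee_fin -(ler_pM2l mpos) mulr_sumr.
apply: (@le_trans _ _ (\sum_(k < N) 4 * (g k * (m - g k)))).
  apply: ler_sum => k _; rewrite /tau; have [hlt hge] := hK k (ltn_ord k).
  have p0 : 0 <= m - g k by rewrite subr_ge0.
  have q0 := g0 k.
  have [kK|kK] := ltnP k K.
    have := hlt kK => hh; rewrite mulrA ler_wpM2r//.
    by move: hh m0; clear => *; lra.
  have h4 : m <= 4 * (m - g k) by move: (hge kK); clear => *; lra.
  by rewrite (mulrC m) mulrCA ler_wpM2l.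
rewrite -mulr_sumr; have := hsum; set sg := \sum_(k < N) _; clearbody sg.
by clear => h; lra.
Qed.

End halfplane_close.

(** * Choice of the constant and conclusion *)

Unset Implicit Arguments.

Theorem theorem1p8 (R : realType) (s : R) (s_gt0 : 0 < s) (s_lt : s < 1 / 2) :
  exists C : R, 0 < C /\
    forall (r : R), 2 <= r ->
    forall E : set (plane R), s_minimizer s (eball r) E ->
    exists h : set (plane R), halfplane h /\
      (area (((E `\` h) `|` (h `\` E)) `&` eball 1) <= (C / r `^ s)%:E)%E.
Proof.
have [C [C0 hC]] := minimizer_flux s_gt0 s_lt.
pose C1 := 4 * (128 * 10) `^ s.
have C10 : 0 < C1 by rewrite mulr_gt0// powR_gt0// mulr_gt0.
(* [C1] settles r < 1280, and 48 C settles C / r^s > 1/12: in both cases the bound is at least 4 >=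
   |B_1|, and any halfplane will do. The first term comes from [halfplane_close]. *)
exists (342 * 16 * C + 48 * C + C1); split.
  by move: C0 C10; clearbody C1; clear => *; lra.
move=> r r2 E Emin; have [mE _ _] := Emin.
have r0 : 0 < r by lra.
have rs0 : 0 < r `^ s by rewrite powR_gt0.
have trivial_case : 4 <= (342 * 16 * C + 48 * C + C1) / r `^ s ->
    exists h : set (plane R), halfplane h /\
      (area (((E `\` h) `|` (h `\` E)) `&` eball 1) <=
        ((342 * 16 * C + 48 * C + C1) / r `^ s)%:E)%E.
  move=> h4; exists [set x | dotp x (1, 0) < 0]; split.
    exists (1, 0), 0; split => //.
    by rewrite /enorm /dotp /= mulr1 mulr0 addr0 sqrtr1.
  apply: (@le_trans _ _ (area (@eball R 1))); first by apply: le_area => x [].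
  apply: (le_trans (area_eball_le ler01)).
  by rewrite expr1n mulr1 lee_fin.
have [rsmall|rbig] := ltP r (128 * 10).
  apply: trivial_case; rewrite ler_pdivlMr//.
  have : r `^ s <= (128 * 10) `^ s.
    apply: ge0_ler_powR; rewrite ?nnegrE ?(ltW s_gt0) ?(ltW r0) ?(ltW rsmall)//.
  rewrite /C1; move: C0; clear => C0 h; lra.
have [dbig|dsmall] := ltP (1 / 12) (C / r `^ s).
  apply: trivial_case; rewrite ler_pdivlMr//.
  move: dbig; rewrite ltr_pdivlMr//.
  by move: C0 C10; clearbody C1; clear => *; lra.
have d0 : 0 < C / r `^ s by rewrite divr_gt0.
have fb : flux_bound E (C / r `^ s).
  apply: flux_bound_directional => v t vv tb; apply: hC => //.
have [|h [hh hE]] := halfplane_close mE _ fb; first by rewrite d0.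
exists h; split => //; apply: (le_trans hE); rewrite lee_fin mulrA ler_pM2r ?invr_gt0//.
by move: C0 C10; clearbody C1; clear => *; lra.
Qed.
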